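(* (Comparison principle.) Let $p\in[2,\infty)\setminus\mathbb N$, $\alpha\in(\lfloor p\rfloor/p,1)$, $1<\kappa\le\frac1{1-\alpha+\lfloor p\rfloor/p}$, $q>\lfloor p\rfloor p\vee\frac\kappa{\kappa-1}$, $b\in\mathrm{Lip}_b(\mathbb R^e\times\mathbb R^\ell,\mathbb R^e)$, $\lambda\in C_b^{\lfloor p\rfloor+1}(\mathbb R^e\times\mathbb R^\ell,\mathcal L(\mathbb R^d,\mathbb R^e))$, $\eta\in C^\infty([0,T],\mathbb R^d)$, $f(x,y,u)=f(x,y)+\widetilde f(u)$ with $f\in\mathrm{Lip}_b(\mathbb R^e\times\mathbb R^\ell,\mathbb R)$ and $\widetilde f:\mathbb R^\ell\to\mathbb R$ continuous, $\widetilde f(u)\ge f_0|u|^q-C_0$ for some $f_0,C_0>0$, and $g:\mathbb R^e\to\mathbb R$ Lipschitz. Let $\varphi_1,\varphi_2:[0,T]\times\mathbb R^e\times AC^\alpha([0,T],\mathbb R^\ell)\to\mathbb R$ be continuous functionals for which there exist sequences $(\varphi_{1,n})_{n\in\mathbb N}$ and $(\varphi_{2,n})_{n\in\mathbb N}$ converging locally uniformly to $\varphi_1$ and $\varphi_2$, respectively. Assume that, for every $n\in\mathbb N$, $\varphi_{1,n}$ is a viscosity subsolution of the $n$-truncated problem, $\varphi_{2,n}$ is a viscosity supersolution of the $n$-truncated problem, both satisfy property (L), and $$\varphi_{1,n}(T,x,\gamma)=\varphi_{2,n}(T,x,\gamma)=g(x)\qquad\text{for every }(x,\gamma)\in\mathbb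 R^e\times AC^\alpha([0,T],\mathbb R^\ell).$$ Then $\varphi_1\le\varphi_2$ on $[0,T]\times\mathbb R^e\times AC^\alpha([0,T],\mathbb R^\ell)$.
   Context: **Spaces.** $\mathrm{Lip}_b$: bounded Lipschitz; $C^k_b$: bounded with bounded derivatives up to order $k$. $I^\alpha_{0^+}u(t)=\frac1{\Gamma(\alpha)}\int_0^t\frac{u_s}{(t-s)^{1-\alpha}}ds$. $AC^\alpha=AC^\alpha([0,T],\mathbb R^\ell)=\{\gamma:\gamma_t=\gamma_0+I^\alpha_{0^+}u(t),\ u\in L^\infty([0,T],\mathbb R^\ell)\}$; then $D^\alpha_{0^+}(\gamma-\gamma_0)=u$. $AC^\alpha_k=\{\gamma\in AC^\alpha:|\gamma_0|\le k,\ \|D^\alpha_{0^+}(\gamma-\gamma_0)\|_\infty\le k\}$. The space $[0,T]\times\mathbb R^e\times AC^\alpha$ carries the metric $\varrho((t,x,\gamma),(s,y,\nu))=\max\{|t-s|,|x-y|,|\gamma_0-\nu_0|+\|\gamma-\nu\|_{p/\lfloor p\rfloor\text{-var};[0,T]}\}$, where $\|\gamma\|_{r\text{-var};[0,T]}=(\sup_{\mathcal P}\sum_{[a,b]\in\mathcal P}|\gamma_b-\gamma_a|^r)^{1/r}$; ''locally uniformly'' means uniformly on compact subsets. **ci-derivatives.** $\varphi:[0,T]\times\mathbb R^e\times AC^\alpha\to\mathbb R$ is ci-differentiable of order $\alpha$ at $(t,x,\gamma)$, $t<T$, if there are $\frac{\partial^\alpha}{\partial t}\varphi(t,x,\gamma)\in\mathbb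 R$, $\nabla_x^\alpha\varphi(t,x,\gamma)\in\mathbb R^e$, $\nabla^\alpha_\gamma\varphi(t,x,\gamma)\in\mathbb R^\ell$ such that for every $\nu\in AC^\alpha$ with $\nu=\gamma$ on $[0,t]$, every $z\in(t,T)$, $y\in\mathbb R^e$: $\varphi(z,y,\nu)-\varphi(t,x,\gamma)=\frac{\partial^\alpha}{\partial t}\varphi\,(z-t)+\langle\nabla_x^\alpha\varphi,y-x\rangle+\langle\nabla_\gamma^\alpha\varphi,I^{1-\alpha}_{0^+}(\nu-\gamma_0)(z)-I^{1-\alpha}_{0^+}(\gamma-\gamma_0)(t)\rangle+o(z-t+|x-y|)$, the remainder possibly depending on $(t,x,\gamma,\nu)$. $\varphi$ is ci-smooth if it is ci-differentiable at every point with $t<T$ and $\varphi$ and its three derivatives are continuous with respect to $\varrho$. **Truncated problem.** For $n,k\in\mathbb N$ let $R_k(t)=k+\|b\|_\infty t+\|\lambda\|_\infty\int_0^t|\dot\eta_r|dr$, $\mathcal K^n_k=\{(t,x,\gamma)\in[0,T]\times\mathbb R^e\times AC^\alpha:|x|\le R_k(t),\ \gamma\in AC^\alpha_{n\vee k}\}$, $H_n(x,y,\phi)=\sup_{|u|\le n}\{-\langle\phi,u\rangle-f(x,y,u)\}$. A continuous $w:[0,T]\times\mathbb R^e\times AC^\alpha\to\mathbb R$ is a viscosity subsolution (resp. supersolution) of the $n$-truncated problem if $w(T,x,\gamma)\le g(x)$ (resp. $\ge$) and, for every $k\in\mathbb N$ and ci-smooth $\varphi$, whenever $w-\varphi$ has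 a local maximum (resp. minimum) on $\mathcal K^n_k$ at some $(t,x,\gamma)\in\mathcal K^n_k$ with $t<T$, then at $(t,x,\gamma)$ $$-\tfrac{\partial^\alpha}{\partial t}\varphi-\langle\nabla^\alpha_x\varphi,\,b(x,\gamma_t)+\lambda(x,\gamma_t)\dot\eta_t\rangle+H_n(x,\gamma_t,\nabla^\alpha_\gamma\varphi)\le0\quad(\text{resp. }\ge0).$$ **Property (L).** For $(s,\gamma)\in[0,T]\times AC^\alpha$ let $a(t\mid s,\gamma)=\gamma_t$ for $t\in[0,s]$ and $a(t\mid s,\gamma)=\gamma_0+\frac1{\Gamma(\alpha)}\int_0^s\frac{D^\alpha_{0^+}(\gamma-\gamma_0)(r)}{(t-r)^{1-\alpha}}dr$ for $t\in(s,T]$. A sequence member $w$ satisfies property (L) if for every $k\in\mathbb N$ there is $C_k>0$ (which may also depend on $w$, hence on $n$) such that for all $t\in[0,T]$, $x,y\in\overline{B(0,k)}$, $\gamma,\nu\in AC^\alpha_k$: $$|w(t,x,\gamma)-w(t,y,\nu)|\le C_k\Bigl(|x-y|+|a(T\mid t,\gamma)-a(T\mid t,\nu)|+\int_0^T\frac{|a(r\mid t,\gamma)-a(r\mid t,\nu)|}{(T-r)^{1-\alpha}}dr\Bigr).$$ *)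

(* Defs.v *)
From HB Require Import structures.
From mathcomp Require Import all_boot all_order all_algebra.
From mathcomp Require Import all_classical all_reals all_analysis.
From mathcomp Require Import ring lra.

Set Implicit Arguments.
Unset Strict Implicit.
Unset Printing Implicit Defensive.

Import Order.TTheory GRing.Theory Num.Theory.
Import numFieldNormedType.Exports.

Local Open Scope classical_set_scope.
Local Open Scope ring_scope.

(* R^n is 'cV[R]_n. The library norm `|x| of a column vector is the sup norm;
   it is used only for notions that depend on the topology or on the norm up
   to equivalence (continuity, boundedness, Lipschitz, derivatives, compactness).
   Every quantitative |x| of the text is the Euclidean norm enorm x. *)
Section euclidean.
Context {R : realType}.

Definition dot n (x y : 'cV[R]_n) : R := \sum_(i < n) x i 0 * y i 0.

Definition enorm n (x : 'cV[R]_n) : R := Num.sqrt (dot x x).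

Definition opnorm m n (A : 'M[R]_(m, n)) : R :=
  sup [set enorm (A *m v) | v in [set v : 'cV[R]_n | enorm v <= 1]].

End euclidean.

Section minkowski_sum.
Context {R : realType}.

Lemma convex_powR_sum (r a b x y : R) : 1 <= r -> 0 < a -> 0 < b ->
  0 <= x -> 0 <= y ->
  (x + y) `^ r <=
  (a + b) `^ r * (a / (a + b) * (x `^ r / a `^ r)
                  + b / (a + b) * (y `^ r / b `^ r)).
Proof.
move=> r1 a0 b0 x0 y0.
have ab0 : 0 < a + b by rewrite addr_gt0.
have t01 : 0 <= a / (a + b) <= 1.
  by rewrite divr_ge0 ?(ltW a0) ?(ltW ab0)//= ler_pdivrMr// mul1r lerDl ltW.
have /andP[t0 t1] := t01.
have tE : 1 - a / (a + b) = b / (a + b) by field; rewrite gt_eqF.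
have divE (u v : R) : 0 <= u -> 0 < v -> u `^ r / v `^ r = (u / v) `^ r.
  move=> u0 v0.
  rewrite powRM ?invr_ge0 ?(ltW v0)//; congr (_ * _).
  have : (v * v^-1) `^ r = 1 by rewrite divff ?gt_eqF// powR1.
  rewrite powRM ?invr_ge0 ?(ltW v0)// => vv1.
  have vr0 : v `^ r != 0 by rewrite gt_eqF// powR_gt0.
  by apply: (mulfI vr0); rewrite vv1 divff.
rewrite divE// divE//.
have xa0 : 0 <= x / a by rewrite divr_ge0// ltW.
have yb0 : 0 <= y / b by rewrite divr_ge0// ltW.
have xyE : x + y = (a + b) * (a / (a + b) * (x / a) + b / (a + b) * (y / b)).
  by field; rewrite !gt_eqF.
rewrite [in leLHS]xyE powRM ?(ltW ab0)//; last first.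
  by rewrite addr_ge0// mulr_ge0// -tE subr_ge0.
rewrite ler_wpM2l ?powR_ge0// -tE.
by have := @convex_powR R r r1 (Itv01 t0 t1) (x / a) (y / b);
   rewrite !convRE/=; apply; rewrite inE/= in_itv/= ?xa0 ?yb0.
Qed.

Lemma minkowski_sum (I : Type) (s : seq I) (P : pred I) (f g : I -> R)
    (r a b : R) : 1 <= r -> 0 < a -> 0 < b ->
  (forall i, 0 <= f i) -> (forall i, 0 <= g i) ->
  \sum_(i <- s | P i) f i `^ r <= a `^ r ->
  \sum_(i <- s | P i) g i `^ r <= b `^ r ->
  \sum_(i <- s | P i) (f i + g i) `^ r <= (a + b) `^ r.
Proof.
move=> r1 a0 b0 f0 g0 fa gb.
have ab0 : 0 < a + b by rewrite addr_gt0.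
apply: le_trans.
  by apply: ler_sum => i _; exact: (convex_powR_sum r1 a0 b0 (f0 i) (g0 i)).
rewrite -mulr_sumr ler_piMr ?powR_ge0//.
rewrite big_split/= -!mulr_sumr -!mulr_suml.
have le1 (u v : R) : 0 < v -> u <= v `^ r -> u / v `^ r <= 1.
  by move=> v0 uv; rewrite ler_pdivrMr ?powR_gt0// mul1r.
apply: (@le_trans _ _ (a / (a + b) + b / (a + b))).
  by rewrite lerD// ler_piMr ?divr_ge0 ?(ltW a0) ?(ltW b0) ?(ltW ab0)// le1.
by rewrite -mulrDl divff// gt_eqF.
Qed.

Lemma enorm_ge0 n (x : 'cV[R]_n) : 0 <= enorm x.
Proof. exact: sqrtr_ge0. Qed.

Lemma enorm0 n : enorm (0 : 'cV[R]_n) = 0.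
Proof.
by rewrite /enorm /dot big1 ?sqrtr0// => i _; rewrite mxE mul0r.
Qed.

Lemma enormN n (x : 'cV[R]_n) : enorm (- x) = enorm x.
Proof.
by rewrite /enorm /dot; congr Num.sqrt; apply: eq_bigr => i _; rewrite !mxE mulrNN.
Qed.

Lemma enorm_powR n (x : 'cV[R]_n) : enorm x `^ 2%:R = \sum_(i < n) `|x i 0| `^ 2%:R.
Proof.
rewrite powR_mulrn ?enorm_ge0// sqr_sqrtr; last first.
  by apply: sumr_ge0 => i _; rewrite -expr2 sqr_ge0.
by apply: eq_bigr => i _; rewrite powR_mulrn// real_normK ?num_real// expr2.
Qed.

Lemma enormD n (x y : 'cV[R]_n) : enorm (x + y) <= enorm x + enorm y.
Proof.
apply/ler_addgt0Pr => e e0.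
have e20 : 0 < e / 2 by rewrite divr_gt0.
have h (z : 'cV[R]_n) : \sum_(i < n) `|z i 0| `^ 2%:R <= (enorm z + e / 2) `^ 2%:R.
  rewrite -enorm_powR ge0_ler_powR ?nnegrE ?enorm_ge0//.
    by rewrite addr_ge0 ?enorm_ge0 ?ltW.
  by rewrite lerDl ltW.
have pos (z : 'cV[R]_n) : 0 < enorm z + e / 2.
  by rewrite ltr_wpDl ?enorm_ge0.
have := @minkowski_sum _ (index_enum 'I_n) xpredT (fun i => `|x i 0|)
  (fun i => `|y i 0|) 2%:R _ _ (ler1n _ _ : 1 <= 2%:R) (pos x) (pos y)
  (fun=> normr_ge0 _) (fun=> normr_ge0 _) (h x) (h y).
have sE : enorm x + e / 2 + (enorm y + e / 2) = enorm x + enorm y + e by field.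
rewrite sE => le2.
have s0 : 0 <= enorm x + enorm y + e by rewrite !addr_ge0 ?enorm_ge0 ?ltW.
rewrite -(@ler_pXn2r _ 2) ?nnegrE ?enorm_ge0//.
rewrite -!powR_mulrn ?enorm_ge0//; apply: le_trans le2.
rewrite enorm_powR; apply: ler_sum => i _.
by rewrite ge0_ler_powR ?nnegrE ?addr_ge0// mxE ler_normD.
Qed.

End minkowski_sum.

Section fractional.
Context {R : realType}.
Local Notation mu := (@lebesgue_measure R).

Definition Gamma (a : R) : R :=
  \int[mu]_(x in `]0, +oo[) (x `^ (a - 1) * expR (- x)).

(* I^a_{0+} u, computed componentwise *)
Definition fracI n (a : R) (u : R -> 'cV[R]_n) (t : R) : 'cV[R]_n :=
  \col_i ((Gamma a)^-1 *
          \int[mu]_(s in `[0, t]) (u s i 0 / (t - s) `^ (1 - a))).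

Definition Linf_norm n (T : R) (u : R -> 'cV[R]_n) : \bar R :=
  Lnorm mu +oo%E (fun s => (\1_(`[0, T]%classic : set R) s * enorm (u s))%:E).

Definition Linf n (T : R) (u : R -> 'cV[R]_n) : Prop :=
  (forall i, measurable_fun `[0, T] (fun s => u s i 0)) /\
  (Linf_norm T u < +oo)%E.

Definition is_fracD n (T a : R) (g u : R -> 'cV[R]_n) : Prop :=
  Linf T u /\ (forall t, 0 <= t <= T -> g t = g 0 + fracI a u t).

(* A map [0,T] -> R^n is encoded by its extension by 0 to the real line, so that
   two elements of ACpath are equal iff they agree on [0,T]. *)
Record ACpath (T a : R) (n : nat) := MkACpath {
  acfun :> R -> 'cV[R]_n;
  acfun_out : forall t, ~~ (0 <= t <= T) -> acfun t = 0;
  acfunP : exists u, is_fracD T a acfun u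
}.

(* the density u (unique up to a null set) such that g = g 0 + I^a u *)
Definition fracD T a n (g : ACpath T a n) : R -> 'cV[R]_n := sval (cid (acfunP g)).

Definition AC_ball (k : nat) T a n (g : ACpath T a n) : Prop :=
  enorm (g 0) <= k%:R /\ (Linf_norm T (fracD g) <= k%:R%:E)%E.

(* a(t | s, g) *)
Definition stopped T a n (s : R) (g : ACpath T a n) (t : R) : 'cV[R]_n :=
  if t <= s then g t else
  g 0 + \col_i ((Gamma a)^-1 *
          \int[mu]_(r in `[0, s]) (fracD g r i 0 / (t - r) `^ (1 - a))).

End fractional.

Section variation.
Context {R : realType}.
Local Open Scope ereal_scope.

Definition variation_sum n (r a b : R) (f : R -> 'cV[R]_n) (s : seq R) : R :=
  (let F := f \o nth b (a :: s) in
   \sum_(0 <= i < size s) enorm (F i.+1 - F i) `^ r)%R.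

Definition rvar n (r T : R) (f : R -> 'cV[R]_n) : \bar R :=
  (ereal_sup [set (variation_sum r 0 T f s)%:E | s in itv_partition 0%R T])
    `^ r^-1.

Lemma variation_sum_ge0 n (r a b : R) (f : R -> 'cV[R]_n) s :
  (0 <= variation_sum r a b f s)%R.
Proof. by apply: sumr_ge0 => i _; exact: powR_ge0. Qed.

Lemma rvar_ge0 n (r T : R) (f : R -> 'cV[R]_n) : 0 <= rvar r T f.
Proof. exact: poweR_ge0. Qed.

Lemma variation_sumN n (r a b : R) (f : R -> 'cV[R]_n) s :
  variation_sum r a b (fun t => - f t)%R s = variation_sum r a b f s.
Proof.
rewrite /variation_sum; apply: eq_bigr => i _ /=.
by rewrite -[X in _ = (X `^ _)%R]enormN opprB opprK addrC.
Qed.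

Lemma rvarN n (r T : R) (f : R -> 'cV[R]_n) :
  rvar r T (fun t => - f t)%R = rvar r T f.
Proof.
rewrite /rvar; suff -> : variation_sum r 0 T (fun t => - f t)%R =
  variation_sum r 0 T f by [].
by apply/funext => s; rewrite variation_sumN.
Qed.

Lemma rvar_leP n (r T c : R) (f : R -> 'cV[R]_n) : (1 <= r)%R -> (0 <= c)%R ->
  (forall s, itv_partition 0%R T s -> variation_sum r 0 T f s <= c `^ r)%R <->
  rvar r T f <= c%:E.
Proof.
move=> r1 c0; have r0 : (0 < r)%R by rewrite (lt_le_trans _ r1).
rewrite /rvar; set E := ereal_sup _.
split => [fc|Ec s sT].
  have ub : E <= (c `^ r)%:E.
    by apply: ge_ereal_sup => _ [s sT <-]; rewrite lee_fin fc.
  have [[s sT]|noT] := pselect (exists s, itv_partition 0%R T s); last first.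
    rewrite /E (_ : itv_partition 0%R T = set0) ?image_set0 ?ereal_sup0 ?poweRNyr ?gt_eqF ?invr_gt0 ?leNye//.
    by rewrite -subset0 => s sT; apply: noT; exists s.
  have E0 : 0 <= E.
    rewrite (@le_trans _ _ (variation_sum r 0 T f s)%:E)//.
      by rewrite lee_fin variation_sum_ge0.
    by apply: ereal_sup_ubound; exists s.
  have -> : c%:E = (c `^ r)%:E `^ r^-1.
    by rewrite poweR_EFin -powRrM divff ?gt_eqF// powRr1.
  apply: gt0_ler_poweR => //; first by rewrite invr_ge0 ltW.
    by rewrite in_itv/= leey E0.
  by rewrite in_itv/= leey lee_fin powR_ge0.
have fE : (variation_sum r 0 T f s)%:E <= E by apply: ereal_sup_ubound; exists s.
have E0 : 0 <= E by rewrite (le_trans _ fE)// lee_fin variation_sum_ge0.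
rewrite -lee_fin (le_trans fE)//.
have -> : E = (E `^ r^-1) `^ r.
  by rewrite -poweRrM mulVf ?gt_eqF// poweRe1.
rewrite -poweR_EFin; apply: gt0_ler_poweR => //; first exact: ltW.
  by rewrite in_itv/= leey poweR_ge0.
by rewrite in_itv/= leey lee_fin c0.
Qed.

End variation.

Section variation_triangle.
Context {R : realType}.
Local Open Scope ereal_scope.

Lemma rvar0 n (r T : R) : (1 <= r)%R -> rvar r T (fun=> 0%R : 'cV[R]_n) = 0.
Proof.
move=> r1; apply/eqP; rewrite eq_le rvar_ge0 andbT; apply/rvar_leP => // s _.
rewrite /variation_sum big1 ?powR_ge0// => i _ /=.
by rewrite subrr enorm0 powR0// gt_eqF// (lt_le_trans _ r1).
Qed.

Lemma rvarD n (r T : R) (f g : R -> 'cV[R]_n) : (1 <= r)%R ->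
  rvar r T (fun t => f t + g t)%R <= rvar r T f + rvar r T g.
Proof.
move=> r1.
have := rvar_ge0 r T f; have := rvar_ge0 r T g.
case Ef : (rvar r T f) => [a| |]//; case Eg : (rvar r T g) => [b| |]//;
  rewrite ?leey// !lee_fin => b0 a0.
apply/lee_addgt0Pr => e e0.
have e20 : (0 < e / 2)%R by rewrite divr_gt0.
have ae : (0 < a + e / 2)%R by rewrite ltr_wpDl.
have be : (0 < b + e / 2)%R by rewrite ltr_wpDl.
have -> : a%:E + b%:E + e%:E = ((a + e / 2) + (b + e / 2))%:E.
  by rewrite -!EFinD; congr EFin; field.
have le_c (c : R) (h : R -> 'cV[R]_n) s : itv_partition 0%R T s ->
    rvar r T h = c%:E -> (0 < c + e / 2)%R ->
    (variation_sum r 0 T h s <= (c + e / 2) `^ r)%R.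
  move=> sT hc c0; move: s sT; apply/rvar_leP => //; first exact: ltW.
  by rewrite hc lee_fin lerDl ltW.
apply/rvar_leP => //; first by rewrite addr_ge0 ?ltW.
move=> s sT.
have := minkowski_sum r1 ae be (fun=> enorm_ge0 _) (fun=> enorm_ge0 _)
  (le_c a f s sT Ef ae) (le_c b g s sT Eg be).
apply: le_trans; apply: ler_sum => i _ /=.
apply: ge0_ler_powR; rewrite ?nnegrE ?addr_ge0 ?enorm_ge0//.
  by rewrite (le_trans _ r1).
by rewrite (le_trans _ (enormD _ _))// opprD addrACA.
Qed.

End variation_triangle.

Section state_space.
Context {R : realType}.

Definition floor_ratio (p : R) : R := p / (Num.truncn p)%:R.

Lemma floor_ratio_ge1 (p : R) : 2 <= p -> 1 <= floor_ratio p.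
Proof.
move=> p2; have p0 : 0 <= p by rewrite (le_trans _ p2).
have tp : (Num.truncn p)%:R <= p by rewrite truncn_le.
have t0 : 0 < (Num.truncn p)%:R :> R.
  by rewrite ltr0n truncn_gt0 (le_trans _ p2)// ler1n.
by rewrite /floor_ratio ler_pdivlMr// mul1r.
Qed.

(* The space [0,T] x R^e x AC^a. The parameters p and hp do not affect the
   carrier; they determine the metric rho below. *)
Record state (p : R) (hp : 2 <= p) (T a : R) (e l : nat) := State {
  stime : R;
  spos : 'cV[R]_e;
  spath : ACpath T a l;
  stimeP : 0 <= stime <= T
}.

Context {p : R} {hp : 2 <= p} {T a : R} {e l : nat}.
Local Notation X := (state hp T a e l).

(* Valued in \bar R because the r-variation of an arbitrary function may be
   infinite; on AC^a it is finite when a > floor(p)/p. *)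
Definition path_dist (P Q : X) : \bar R :=
  ((enorm (spath P 0%R - spath Q 0%R)%R)%:E
   + rvar (floor_ratio p) T (fun t => spath P t - spath Q t)%R)%E.

Definition rho (P Q : X) : \bar R :=
  Order.max (`|stime P - stime Q|%R%:E)
    (Order.max ((enorm (spos P - spos Q)%R)%:E) (path_dist P Q)).

Definition rho_ball (P : X) (r : R) (Q : X) : Prop := (rho P Q < r%:E)%E.

Lemma rho_ball_center (P : X) (r : R) : 0 < r -> rho_ball P r P.
Proof.
move=> r0; rewrite /rho_ball /rho /path_dist !subrr normr0 !enorm0.
have -> : (fun t => spath P t - spath P t) = (fun=> 0).
  by apply/funext => t; rewrite subrr.
by rewrite rvar0 ?floor_ratio_ge1// adde0 !maxxx lte_fin.
Qed.

Lemma path_dist_sym (P Q : X) : path_dist P Q = path_dist Q P.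
Proof.
rewrite /path_dist -(enormN (spath P 0 - _)) opprB -rvarN.
have -> // : (fun t => - (spath P t - spath Q t)) = (fun t => spath Q t - spath P t).
by apply/funext => t; rewrite opprB.
Qed.

Lemma rho_sym (P Q : X) : rho P Q = rho Q P.
Proof.
by rewrite /rho distrC -(enormN (spos P - _)) opprB path_dist_sym.
Qed.

Lemma rho_ball_sym (P Q : X) (r : R) : rho_ball P r Q -> rho_ball Q r P.
Proof. by rewrite /rho_ball rho_sym. Qed.

Lemma path_dist_triangle (P Q S : X) :
  (path_dist P S <= path_dist P Q + path_dist Q S)%E.
Proof.
rewrite /path_dist addeACA; apply: leeD.
  by rewrite -EFinD lee_fin -(subrKA (spath Q 0)) enormD.
have -> : (fun t => spath P t - spath S t) =
    (fun t => (spath P t - spath Q t) + (spath Q t - spath S t)).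
  by apply/funext => t; rewrite subrKA.
exact: rvarD (floor_ratio_ge1 hp).
Qed.

Lemma rho_ballP (P Q : X) (r : R) : rho_ball P r Q <->
  [/\ `|stime P - stime Q| < r, enorm (spos P - spos Q) < r &
      (path_dist P Q < r%:E)%E].
Proof.
rewrite /rho_ball /rho gt_max gt_max lte_fin lte_fin.
by split=> [/and3P[]//|[-> -> ->]].
Qed.

Lemma rho_ball_triangle (P Q S : X) (r1 r2 : R) :
  rho_ball P r1 Q -> rho_ball Q r2 S -> rho_ball P (r1 + r2) S.
Proof.
move=> /rho_ballP[t1 x1 g1] /rho_ballP[t2 x2 g2]; apply/rho_ballP; split.
- rewrite -(subrKA (stime Q)); apply: le_lt_trans (ltrD t1 t2).
  exact: ler_normD.
- rewrite -(subrKA (spos Q)); apply: le_lt_trans (ltrD x1 x2).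
  exact: enormD.
- rewrite EFinD; apply: le_lt_trans (lteD g1 g2).
  exact: path_dist_triangle.
Qed.

HB.instance Definition _ := gen_eqMixin X.
HB.instance Definition _ := gen_choiceMixin X.
HB.instance Definition _ := hasNbhs.Build X (nbhs_ (entourage_ rho_ball)).
HB.instance Definition _ := @Nbhs_isPseudoMetric.Build R X
  (entourage_ rho_ball) erefl rho_ball
  rho_ball_center rho_ball_sym rho_ball_triangle erefl.

End state_space.

Section calculus.
Context {R : realType}.

(* f is continuous and bounded together with all its iterated directional
   derivatives up to order k *)
Fixpoint Cb (V W : normedModType R) (k : nat) (f : V -> W) : Prop :=
  continuous f /\ bounded_fun f /\
  if k is k'.+1 then
    forall v, (forall z, derivable f z v) /\ Cb k' (fun z => derive f z v)
  else True.

Definition Lipb (V W : normedModType R) (f : V -> W) : Prop :=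
  bounded_fun f /\ lipschitz f.

(* difference quotients within [0,T]: one-sided at the end points *)
Definition derive_on n (T : R) (f : R -> 'cV[R]_n) (t : R) : 'cV[R]_n :=
  lim ((fun s => (s - t)^-1 *: (f s - f t)) @ within `[0, T] t^').

Definition smooth_on n (T : R) (f : R -> 'cV[R]_n) : Prop :=
  exists F : nat -> R -> 'cV[R]_n,
    (forall t, 0 <= t <= T -> F 0%N t = f t) /\
    (forall j t, 0 <= t <= T ->
      (fun s => (s - t)^-1 *: (F j s - F j t)) @ within `[0, T] t^'
        --> F j.+1 t).

End calculus.

Section ci_derivatives.
Context {R : realType} {p : R} {hp : 2 <= p} {T a : R} {e l : nat}.
Local Notation X := (state hp T a e l).

(* dt, dx, dg are ci-derivatives of phi at P; the little-o is for Q -> P with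
   spath Q = nu fixed, so the threshold delta may depend on P and nu *)
Definition is_ci_derivative (phi : X -> R) (P : X)
    (dt : R) (dx : 'cV[R]_e) (dg : 'cV[R]_l) : Prop :=
  forall nu : ACpath T a l, (forall s, 0 <= s <= stime P -> nu s = spath P s) ->
  forall eps : R, 0 < eps -> exists2 delta : R, 0 < delta &
  forall Q : X, spath Q = nu -> stime P < stime Q < T ->
    stime Q - stime P + enorm (spos Q - spos P) < delta ->
    `| phi Q - phi P
       - (dt * (stime Q - stime P) + dot dx (spos Q - spos P)
          + dot dg (fracI (1 - a) (fun s => nu s - spath P 0) (stime Q)
                    - fracI (1 - a) (fun s => spath P s - spath P 0) (stime P))) |
    <= eps * (stime Q - stime P + enorm (spos Q - spos P)).

Definition ci_smooth (phi : X -> R)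
    (dt : X -> R) (dx : X -> 'cV[R]_e) (dg : X -> 'cV[R]_l) : Prop :=
  let A := [set P : X | stime P < T] in
  [/\ forall P, A P -> is_ci_derivative phi P (dt P) (dx P) (dg P),
      continuous phi,
      {within A, continuous dt},
      {within A, continuous dx} &
      {within A, continuous dg}].

End ci_derivatives.

Section viscosity.
Context {R : realType} {p : R} {hp : 2 <= p} {T a : R} {d e l : nat}.
Local Notation X := (state hp T a e l).
Local Notation mu := (@lebesgue_measure R).

Variables (b : 'cV[R]_e * 'cV[R]_l -> 'cV[R]_e)
          (lambda : 'cV[R]_e * 'cV[R]_l -> 'M[R]_(e, d))
          (eta : R -> 'cV[R]_d)
          (f : 'cV[R]_e -> 'cV[R]_l -> 'cV[R]_l -> R)
          (g : 'cV[R]_e -> R).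

Definition tube_radius (k : nat) (t : R) : R :=
  k%:R + sup [set enorm (b z) | z in setT] * t
  + sup [set opnorm (lambda z) | z in setT]
    * \int[mu]_(r in `[0, t]) enorm (derive_on T eta r).

Definition trunc_domain (n k : nat) : set X :=
  [set P | enorm (spos P) <= tube_radius k (stime P) /\ AC_ball (maxn n k) (spath P)].

Definition hamiltonian (n : nat) (x : 'cV[R]_e) (y phi : 'cV[R]_l) : R :=
  sup [set - dot phi u - f x y u | u in [set u : 'cV[R]_l | enorm u <= n%:R]].

Definition hjb (n : nat) (P : X) (dt : R) (dx : 'cV[R]_e) (dg : 'cV[R]_l) : R :=
  let x := spos P in let y := spath P (stime P) in
  - dt - dot dx (b (x, y) + lambda (x, y) *m derive_on T eta (stime P))
  + hamiltonian n x y dg.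

(* (0 < k)%N below: indices in N are positive integers *)
Definition viscosity_subsolution (n : nat) (w : X -> R) : Prop :=
  [/\ continuous w,
      forall P, stime P = T -> w P <= g (spos P) &
      forall (k : nat) phi dt dx dg, (0 < k)%N -> ci_smooth phi dt dx dg ->
      forall P, trunc_domain n k P -> stime P < T ->
      (\forall Q \near within (trunc_domain n k) (nbhs P),
        w Q - phi Q <= w P - phi P) ->
      hjb n P (dt P) (dx P) (dg P) <= 0].

Definition viscosity_supersolution (n : nat) (w : X -> R) : Prop :=
  [/\ continuous w,
      forall P, stime P = T -> g (spos P) <= w P &
      forall (k : nat) phi dt dx dg, (0 < k)%N -> ci_smooth phi dt dx dg ->
      forall P, trunc_domain n k P -> stime P < T ->
      (\forall Q \near within (trunc_domain n k) (nbhs P),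
        w P - phi P <= w Q - phi Q) ->
      0 <= hjb n P (dt P) (dx P) (dg P)].

Definition property_L (w : X -> R) : Prop :=
  forall k : nat, (0 < k)%N -> exists2 C : R, 0 < C &
  forall P Q : X, stime P = stime Q ->
    enorm (spos P) <= k%:R -> enorm (spos Q) <= k%:R ->
    AC_ball k (spath P) -> AC_ball k (spath Q) ->
    let D r := enorm (stopped (stime P) (spath P) r
                      - stopped (stime P) (spath Q) r) in
    `| w P - w Q | <=
      C * (enorm (spos P - spos Q) + D T
           + \int[mu]_(r in `[0, T]) (D r / (T - r) `^ (1 - a))).

End viscosity.

(* Main.v *)
(* Suppose the subsolution w1 of the n-truncated problem exceeds the supersolution
   w2 somewhere. Maximize
     w1 P - w2 Q - A |x - y|^2 - B v(P, Q) - m (t - s)^2 - zeta (T - t)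
   over pairs of points of a compact truncated domain. Since I^(1-a)(g - g 0) is a
   positive multiple of the primitive of the density of g, the squared L^2
   distance v of these primitives, stopped at the current time, is a smooth test
   function with zero time derivative. As m tends to infinity the times of the
   maximizers merge, the path gradients of v cancel, and only
   2 A <x - y, F P - F Q> + f P - f Q is left to balance zeta, where F is the
   drift. On paths with bounded density the distance of property (L) is at most
   delta + C_delta sqrt v for every delta > 0; with delta = 1/A and
   B = A C_delta^2, property (L) bounds A |x - y| and sends the difference of the
   end points of the paths to 0. As A tends to infinity continuity of F and f
   gives zeta <= 0, a contradiction. All limits are taken along ultrafilters. *)

Require Import Defs.
From HB Require Import structures.
From mathcomp Require Import all_boot all_order all_algebra.
From mathcomp Require Import all_classical all_reals all_analysis.
From mathcomp Require Import measurable_realfun ess_sup_inf ring lra.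

Import Order.TTheory GRing.Theory Num.Theory.
Import numFieldNormedType.Exports.

Set Implicit Arguments.
Unset Strict Implicit.
Unset Printing Implicit Defensive.

Local Open Scope classical_set_scope.
Local Open Scope ring_scope.

(** * Weakly singular kernels *)

Section affine.
Context {R : realType}.
Notation mu := (@lebesgue_measure R).

(** The obstacle is a mismatch of distances. Property (L) measures the stopped paths, that is,
    potentials of the densities with a singular kernel, at [T] and in a weighted L^1 norm. A
    ci-derivative only sees the primitives of the densities, and the penalty built from them is an
    L^2 distance, chosen because its expansion along a continued path is quadratic. The density
    bound of the truncated domain bridges the gap: it makes the primitives Lipschitz, so that small
    in L^2 implies small in sup norm, and it makes the part of a potential close to the pole of the
    kernel negligible, so that a small primitive gives a small potential. Each passage loses an
    arbitrary delta and leaves a factor depending on delta in front of the root of the penalty. This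
    factor is harmless: the constant of property (L) is fixed before delta, and the weight [B] of
    the penalty may be as large as the factor asks. The density bound also gives compactness, since
    it is equivalent to a Lipschitz bound on I^(1-a)(g - g 0), a condition that survives pointwise
    limits. *)

Lemma integral_oppr (f : R -> \bar R) :
  measurable_fun [set: R] f -> (forall x, (0 <= f x)%E) ->
  (\int[mu]_x f (- x)%R = \int[mu]_x f x)%E.
Proof.
move=> mf f0; rewrite -[LHS]/(\int[mu]_(x in setT) (f \o -%R) x)%E.
rewrite (_ : setT = (-%R : _ -> measurableTypeR R) @^-1` [set: R])//.
rewrite -ge0_integral_pushforward//=.
by apply: eq_measure_integral => //= A mA _; exact/lebesgue_measureN.
Qed.

Lemma measurable_affine (b c : R) : measurable_fun [set: R] (fun x => c * x + b).
Proof. by apply: measurable_funD => //; exact: measurable_funM. Qed.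

Lemma affine_preimage (b c x y : R) : 0 < c ->
  (fun z => c * z + b) @^-1` `]x, y]%classic = `](x - b) / c, (y - b) / c]%classic.
Proof.
move=> c0; apply/seteqP; split => z /=; rewrite !in_itv/= ler_pdivlMr// ltr_pdivrMr//;
  rewrite ltrBlDr lerBrDr (mulrC z)//.
Qed.

(** The right side, as a function of [A], is a measure that agrees with the length on half-open
    intervals, so uniqueness of Lebesgue measure applies. *)
Lemma lebesgue_measure_affine (b c : R) (A : set R) : 0 < c -> measurable A ->
  mu A = (c%:E * mu ((fun x : R => c * x + b)%R @^-1` A))%E.
Proof.
move=> c0 mA.
pose cn := NngNum (ltW c0).
pose phi := (fun x : R => c * x + b) : R -> measurableTypeR R.
have mphi : measurable_fun [set: R] phi by exact: measurable_affine.
pose HBphi := isMeasurableFun.Build _ _ _ _ _ mphi.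
pose phi' : {mfun R >-> measurableTypeR R} := HB.pack phi HBphi.
have -> : (c%:E * mu ((fun x : R => c * x + b)%R @^-1` A))%E = mscale cn (pushforward mu phi') A.
  by rewrite /mscale/= /pushforward.
apply: lebesgue_measure_unique => //= _ [[x y]] _ <-.
rewrite /mscale/= /pushforward/= affine_preimage// !lebesgue_measure_itv/=.
rewrite !lte_fin ltr_pM2r ?invr_gt0// ltrD2r.
case: ifPn => xy; last by rewrite mule0.
rewrite -!EFinB -EFinM; congr EFin; field; rewrite gt_eqF//.
Qed.

Lemma integral_affine (b c : R) (f : R -> \bar R) : 0 < c ->
  measurable_fun [set: R] f -> (forall x, (0 <= f x)%E) ->
  (\int[mu]_x f x = c%:E * \int[mu]_x f (c * x + b)%R)%E.
Proof.
move=> c0 mf f0.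
pose cn := NngNum (ltW c0).
pose phi := (fun x : R => c * x + b) : R -> measurableTypeR R.
have mphi : measurable_fun [set: R] phi by exact: measurable_affine.
pose HBphi := isMeasurableFun.Build _ _ _ _ _ mphi.
pose phi' : {mfun R >-> measurableTypeR R} := HB.pack phi HBphi.
rewrite -[X in (_ * X)%E]/(\int[mu]_(x in phi' @^-1` setT) (f \o phi') x)%E.
rewrite -ge0_integral_pushforward//=.
have -> : c = (cn%:num)%R by [].
rewrite -ge0_integral_mscale//.
by apply: eq_measure_integral => //= A mA _; exact: lebesgue_measure_affine.
Qed.

End affine.

Section power_integral.
Context {R : realType}.
Notation mu := (@lebesgue_measure R).

Lemma measurable_kernel (a : R) : measurable_fun [set: R] (fun x : R => (x `^ (1 - a))^-1).
Proof.
under eq_fun do rewrite -powRN.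
exact: measurable_powR.
Qed.

Lemma continuous_powR_pos (a x : R) : 0 < x -> {for x, continuous (fun y => y `^ a)}.
Proof.
move=> x0; apply: differentiable_continuous; apply/derivable1_diffP.
by apply: derivable_powR; rewrite in_itv/= x0.
Qed.

Lemma integral_kernel_pos (a b c : R) : 0 < a -> 0 < b -> b < c ->
  (\int[mu]_(x in `[b, c]) ((x `^ (1 - a))^-1)%:E = (c `^ a / a - b `^ a / a)%:E)%E.
Proof.
move=> a0 b0 bc.
have kE x : (x `^ (1 - a))^-1 = x `^ (a - 1) by rewrite -powRN opprB.
have pos x : b <= x -> 0 < x by apply: lt_le_trans.
have df (x : R) : 0 < x -> is_derive x 1 (fun x => x `^ a / a) (x `^ (a - 1)).
  move=> x0; have := @is_deriveM _ _ (fun x => x `^ a) (cst a^-1) x 1 _ _ (is_derive1_powR a x0) (is_derive_cst _ _ _).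
  move=> h; apply: is_derive_eq; rewrite /= scaler0 add0r.
  by rewrite /GRing.scale/=; field; rewrite gt_eqF.
have cf (x : R) : 0 < x -> {for x, continuous (fun x => x `^ a / a)}.
  move=> x0; apply: differentiable_continuous; apply/derivable1_diffP.
  by case: (df x x0).
rewrite (@continuous_FTC2 _ (fun x => (x `^ (1 - a))^-1) (fun x => x `^ a / a)) ?EFinB//.
- apply: continuous_in_subspaceT => x; rewrite inE/= in_itv/= => /andP[bx _].
  under eq_fun do rewrite kE.
  by apply: continuous_powR_pos; exact: pos.
- split.
  + by move=> x; rewrite in_itv/= => /andP[bx _]; case: (df x (pos _ (ltW bx))).
  + by apply/cvg_at_right_filter; exact: cf.
  + by apply/cvg_at_left_filter; apply: cf; exact: pos (ltW bc).
- move=> x; rewrite in_itv/= => /andP[bx _]; rewrite derive1E kE.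
  by case: (df x (pos _ (ltW bx))).
Qed.

Lemma powR_at0 (a : R) (u : R ^nat) : 0 < a -> (forall n, 0 < u n) ->
  u @ \oo --> (0 : R) -> (fun n => u n `^ a) @ \oo --> (0 : R).
Proof.
move=> a0 u0 cu.
apply: (@cvg_comp _ _ _ u (fun x => x `^ a) _ (0^'+) _ _ (powR_cvg0 a0)).
move=> A /= [e e0 eA]; have /cvgrPdist_lt /(_ e e0) := cu.
apply: filterS => n un; exact: eA.
Qed.

Lemma integral_kernel0 (a c : R) : 0 < a -> 0 < c ->
  (\int[mu]_(x in `]0%R, c]) ((x `^ (1 - a))^-1)%:E = (c `^ a / a)%:E)%E.
Proof.
move=> a0 c0.
(* Exhaustion of the punctured interval. The shift by 2 keeps the left end strictly below [c]
   already for [n = 0], as [integral_kernel_pos] asks. *)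
pose F n := `[c / n.+2%:R, c]%classic.
have -> : `]0, c]%classic = \bigcup_n F n.
  apply/seteqP; split => [x /=|x [n _]]; rewrite /F/= !in_itv/=.
    move=> /andP[x0 xc]; exists (Num.truncn (c / x)) => //=; rewrite in_itv/= xc andbT.
    rewrite ler_pdivrMr// mulrC -ler_pdivrMr// ltW// (lt_trans (truncnS_gt _))//.
    by rewrite ltr_nat.
  by move=> /andP[cx ->]; rewrite (lt_le_trans _ cx)// divr_gt0.
have h1 : nondecreasing_seq F.
  move=> n m nm; apply/subsetPset => x; rewrite /F/= !in_itv/= => /andP[cx ->].
  rewrite andbT (le_trans _ cx)// ler_pM2l// lef_pV2 ?posrE ?ltr0n// ler_nat.
  by rewrite !ltnS.
have h2 (i : nat) : measurable_fun (F i) (fun x => ((x `^ (1 - a))^-1)%:E).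
  apply/measurable_EFinP; apply: measurable_funTS; exact: measurable_kernel.
have h3 (i : nat) x : F i x -> (0 <= ((x `^ (1 - a))^-1)%:E)%E.
  by move=> _; rewrite lee_fin invr_ge0 powR_ge0.
have /cvg_lim <- // := ge0_nondecreasing_set_cvg_integral (mu := lebesgue_measure) h1 (fun=> measurable_itv _) h2 h3.
apply/cvg_lim => //.
have -> : (fun i => \int[mu]_(x in F i) ((x `^ (1 - a))^-1)%:E)%E =
   (fun i => (c `^ a / a - (c / i.+2%:R) `^ a / a)%:E).
  apply/funext => i; apply: integral_kernel_pos => //; first by rewrite divr_gt0.
  by rewrite ltr_pdivrMr// ltr_pMr// ltr1n.
apply: cvg_EFin; first exact: nearW.
rewrite -[X in _ --> X]subr0; apply: cvgB; first exact: cvg_cst.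
rewrite -(mul0r a^-1); apply: cvgM; last exact: cvg_cst.
apply: powR_at0 => //; first by move=> n; rewrite divr_gt0.
rewrite -(mulr0 c); apply: cvgM; first exact: cvg_cst.
by rewrite (cvg_shiftS (fun n => (n.+1%:R : R)^-1)); exact: cvg_harmonic.
Qed.

(** The Riemann-Liouville kernel (t - r)^(a - 1) without the factor 1 / Gamma(a). As an inverse it
    matches the quotients in [fracI] and [stopped]; for a < 1 its value at the pole r = t is 0. *)
Definition fker (a t r : R) : R := ((t - r) `^ (1 - a))^-1.

Lemma fker_ge0 (a t r : R) : 0 <= fker a t r.
Proof. by rewrite invr_ge0 powR_ge0. Qed.

Lemma measurable_fker (a t : R) D : measurable_fun D (fker a t).
Proof.
apply: measurable_funTS; apply: (measurableT_comp (@measurable_kernel a)).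
exact: measurable_funB.
Qed.

Lemma integral_fker (a x t : R) : 0 < a -> x <= t ->
  (\int[mu]_(r in `[x, t]) (fker a t r)%:E = ((t - x) `^ a / a)%:E)%E.
Proof.
move=> a0; rewrite le_eqVlt => /predU1P[->|xt].
  by rewrite set_itv1 integral_set1 subrr powR0 ?gt_eqF// mul0r.
rewrite -integral_itv_bndo_bndc; last by apply/measurable_EFinP; exact: measurable_fker.
have tx : 0 < t - x by rewrite subr_gt0.
rewrite -(integral_kernel0 a0 tx).
pose f := (fun y : R => ((y `^ (1 - a))^-1)%:E) \_ `]0, (t - x)]%classic.
have f0 y : (0 <= f y)%E.
  by apply: erestrict_ge0 => z _; rewrite lee_fin invr_ge0 powR_ge0.
have mf : measurable_fun [set: R] f.
  apply/(measurable_restrictT _ _).1 => //; apply/measurable_EFinP.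
  by apply: measurable_funTS; exact: measurable_kernel.
rewrite [RHS]integral_mkcond -/f -(integral_oppr mf f0).
rewrite (@integral_affine _ (- t) 1 (fun z => f (- z)))//; last first.
  by apply: (measurableT_comp mf); exact: oppr_measurable.
rewrite mul1e integral_mkcond; apply: eq_integral => r _.
rewrite /f !patchE mul1r opprD opprK addrC.
have -> : (r \in `[x, t[%classic) = (t - r \in `]0, (t - x)]%classic).
  apply/idP/idP; rewrite !inE/= !in_itv/= => /andP[h1 h2]; apply/andP; split; lra.
by [].
Qed.

Lemma integrable_fker (a x s t : R) : 0 < a -> s <= t ->
  mu.-integrable `[x, s] (EFin \o fker a t).
Proof.
move=> a0 st; have [xs|sx] := leP x s; last first.
  by rewrite set_itv_ge -?ltNge ?bnd_simp//; exact: integrable_set0.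
suff it : mu.-integrable `[x, t] (EFin \o fker a t).
  by apply: integrableS it => //; apply: subset_itvl; rewrite bnd_simp.
apply/integrableP; split; first by apply/measurable_EFinP; exact: measurable_fker.
under eq_integral => r _ do rewrite /= ger0_norm ?fker_ge0//.
by rewrite integral_fker ?(le_trans xs)// ltry.
Qed.

Lemma Rintegral_fker (a x s t : R) : 0 < a -> x <= s -> s <= t ->
  \int[mu]_(r in `[x, s]) fker a t r = ((t - x) `^ a - (t - s) `^ a) / a.
Proof.
move=> a0 xs st.
have full y : y <= t -> \int[mu]_(r in `[y, t]) fker a t r = (t - y) `^ a / a.
  by move=> yt; rewrite /Rintegral integral_fker.
have it : mu.-integrable `[x, t] (EFin \o fker a t) by exact: integrable_fker.
have := @Rintegral_itvB _ (fker a t) (BLeft x) (BRight t) s it.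
rewrite !bnd_simp => /(_ xs st).
rewrite full ?(le_trans xs)// Rintegral_itv_obnd_cbnd; last first.
  apply: integrableS it => //; apply: subset_itv; rewrite bnd_simp//.
by rewrite full// mulrBl => <-; rewrite subKr.
Qed.

(** Measurable on the whole line and bounded everywhere, not just almost everywhere, so that no
    interval or null set has to be carried along. Densities are brought to this form by a
    modification on a null set. *)
Definition bounded_by (M : R) (u : R -> R) :=
  measurable_fun [set: R] u /\ forall r, `|u r| <= M.

Lemma bounded_by_ge0 M u : bounded_by M u -> 0 <= M.
Proof. by move=> [_ /(_ 0)]; apply: le_trans. Qed.

Lemma integrable_bounded_by M u (x s : R) : bounded_by M u ->
  mu.-integrable `[x, s] (EFin \o u).
Proof.
move=> [mu_ uM]; apply: measurable_bounded_integrable => //.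
- by rewrite /= lebesgue_measure_itv/=; case: ifPn => // _; rewrite -EFinB ltry.
- exact: measurable_funTS.
- by exists M; split => //= N MN r _; rewrite (le_trans (uM r))// ltW.
Qed.

Lemma integrable_fpot M u (a x s t : R) : 0 < a -> s <= t -> bounded_by M u ->
  mu.-integrable `[x, s] (EFin \o (fun r => u r / (t - r) `^ (1 - a))).
Proof.
move=> a0 st [mu_ uM].
have := @integrableZl _ _ _ mu `[x, s] _ M _ (@integrable_fker a x s t a0 st).
move=> /(_ (measurable_itv _)); apply: le_integrable => //.
- apply/measurable_EFinP; apply: measurable_funM; last exact: measurable_fker.
  exact: measurable_funTS.
- move=> r _ /=; rewrite lee_fin !normrM.
  rewrite ler_pM// (le_trans (uM r))// ler_norm//.
Qed.

(** The upper limit [s] and the pole [t] are kept apart: [s = t] gives the fractional integral, and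
    [s < t] the path stopped at [s] and evaluated at [t]. *)
Definition fpot (a s t : R) (u : R -> R) : R :=
  \int[mu]_(r in `[0, s]) (u r / (t - r) `^ (1 - a)).

Lemma fpot_bound M u (a x s t : R) : 0 < a -> x <= s -> s <= t -> bounded_by M u ->
  `|\int[mu]_(r in `[x, s]) (u r / (t - r) `^ (1 - a))| <=
  M * (((t - x) `^ a - (t - s) `^ a) / a).
Proof.
move=> a0 xs st bu; rewrite -Rintegral_fker// -RintegralZl//; last first.
  exact: integrable_fker.
apply: le_trans; first by apply: le_normr_Rintegral => //; exact: (integrable_fpot _ a0 st bu).
apply: le_Rintegral => //.
- have /= := @integrable_norm _ _ _ mu `[x, s] _ (integrable_fpot x a0 st bu).
  by [].
- by have := @integrableZl _ _ _ mu `[x, s] _ M _ (@integrable_fker a x s t a0 st);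
  apply.
- move=> r _; rewrite normrM; case: bu => _ /(_ r) uM.
  by rewrite [X in _ * X]ger0_norm ?fker_ge0// ler_wpM2r ?fker_ge0.
Qed.

Lemma ler_powRl (a x y : R) : 0 < a -> 0 <= x -> x <= y -> x `^ a <= y `^ a.
Proof.
by move=> a0 x0 xy; apply: ge0_ler_powR; rewrite ?nnegrE ?(ltW a0)// (le_trans x0).
Qed.

Lemma ler_fker (a t t' r : R) : a < 1 -> r < t -> t <= t' -> fker a t' r <= fker a t r.
Proof.
move=> a1 rt tt'; rewrite lef_pV2 ?posrE ?powR_gt0 ?subr_gt0 ?(lt_le_trans rt)//.
by apply: ler_powRl; rewrite ?subr_gt0// ?subr_ge0 ?(ltW rt)// lerD2r.
Qed.

Lemma Rintegral_cst_itv (c x y : R) : x <= y -> \int[mu]_(r in `[x, y]) c = c * (y - x).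
Proof.
rewrite le_eqVlt => /predU1P[->|xy]; first by rewrite set_itv1 Rintegral_set1 subrr mulr0.
by rewrite Rintegral_cst//= lebesgue_measure_itv/= lte_fin xy.
Qed.

Lemma integrable_cst_itv (c x y : R) : mu.-integrable `[x, y] (EFin \o cst c).
Proof.
apply: measurable_bounded_integrable => //; last exact: bounded_cst.
by rewrite /= lebesgue_measure_itv/=; case: ifPn => // _; rewrite -EFinB ltry.
Qed.

Lemma Rintegral_split (f : R -> R) (x y z : R) : x <= y -> y <= z ->
  mu.-integrable `[x, z] (EFin \o f) ->
  \int[mu]_(r in `[x, z]) f r =
  \int[mu]_(r in `[x, y]) f r + \int[mu]_(r in `[y, z]) f r.
Proof.
move=> xy yz it.
have := @Rintegral_itvB _ f (BLeft x) (BRight z) y it; rewrite !bnd_simp => /(_ xy yz).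
rewrite Rintegral_itv_obnd_cbnd; last first.
  by apply: integrableS it => //; apply: subset_itv; rewrite bnd_simp.
by move=> <-; rewrite addrC subrK.
Qed.

Lemma integrable_subitv (f : R -> R) (x y x' y' : R) : x <= x' -> y' <= y ->
  mu.-integrable `[x, y] (EFin \o f) -> mu.-integrable `[x', y'] (EFin \o f).
Proof.
by move=> xx yy it; apply: integrableS it => //; apply: subset_itv; rewrite bnd_simp.
Qed.

(** The piece on [s, t] costs M (t - s)^a / a. On [0, s] the difference of the two kernels has a
    sign, so its integral is explicit, and it is at most (t - s)^a / a because s^a <= t^a. *)
Lemma fpot_holder M u (a s t : R) : 0 < a < 1 -> 0 <= s -> s <= t -> bounded_by M u ->
  `|fpot a t t u - fpot a s s u| <= 2 * M / a * (t - s) `^ a.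
Proof.
move=> /andP[a0 a1] s0 st bu; have M0 := bounded_by_ge0 bu.
have i1 : mu.-integrable `[0, s] (EFin \o (fun r => u r / (t - r) `^ (1 - a))).
  exact: integrable_fpot bu.
have i2 : mu.-integrable `[0, s] (EFin \o (fun r => u r / (s - r) `^ (1 - a))).
  exact: integrable_fpot bu.
have k1 := @integrable_fker a 0 s t a0 st.
have k2 := @integrable_fker a 0 s s a0 (lexx s).
have oi f : mu.-integrable `[0, s] (EFin \o f) -> mu.-integrable `[0, s[ (EFin \o f).
  by apply: integrableS => //; apply: subset_itvl; rewrite bnd_simp.
rewrite /fpot (Rintegral_split s0 st); last exact: integrable_fpot bu.
rewrite addrAC (le_trans (ler_normD _ _))//.
have h2 := fpot_bound a0 st (lexx t) bu.
rewrite subrr [0 `^ a]powR0 ?gt_eqF// subr0 in h2.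
suff h1 : `|\int[mu]_(r in `[0, s]) (u r / (t - r) `^ (1 - a)) -
  \int[mu]_(r in `[0, s]) (u r / (s - r) `^ (1 - a))| <= M * ((t - s) `^ a / a).
  rewrite (le_trans (lerD h1 h2))//; rewrite le_eqVlt; apply/orP; left; apply/eqP.
  by field; rewrite gt_eqF.
rewrite -RintegralB//.
(* The end point [s] is removed because the kernels are compared by [ler_fker], which fails at the
   pole, where the kernel takes the value 0. *)
rewrite -Rintegral_itv_bndo_bndc; last first.
  by apply: oi; have := @integrableB _ _ _ mu `[0, s] _ _ _ i1 i2; apply.
have i12 : mu.-integrable `[0, s[ (EFin \o (fun r => u r / (t - r) `^ (1 - a) - u r / (s - r) `^ (1 - a))).
  by apply: oi; have := @integrableB _ _ _ mu `[0, s] _ _ _ i1 i2; apply.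
have k12 : mu.-integrable `[0, s] (EFin \o (fun r => fker a s r - fker a t r)).
  by have := @integrableB _ _ _ mu `[0, s] _ _ _ k2 k1; apply.
apply: (le_trans (le_normr_Rintegral _ i12)) => //.
apply: (@le_trans _ _ (\int[mu]_(r in `[0, s[) (M * (fker a s r - fker a t r)))).
  apply: le_Rintegral => //.
  - by have := integrable_norm i12.
  - by apply: oi; have := @integrableZl _ _ _ mu `[0, s] _ M _ k12; apply.
  - move=> r /=; rewrite in_itv/= => /andP[r0 rs].
    rewrite -mulrBr normrM; case: bu => _ /(_ r) uM; rewrite ler_pM//.
    by rewrite distrC ger0_norm// subr_ge0 ler_fker.
rewrite RintegralZl//; last exact: oi.
rewrite Rintegral_itv_bndo_bndc; last exact: oi.
rewrite ler_wpM2l// RintegralB// !Rintegral_fker// subrr subr0 powR0 ?gt_eqF// subr0.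
rewrite -mulrBl ler_wpM2r ?invr_ge0 ?(ltW a0)// subr0.
suff : s `^ a <= t `^ a by lra.
exact: ler_powRl.
Qed.

(* Riemann-sum surrogate for an integration by parts of u against an
   increasing kernel, u being merely measurable. *)
Lemma monotone_weight_bound M u (w : R -> R) (s eta B : R) (N : nat) :
  bounded_by M u -> 0 <= s -> 0 <= eta -> (0 < N)%N ->
  measurable_fun [set: R] w ->
  (forall r r' : R, 0 <= r -> r <= r' -> r' <= s -> 0 <= w r <= w r') ->
  w s <= B ->
  (forall x : R, 0 <= x <= s -> `|\int[mu]_(r in `[0, x]) u r| <= eta) ->
  `|\int[mu]_(r in `[0, s]) (u r * w r)| <= 2 * N%:R * B * eta + M * s / N%:R * B.
Proof.
move=> bu s0 eta0 N0 mw w_mono wB Ueta.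
have M0 := bounded_by_ge0 bu.
have B0 : 0 <= B by case/andP: (w_mono s s s0 (lexx s) (lexx s)) => h _; apply: le_trans wB.
have NR : 0 < N%:R :> R by rewrite ltr0n.
pose x (j : nat) : R := j%:R * (s / N%:R).
have sN0 : 0 <= s / N%:R by rewrite divr_ge0// ltW.
have x0 j : 0 <= x j by rewrite mulr_ge0.
have xS j : x j.+1 = x j + s / N%:R by rewrite /x -natr1 mulrDl mul1r.
have xs j : (j <= N)%N -> x j <= s.
  move=> jN; rewrite /x mulrA ler_pdivrMr// mulrC ler_wpM2l// ler_nat//.
have iu (y z : R) : 0 <= y -> mu.-integrable `[y, z] (EFin \o u).
  by move=> _; exact: integrable_bounded_by bu.
have iw (y z : R) : 0 <= y -> z <= s -> mu.-integrable `[y, z] (EFin \o w).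
  move=> y0 zs; apply: measurable_bounded_integrable => //.
  - by rewrite /= lebesgue_measure_itv/=; case: ifPn => // _; rewrite -EFinB ltry.
  - exact: measurable_funTS.
  - exists B; split => //= K BK r; rewrite /= in_itv/= => /andP[yr rz].
    have /andP[wr0 wrs] := w_mono r s (le_trans y0 yr) (le_trans rz zs) (lexx _).
    by rewrite ger0_norm// (le_trans wrs)// (le_trans wB)// ltW.
have iuw (y z : R) : 0 <= y -> z <= s -> mu.-integrable `[y, z] (EFin \o (fun r => u r * w r)).
  move=> y0 zs; have := @integrableZl _ _ _ mu `[y, z] _ M _ (iw y z y0 zs).
  move=> /(_ (measurable_itv _)); apply: le_integrable => //.
    apply/measurable_EFinP; apply: measurable_funM; apply: measurable_funTS => //.
    by case: bu.
  move=> r _; rewrite /= lee_fin !normrM ler_wpM2r//.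
  by case: bu => _ /(_ r) uM; rewrite (le_trans uM)// ler_norm.
suff H j : (j <= N)%N -> `|\int[mu]_(r in `[0, x j]) (u r * w r)| <=
    2 * j%:R * B * eta + M * (s / N%:R) * (w (x j) - w 0).
  have := H N (leqnn N); rewrite {1 2}/x mulrC divfK ?gt_eqF// => /le_trans; apply.
  rewrite lerD2l -(mulrA M s) ler_wpM2l ?mulr_ge0//.
  have /andP[w00 _] := w_mono 0 s (lexx 0) s0 (lexx s).
  by rewrite lerBlDr (le_trans wB)// lerDl.
elim: j => [_|j IH jN].
  by rewrite /x mul0r set_itv1 Rintegral_set1 normr0 subrr !mulr0 addr0 !mul0r.
have xj : x j <= x j.+1 by rewrite xS lerDl.
have xjs := xs _ jN.
rewrite (Rintegral_split (x0 j) xj); last exact: iuw.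
rewrite (le_trans (ler_normD _ _))//.
have {}IH := IH (ltnW jN).
suff step : `|\int[mu]_(r in `[x j, x j.+1]) (u r * w r)| <=
    2 * B * eta + M * (s / N%:R) * (w (x j.+1) - w (x j)).
  apply: (le_trans (lerD IH step)); rewrite -[j.+1]addn1 natrD le_eqVlt; apply/orP; left; apply/eqP.
  by rewrite addn1; ring.
have Uj : `|\int[mu]_(r in `[x j, x j.+1]) u r| <= 2 * eta.
  have e1 := Ueta (x j.+1); have e2 := Ueta (x j).
  have -> : \int[mu]_(r in `[x j, x j.+1]) u r =
    \int[mu]_(r in `[0, x j.+1]) u r - \int[mu]_(r in `[0, x j]) u r.
    by rewrite (Rintegral_split (x0 j) xj) ?(addrC (\int[mu]_(r in `[0, x j]) _)) ?addrK//; exact: iu.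
  rewrite (le_trans (ler_normB _ _))// mulr2n mulrDl !mul1r lerD//.
    by apply: e1; rewrite x0 xjs.
  by apply: e2; rewrite x0 (le_trans xj).
have wj (r : R) : x j <= r -> r <= x j.+1 -> 0 <= w r - w (x j) <= w (x j.+1) - w (x j).
  move=> jr rj; have /andP[_ h1] := w_mono (x j) r (x0 j) jr (le_trans rj xjs).
  have /andP[_ h2] := w_mono r (x j.+1) (le_trans (x0 j) jr) rj xjs.
  by rewrite subr_ge0 h1 lerB.
have i1 : mu.-integrable `[x j, x j.+1] (EFin \o (fun r => u r * w (x j))).
  by have := @integrableZr _ _ _ mu `[x j, x j.+1] _ (w (x j)) _ (iu _ _ (x0 j)); apply.
have i2 : mu.-integrable `[x j, x j.+1] (EFin \o (fun r => u r * (w r - w (x j)))).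
  have := @integrableB _ _ _ mu `[x j, x j.+1] _ _ _ (iuw _ _ (x0 j) xjs) i1.
  move=> /(_ (measurable_itv _)); congr (_.-integrable _ _).
  by apply/funext => r /=; rewrite mulrBr.
have -> : \int[mu]_(r in `[x j, x j.+1]) (u r * w r) =
    \int[mu]_(r in `[x j, x j.+1]) (u r * w (x j) + u r * (w r - w (x j))).
  by apply: eq_Rintegral => r _; rewrite -mulrDr addrC subrK.
rewrite RintegralD// RintegralZr//; last exact: iu.
rewrite (le_trans (ler_normD _ _))// lerD//.
  rewrite normrM -mulrA mulrCA (mulrC `|_|) ler_pM//.
    have /andP[wj0 wjs] := w_mono (x j) s (x0 j) (xs _ (ltnW jN)) (lexx _).
    by rewrite ger0_norm// (le_trans wjs).
apply: (le_trans (le_normr_Rintegral _ i2)) => //.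
apply: (@le_trans _ _ (\int[mu]_(r in `[x j, x j.+1]) (M * (w (x j.+1) - w (x j))))).
  apply: le_Rintegral => //.
  - by have := integrable_norm i2.
  - apply: measurable_bounded_integrable => //.
      by rewrite /= lebesgue_measure_itv/=; case: ifPn => // _; rewrite -EFinB ltry.
    exact: bounded_cst.
  - move=> r /=; rewrite in_itv/= => /andP[jr rj].
    have /andP[h1 h2] := wj r jr rj.
    rewrite normrM (ger0_norm h1) ler_pM//.
    by case: bu => _ /(_ r).
rewrite Rintegral_cst_itv// xS.
by rewrite (addrC (x j)) addrK mulrAC.
Qed.

(* Away from the singularity the kernel is monotone and bounded, so there the
   potential is controlled by the primitive of u alone; the rest costs delta. *)
Lemma fpot_weak_bound M (a T delta : R) : 0 < a < 1 -> 0 < delta ->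
  exists2 C : R, 0 <= C & forall (u : R -> R) (eta s t : R), bounded_by M u -> 0 <= eta ->
    0 <= s -> s <= t -> t <= T ->
    (forall x : R, 0 <= x <= s -> `|\int[mu]_(r in `[0, x]) u r| <= eta) ->
    `|fpot a s t u| <= delta + C * eta.
Proof.
move=> a01 delta0; have /andP[a0 a1] := a01.
have [M0|M0] := leP 0 M; last first.
  by exists 0 => // u eta s t /bounded_by_ge0; rewrite leNgt M0.
have [T0|T0] := leP 0 T; last first.
  exists 0 => // u eta s t _ _ s0 st tT; exfalso.
  by have := le_lt_trans (le_trans (le_trans s0 st) tT) T0; rewrite ltxx.
(* [h] is the distance from the pole below which the potential is simply estimated by M h^a / a,
   through [fpot_bound]. The denominator [M + 1] in the witness covers M = 0. *)
have [h h0 hM] : exists2 h : R, 0 < h & M * (h `^ a / a) <= delta / 2.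
  exists ((delta / 2 * a / (M + 1)) `^ a^-1).
    by rewrite powR_gt0// divr_gt0 ?mulr_gt0 ?divr_gt0// ltr_wpDl.
  have M1 : 0 < M + 1 by rewrite ltr_wpDl.
  have X0 : 0 <= delta / 2 * a / (M + 1) by rewrite ltW// divr_gt0// mulr_gt0// divr_gt0.
  rewrite -powRrM mulVf ?gt_eqF// powRr1//.
  have -> : M * (delta / 2 * a / (M + 1) / a) = (delta / 2) * (M / (M + 1)).
    by field; rewrite !gt_eqF.
  by rewrite ler_piMr ?divr_ge0 ?(ltW delta0)// ler_pdivrMr// mul1r lerDl.
(* [B] is the kernel at distance [h] from the pole, and [N] brings the oscillation term of
   [monotone_weight_bound] below delta / 2. Neither depends on [u], so the constant is uniform over
   all densities bounded by [M]. *)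
pose B := (h `^ (1 - a))^-1.
have B0 : 0 <= B by rewrite invr_ge0 powR_ge0.
pose N := (Num.truncn (M * T * B / (delta / 2))).+1.
have NB : M * T / N%:R * B <= delta / 2.
  rewrite mulrAC ler_pdivrMr ?ltr0n// [leRHS]mulrC -ler_pdivrMr ?divr_gt0//.
  by rewrite ltW// truncnS_gt.
exists (2 * N%:R * B) => [|u eta s t bu eta0 s0 st tT Ueta]; first by rewrite !mulr_ge0.
have hb (x : R) : 0 <= x -> x <= s -> t - x <= h ->
    `|\int[mu]_(r in `[x, s]) (u r / (t - r) `^ (1 - a))| <= delta / 2.
  move=> x0 xs xh; apply: (le_trans (fpot_bound a0 xs st bu)); apply: le_trans hM.
  rewrite ler_wpM2l// ler_wpM2r ?invr_ge0 ?(ltW a0)//.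
  rewrite (@le_trans _ _ ((t - x) `^ a))//; first by rewrite lerBlDr lerDl powR_ge0.
  by apply: ler_powRl => //; rewrite subr_ge0 (le_trans xs).
have wb (x : R) : 0 <= x -> x <= s -> h <= t - x ->
    `|\int[mu]_(r in `[0, x]) (u r / (t - r) `^ (1 - a))| <= delta / 2 + 2 * N%:R * B * eta.
  move=> x0 xs xh.
  have := @monotone_weight_bound M u (fker a t) x eta B N bu x0 eta0 (ltn0Sn _) (@measurable_fker _ _ _).
  move=> H; apply: (le_trans (H _ _ _)).
  - move=> r r' r0 rr r'x; rewrite fker_ge0/=.
    rewrite /fker lef_pV2 ?posrE ?powR_gt0//; last 2 first.
      lra.
      lra.
    by apply: ler_powRl; lra.
  - rewrite /fker /B lef_pV2 ?posrE ?powR_gt0 ?(lt_le_trans h0)//.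
    by apply: ler_powRl; rewrite ?subr_gt0// ltW.
  - move=> y /andP[y0 yx]; apply: Ueta.
    by rewrite y0 (le_trans yx).
  rewrite addrC lerD2r; apply: le_trans NB.
  rewrite ler_wpM2r// ler_wpM2r ?invr_ge0// ler_wpM2l//.
  by rewrite (le_trans xs)// (le_trans st).
have e0 : 0 <= 2 * N%:R * B * eta by rewrite !mulr_ge0.
have [th|th] := leP t h.
  rewrite (le_trans (hb 0 _ _ _))// ?subr0//; lra.
have [sth|sth] := leP s (t - h).
  rewrite (le_trans (wb s _ _ _))// ?lexx//; lra.
have th0 : 0 <= t - h by rewrite subr_ge0 ltW.
rewrite /fpot (Rintegral_split th0 (ltW sth)); last exact: integrable_fpot bu.
apply: (le_trans (ler_normD _ _)).
have := hb (t - h) th0 (ltW sth); rewrite opprB addrC subrK => /(_ (lexx _)).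
have := wb (t - h) th0 (ltW sth); rewrite opprB addrC subrK => /(_ (lexx _)).
lra.
Qed.

(** * Abel's identity and the Gamma and Beta constants *)

Lemma fker_affine (a c y : R) : 0 < c -> 0 <= y <= 1 -> fker a c (c * y) = c `^ (a - 1) * fker a 1 y.
Proof.
move=> c0 /andP[y0 y1]; rewrite /fker.
have -> : c - c * y = c * (1 - y) by rewrite mulrBr mulr1.
rewrite powRM ?(ltW c0) ?subr_ge0//.
by rewrite invfM (_ : a - 1 = - (1 - a)) ?powRN//; ring.
Qed.

(** At each point one of the two singular factors is at most 2, according to the side of 1/2. Hence
    the product is dominated by an integrable sum. *)
Lemma beta_integrand_le (a y : R) : 0 < a < 1 -> 0 <= y <= 1 ->
  fker a y 0 * fker (1 - a) 1 y <= 2 * (fker a y 0 + fker (1 - a) 1 y).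
Proof.
move=> /andP[a0 a1] /andP[y0 y1].
have half (b z : R) : 0 < b <= 1 -> 2^-1 <= z -> (z `^ b)^-1 <= 2.
  move=> /andP[b0 b1] hz; rewrite -[leRHS]invrK lef_pV2 ?posrE ?powR_gt0 ?invr_gt0//.
    by apply: le_trans (ler_powRl b0 _ hz) => //; apply: ger1_powR => //; lra.
  by rewrite (lt_le_trans _ hz).
have k0 := fker_ge0 a y 0; have k1 := fker_ge0 (1 - a) 1 y.
have [hy|hy] := leP 2^-1 y.
  have : fker a y 0 <= 2 by rewrite /fker subr0; apply: half => //; lra.
  by nra.
have : fker (1 - a) 1 y <= 2 by rewrite /fker; apply: half; lra.
by nra.
Qed.

(** Euler's Beta integral B(a, 1 - a). *)
Definition beta_const (a : R) : R :=
  fine (\int[mu]_(y in `[0%R, 1%R]) (fker a y 0 * fker (1 - a) 1 y)%:E)%E.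

Lemma measurable_fker0 (a : R) D : measurable_fun D (fun y => fker a y 0).
Proof.
apply: measurable_funTS; apply: (measurableT_comp (@measurable_kernel a)).
exact: measurable_funB.
Qed.

Lemma beta_const_lty (a : R) : 0 < a < 1 ->
  (\int[mu]_(y in `[0%R, 1%R]) (fker a y 0 * fker (1 - a) 1 y)%:E < +oo)%E.
Proof.
move=> a01; have /andP[a0 a1] := a01.
have fk0 : (\int[mu]_(y in `[0%R, 1%R]) (fker a y 0)%:E = (a^-1)%:E)%E.
  rewrite -integral_itv_obnd_cbnd; last by apply/measurable_EFinP; exact: measurable_fker0.
  have := integral_kernel0 a0 (@ltr01 R); rewrite powR1 mul1r => <-.
  by apply: eq_integral => y _; rewrite /fker subr0.
have i1 : mu.-integrable `[0, 1] (EFin \o (fun y => fker a y 0)).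
  apply/integrableP; split; first by apply/measurable_EFinP; exact: measurable_fker0.
  under eq_integral => y _ do rewrite /= ger0_norm ?fker_ge0//.
  by rewrite fk0 ltry.
have i2 : mu.-integrable `[0, 1] (EFin \o fker (1 - a) 1) by apply: integrable_fker; lra.
have i3 : mu.-integrable `[0, 1] (EFin \o (fun y => 2 * (fker a y 0 + fker (1 - a) 1 y))).
  have i12 : mu.-integrable `[0, 1] (EFin \o (fun y => fker a y 0 + fker (1 - a) 1 y)).
    by have := @integrableD _ _ _ mu `[0, 1] _ _ _ i1 i2; apply.
  by have := @integrableZl _ _ _ mu `[0, 1] _ 2 _ i12; apply.
have i4 : mu.-integrable `[0, 1] (EFin \o (fun y => fker a y 0 * fker (1 - a) 1 y)).
  apply: le_integrable i3 => //.
    apply/measurable_EFinP; apply: measurable_funM; first exact: measurable_fker0.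
    exact: measurable_fker.
  move=> y; rewrite /= in_itv/= => y01.
  by rewrite lee_fin !ger0_norm ?beta_integrand_le ?mulr_ge0 ?addr_ge0 ?fker_ge0.
by rewrite ltey_eq (integrable_fin_num _ i4).
Qed.

Lemma beta_constE (a : R) : 0 < a < 1 ->
  (\int[mu]_(y in `[0%R, 1%R]) (fker a y 0 * fker (1 - a) 1 y)%:E = (beta_const a)%:E)%E.
Proof.
move=> a01; rewrite /beta_const fineK// ge0_fin_numE ?beta_const_lty//.
by apply: integral_ge0 => y _; rewrite lee_fin mulr_ge0 ?fker_ge0.
Qed.

(** Both factors are at least 1 on the open unit interval, hence so is the integral. *)
Lemma beta_const_gt0 (a : R) : 0 < a < 1 -> 0 < beta_const a.
Proof.
move=> a01; have /andP[a0 a1] := a01.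
apply: (@lt_le_trans _ _ 1) => //; rewrite -lee_fin -beta_constE//.
have -> : 1%:E = (\int[mu]_(y in `]0%R, 1%R[) (cst 1%:E y))%E.
  by rewrite integral_cst//= lebesgue_measure_itv/= lte_fin ltr01 -EFinB subr0 mul1e.
have mf D : measurable_fun D (fun y => (fker a y 0 * fker (1 - a) 1 y)%:E).
  apply/measurable_EFinP; apply: measurable_funM; first exact: measurable_fker0.
  exact: measurable_fker.
apply: (@le_trans _ _ (\int[mu]_(y in `]0%R, 1%R[) (fker a y 0 * fker (1 - a) 1 y)%:E)%E); last first.
  apply: ge0_subset_integral => //.
  - exact: mf.
  - by move=> y _; rewrite lee_fin mulr_ge0 ?fker_ge0.
  - by apply: subset_itv; rewrite bnd_simp.
apply: ge0_le_integral => //; first exact: mf.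
move=> y; rewrite /= in_itv/= => /andP[y0 y1]; rewrite lee_fin.
have h (b z : R) : 0 < b -> 0 < z < 1 -> 1 <= (z `^ b)^-1.
  move=> b0 /andP[z0 z1]; rewrite -[leLHS]invr1 lef_pV2 ?posrE ?powR_gt0//.
  by apply: le_trans (ler_powRl b0 (ltW z0) (ltW z1)) _; rewrite powR1.
rewrite -[leLHS]mulr1 ler_pM// /fker.
  by apply: h; rewrite ?subr0 ?subr_gt0//; lra.
by apply: h; lra.
Qed.

(* The section at r of the double integral of Abel's identity; the affine
   substitution s = r + (t - r) y makes it independent of r. *)
Lemma abel_section (a r t : R) : 0 < a < 1 -> r < t ->
  (\int[mu]_(s in `[r, t]) (fker a s r * fker (1 - a) t s)%:E = (beta_const a)%:E)%E.
Proof.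
move=> a01 rt; have /andP[a0 a1] := a01; rewrite -(beta_constE a01).
have c0 : 0 < t - r by rewrite subr_gt0.
pose f := (fun s : R => (fker a s r * fker (1 - a) t s)%:E) \_ `[r, t]%classic.
have mfr D : measurable_fun D (fun s : R => fker a s r).
  apply: measurable_funTS; apply: (measurableT_comp (@measurable_kernel a)).
  exact: measurable_funB.
have f0 y : (0 <= f y)%E.
  by apply: erestrict_ge0 => z _; rewrite lee_fin mulr_ge0 ?fker_ge0.
have mf : measurable_fun [set: R] f.
  apply/(measurable_restrictT _ _).1 => //; apply/measurable_EFinP.
  by apply: measurable_funM; [exact: mfr|exact: measurable_fker].
rewrite integral_mkcond -/f (integral_affine r c0 mf f0).
rewrite -ge0_integralZl//; last 2 first.
- by apply: (measurableT_comp mf); exact: measurable_affine.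
- by rewrite lee_fin ltW.
rewrite [RHS]integral_mkcond; apply: eq_integral => y _.
rewrite /f !patchE.
have -> : ((t - r) * y + r \in `[r, t]%classic) = (y \in `[0%R, 1%R]%classic).
  apply/idP/idP; rewrite !inE/= !in_itv/= => /andP[h1 h2]; apply/andP; split; nra.
case: ifPn => [|_]; last by rewrite mule0.
rewrite inE/= in_itv/= => y01; have /andP[y0 y1] := y01.
rewrite -EFinM; congr EFin.
rewrite {1}/fker addrK powRM ?(ltW c0)// invfM -powRN opprB.
have -> : fker (1 - a) t ((t - r) * y + r) = fker (1 - a) (t - r) ((t - r) * y).
  by rewrite /fker; congr ((_ `^ _)^-1); ring.
have -> : fker a y 0 = (y `^ (1 - a))^-1 by rewrite /fker subr0.
rewrite fker_affine//.
transitivity ((t - r) * ((t - r) `^ (a - 1) * (t - r) `^ (1 - a - 1)) *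
  ((y `^ (1 - a))^-1 * fker (1 - a) 1 y)).
  move: (_ `^ _) ((y `^ _)^-1) (_ `^ _) (fker _ _ _) => A B C D; ring.
rewrite -powRD; last by apply/implyP => _; rewrite gt_eqF.
rewrite (_ : a - 1 + (1 - a - 1) = -1); last by ring.
by rewrite powR_inv1 ?(ltW c0)// divff ?gt_eqF// mul1r.
Qed.

Lemma fpot_EFin M (u : R -> R) (a s t : R) : 0 < a -> s <= t -> bounded_by M u ->
  (\int[mu]_(r in `[0%R, s]) (u r / (t - r) `^ (1 - a))%:E = (fpot a s t u)%:E)%E.
Proof.
move=> a0 st bu; rewrite /fpot /Rintegral fineK//.
by have := @integrable_fin_num _ _ _ mu `[0, s] (measurable_itv _) _ (integrable_fpot 0 a0 st bu).
Qed.

(** The integrand of Abel's double integral with s = [z.1] and r = [z.2], extended by 0 off the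
    triangle 0 <= r <= s <= t so that Fubini applies on the whole plane. *)
Let abel_ker (a t : R) (u : R -> R) (z : R * R) : R :=
  \1_[set z : R * R | [/\ 0 <= z.2, z.2 <= z.1 & z.1 <= t]] z *
  (u z.2 * (fker a z.1 z.2 * fker (1 - a) t z.1)).

Let measurable_abel_ker (a t M : R) (u : R -> R) : bounded_by M u ->
  measurable_fun [set: R * R] (abel_ker a t u).
Proof.
move=> [mu_ _].
apply: measurable_funM.
  apply: measurable_indic.
  have -> : [set z : R * R | [/\ 0 <= z.2, z.2 <= z.1 & z.1 <= t]] =
    (snd @^-1` `[0, +oo[%classic) `&` ((fun z : R * R => z.1 - z.2) @^-1` `[0, +oo[%classic)
    `&` (fst @^-1` `]-oo, t]%classic).
    apply/seteqP; split => z /=; rewrite !in_itv/= !andbT subr_ge0.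
      by case.
    by case => -[].
  apply: measurableI; first apply: measurableI.
  - rewrite -[X in measurable X]setTI; exact: measurable_snd.
  - rewrite -[X in measurable X]setTI; apply: measurable_funB => //.
  - rewrite -[X in measurable X]setTI; exact: measurable_fst.
apply: measurable_funM; first by apply: (measurableT_comp mu_).
apply: measurable_funM.
  apply: (measurableT_comp (@measurable_kernel a)).
  exact: measurable_funB.
apply: (measurableT_comp (@measurable_kernel (1 - a))).
exact: measurable_funB.
Qed.

Let abel_ker_section1 (a t r : R) : 0 < a < 1 ->
  (\int[mu]_s (abel_ker a t (cst 1%R) (s, r))%:E =
   (beta_const a * \1_(`[0%R, t[%classic : set R) r)%:E)%E.
Proof.
move=> a01; have /andP[a0 a1] := a01.
have [r0|r0] := leP 0 r; last first.
  rewrite indicE memNset ?mulr0/=; last by rewrite in_itv/= leNgt r0.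
  rewrite integral0_eq// => s _; rewrite /abel_ker indicE memNset ?mul0r//=.
  by rewrite leNgt r0; case.
have [tr|tr] := leP t r.
  rewrite indicE memNset ?mulr0/=; last by rewrite in_itv/= r0/= ltNge tr.
  rewrite integral0_eq// => s _; rewrite /abel_ker indicE/=.
  (* Only s = t can lie in the triangle when r >= t, and there the second kernel takes its value 0
     at the pole. *)
  have [st|st] := eqVneq s t.
    by rewrite st [fker (1 - a) t t]/fker subrr powR0 ?invr0 ?mulr0// opprB addrC subrK gt_eqF.
  rewrite memNset ?mul0r//= => -[_ rs st']; move: st.
  by rewrite eq_le st' (le_trans tr rs).
rewrite indicE mem_set ?mulr1/=; last by rewrite in_itv/= r0.
rewrite -(abel_section a01 tr).
rewrite [RHS]integral_mkcond; apply: eq_integral => s _.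
rewrite /abel_ker patchE indicE/=.
have -> : ((s, r) \in [set z : R * R | [/\ 0 <= z.2, z.2 <= z.1 & z.1 <= t]]) = (s \in `[r, t]%classic).
  apply/idP/idP; rewrite !inE/= !in_itv/=; first by move=> [_ -> ->].
  by move=> /andP[-> ->].
by case: ifPn; rewrite ?mul0r// !mul1r.
Qed.

Let abel_kerM (a t s r : R) (u : R -> R) :
  abel_ker a t u (s, r) = u r * abel_ker a t (cst 1) (s, r).
Proof. by rewrite /abel_ker/=; ring. Qed.

Let abel_ker1_ge0 (a t : R) z : 0 <= abel_ker a t (cst 1) z.
Proof. by rewrite /abel_ker !mulr_ge0 ?fker_ge0//= indicE. Qed.

Let bounded_by1 : bounded_by 1 (cst 1).
Proof. by split => // r; rewrite normr1. Qed.

Let measurable_abel_section (a t r : R) :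
  measurable_fun [set: R] (fun s => (abel_ker a t (cst 1) (s, r))%:E).
Proof.
apply/measurable_EFinP.
apply: (measurableT_comp (measurable_abel_ker a t bounded_by1)).
exact: measurable_pair2.
Qed.

Let integrable_abel_ker (a t M : R) (u : R -> R) : 0 < a < 1 -> bounded_by M u ->
  (mu \x mu)%E.-integrable [set: R * R] (EFin \o abel_ker a t u).
Proof.
move=> a01 bu; have M0 := bounded_by_ge0 bu; have b0 := beta_const_gt0 a01.
have [mu_ uM] := bu.
apply/integrable21ltyP; first by apply/measurable_EFinP; exact: measurable_abel_ker bu.
apply: (@le_lt_trans _ _ (\int[mu]_r ((M * beta_const a)%:E * (\1_(`[0%R, t[%classic : set R) r)%:E))%E); last first.
  rewrite ge0_integralZl//; last 2 first.
  - by apply/measurable_EFinP.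
  - by rewrite lee_fin mulr_ge0// ltW.
  rewrite integral_indic//= setIT lebesgue_measure_itv/=.
  by case: ifPn => _; rewrite ?mule0 ?ltry// -EFinB -EFinM ltry.
under eq_integral => r _.
  under eq_integral => s _ do rewrite /= abel_kerM normrM (ger0_norm (abel_ker1_ge0 _ _ _)) EFinM.
  rewrite ge0_integralZl//; last 2 first.
  - exact: measurable_abel_section.
  - by move=> s _; rewrite lee_fin.
  rewrite abel_ker_section1//.
  over.
apply: ge0_le_integral => //.
- by move=> r _; rewrite -EFinM lee_fin !mulr_ge0// ltW.
- under eq_fun do rewrite -EFinM.
  apply/measurable_EFinP; apply: measurable_funM; first exact: measurableT_comp.
  by apply: measurable_funM.
- under eq_fun do rewrite -EFinM.
  by apply/measurable_EFinP; apply: measurable_funM.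
- move=> r _; rewrite -!EFinM lee_fin -mulrA ler_wpM2r//.
  by rewrite mulr_ge0// ltW.
Qed.

(** The semigroup law I^(1-a) I^a = I^1 stripped of its Gamma factors. Exchanging the integrals over
    the triangle and integrating in s first leaves the constant of [abel_section] for every r. *)
Lemma abel_identity (a t M : R) (u : R -> R) : 0 < a < 1 -> 0 <= t -> bounded_by M u ->
  \int[mu]_(s in `[0, t]) (fpot a s s u / (t - s) `^ (1 - (1 - a))) =
  beta_const a * \int[mu]_(r in `[0, t]) u r.
Proof.
move=> a01 t0 bu; have /andP[a0 a1] := a01.
have iu : mu.-integrable `[0, t] (EFin \o u) by exact: integrable_bounded_by bu.
have := Fubini (integrable_abel_ker t a01 bu).
have -> : (\int[mu]_s \int[mu]_r (EFin \o abel_ker a t u) (s, r))%E =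
  (\int[mu]_(s in `[0%R, t]) (fpot a s s u / (t - s) `^ (1 - (1 - a)))%:E)%E.
  rewrite [RHS]integral_mkcond; apply: eq_integral => s _; rewrite patchE.
  case: ifPn => s0t; last first.
    rewrite integral0_eq// => r _; rewrite /= /abel_ker indicE memNset ?mul0r//=.
    by move=> [r0 rs st]; by move/negP: s0t; apply; rewrite inE/= in_itv/= (le_trans r0 rs) st.
  move: s0t; rewrite inE/= in_itv/= => /andP[s0 st].
  rewrite EFinM -(fpot_EFin a0 (lexx s) bu) muleC -integralZl//; last first.
    exact: (integrable_fpot _ a0 (lexx s) bu).
  rewrite [RHS]integral_mkcond; apply: eq_integral => r _.
  rewrite /abel_ker patchE indicE/=.
  have -> : ((s, r) \in [set z : R * R | [/\ 0 <= z.2, z.2 <= z.1 & z.1 <= t]]) = (r \in `[0, s]%classic).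
    apply/idP/idP; rewrite !inE/= !in_itv/=; first by move=> [-> ->].
    by move=> /andP[-> ->].
  case: ifPn; rewrite ?mul0r// mul1r -EFinM => _; congr EFin.
  by rewrite /fker; ring.
have -> : (\int[mu]_r \int[mu]_s (EFin \o abel_ker a t u) (s, r))%E =
  (\int[mu]_(r in `[0%R, t]) (beta_const a * u r)%:E)%E.
  rewrite -integral_itv_bndo_bndc; last first.
    apply/measurable_EFinP; apply: measurable_funM => //; apply: measurable_funTS.
    by case: bu.
  rewrite [RHS]integral_mkcond; apply: eq_integral => r _; rewrite patchE.
  under eq_integral => s _ do rewrite /= abel_kerM EFinM.
  rewrite integralZl//; last first.
    apply/integrableP; split; first exact: measurable_abel_section.
    under eq_integral => s _ do rewrite gee0_abs ?lee_fin//.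
    by rewrite abel_ker_section1// ltry.
  rewrite abel_ker_section1// indicE.
  by case: ifPn => _; rewrite -EFinM ?mulr1 ?mulr0// mulrC.
by move=> E; rewrite -RintegralZl// /Rintegral E.
Qed.

(** Finiteness is part of the claim, since a divergent integral has real value 0. The integrand is
    dominated by x^(a - 1) on (0, 1] plus the exponential density, and it is at least exp(-1) on (0,
    1]. *)
Lemma Gamma_gt0 (a : R) : 0 < a < 1 -> 0 < Gamma a.
Proof.
move=> a01; have /andP[a0 a1] := a01.
pose g x : R := x `^ (a - 1) * expR (- x).
have mg D : measurable_fun D g.
  apply: measurable_funTS; apply: measurable_funM; first exact: measurable_powR.
  by apply: (measurableT_comp (@measurable_expR R)).
have g0 x : 0 <= g x by rewrite mulr_ge0 ?powR_ge0 ?expR_ge0.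
have kE x : (x `^ (1 - a))^-1 = x `^ (a - 1) by rewrite -powRN opprB.
have i1 : mu.-integrable [set: R] (EFin \o ((fun x => (x `^ (1 - a))^-1) \_ `]0, 1]%classic)).
  rewrite -restrict_EFin; apply/(integrable_mkcond _ _).1 => //.
  apply/integrableP; split.
    by apply/measurable_EFinP; apply: measurable_funTS; exact: measurable_kernel.
  under eq_integral => y _ do rewrite /= ger0_norm ?invr_ge0 ?powR_ge0//.
  by rewrite integral_kernel0// ltry.
have i2 := integrable_exponential_pdf (@ltr01 R).
have i12 := integrableD measurableT i1 i2.
have ig : mu.-integrable `]0, +oo[ (EFin \o g).
  have i3 : mu.-integrable `]0, +oo[ (EFin \o (fun x =>
      ((fun x => (x `^ (1 - a))^-1) \_ `]0, 1]%classic) x + exponential_pdf 1 x)).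
    by apply: integrableS i12.
  apply: le_integrable i3 => //.
    by apply/measurable_EFinP; exact: mg.
  move=> x; rewrite /= in_itv/= andbT => x0.
  have e0 : 0 <= exponential_pdf 1 x by rewrite exponential_pdf_ge0.
  rewrite lee_fin patchE ger0_norm//.
  rewrite (@ger0_norm _ (_ + _)); last first.
    by rewrite addr_ge0//; case: ifPn => // _; rewrite invr_ge0 powR_ge0.
  case: ifPn => [|].
    rewrite inE/= in_itv/= => /andP[_ x1].
    rewrite (@le_trans _ _ ((x `^ (1 - a))^-1))// ?lerDl// /g kE ler_piMr ?powR_ge0//.
    by rewrite -expR0 ler_expR oppr_le0 ltW.
  rewrite notin_setE/= in_itv/= x0/= => /negP; rewrite -ltNge => x1.
  rewrite -[X in _ <= X]/(0 + exponential_pdf 1 x) add0r exponential_pdfE ?(ltW x0)// mul1r mulN1r /g ler_piMl ?expR_ge0//.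
  rewrite -kE invf_le1 ?powR_gt0//.
  have := @ler_powRl (1 - a) 1 x; rewrite powR1; apply; rewrite ?subr_gt0//.
  exact: ltW.
rewrite /Gamma -/g.
pose m := expR (-1) : R.
have im : mu.-integrable `]0, 1] (EFin \o cst m).
  by apply: integrableS (integrable_cst_itv m 0 1) => //; apply: subset_itv; rewrite bnd_simp.
apply: (@lt_le_trans _ _ (\int[mu]_(x in `[0, 1]) m)).
  by rewrite Rintegral_cst_itv// subr0 mulr1 expR_gt0.
rewrite -Rintegral_itv_obnd_cbnd//.
have ig1 : mu.-integrable `]0, 1] (EFin \o g).
  by apply: integrableS ig => //; apply: subset_itv; rewrite bnd_simp.
apply: (@le_trans _ _ (\int[mu]_(x in `]0, 1]) g x)).
  apply: le_Rintegral => //.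
  move=> x; rewrite /= in_itv/= => /andP[x0 x1].
  rewrite /g /m -[leLHS]mul1r ler_pM ?expR_ge0//; last by rewrite ler_expR lerN2.
  rewrite -kE -[leLHS]invr1 lef_pV2 ?posrE ?powR_gt0//.
  by have := @ler_powRl (1 - a) x 1; rewrite powR1; apply; rewrite ?subr_gt0 ?(ltW x0).
rewrite /Rintegral fine_le//.
- exact: integrable_fin_num.
- exact: integrable_fin_num.
apply: ge0_subset_integral => //.
- by apply/measurable_EFinP; exact: mg.
- by move=> x _; rewrite lee_fin.
- by apply: subset_itv; rewrite bnd_simp.
Qed.

End power_integral.

(** * Vectors and paths *)

Section euclidean_facts.
Context {R : realType}.

Lemma coordB n (x y : 'cV[R]_n) i : (x - y) i 0 = x i 0 - y i 0.
Proof. by rewrite !mxE. Qed.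

Lemma dot_ge0 n (x : 'cV[R]_n) : 0 <= dot x x.
Proof. by apply: sumr_ge0 => i _; rewrite -expr2 sqr_ge0. Qed.

Lemma enorm_sqr n (x : 'cV[R]_n) : enorm x ^+ 2 = dot x x.
Proof. by rewrite sqr_sqrtr ?dot_ge0. Qed.

Lemma dotC n (x y : 'cV[R]_n) : dot x y = dot y x.
Proof. by apply: eq_bigr => i _; rewrite mulrC. Qed.

Lemma dotDl n (x y z : 'cV[R]_n) : dot (x + y) z = dot x z + dot y z.
Proof. by rewrite -big_split; apply: eq_bigr => i _; rewrite mxE mulrDl. Qed.

Lemma dotDr n (x y z : 'cV[R]_n) : dot z (x + y) = dot z x + dot z y.
Proof. by rewrite dotC dotDl !(dotC z). Qed.

Lemma dotNl n (x y : 'cV[R]_n) : dot (- x) y = - dot x y.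
Proof. by rewrite -sumrN; apply: eq_bigr => i _; rewrite mxE mulNr. Qed.

Lemma dotNr n (x y : 'cV[R]_n) : dot x (- y) = - dot x y.
Proof. by rewrite dotC dotNl dotC. Qed.

Lemma dotZl n (c : R) (x y : 'cV[R]_n) : dot (c *: x) y = c * dot x y.
Proof. by rewrite mulr_sumr; apply: eq_bigr => i _; rewrite mxE mulrA. Qed.

Lemma dotZr n (c : R) (x y : 'cV[R]_n) : dot x (c *: y) = c * dot x y.
Proof. by rewrite dotC dotZl dotC. Qed.

Lemma dotBl n (x y z : 'cV[R]_n) : dot (x - y) z = dot x z - dot y z.
Proof. by rewrite dotDl dotNl. Qed.

Lemma dotBr n (x y z : 'cV[R]_n) : dot z (x - y) = dot z x - dot z y.
Proof. by rewrite dotDr dotNr. Qed.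

Lemma dot_le n (x y : 'cV[R]_n) : dot x y <= enorm x * enorm y.
Proof.
have := enormD x y.
rewrite -(@ler_pXn2r _ 2) ?nnegrE ?addr_ge0 ?enorm_ge0//.
rewrite sqrrD !enorm_sqr dotDl !dotDr (dotC y x) mulr2n; lra.
Qed.

Lemma dot_norm_le n (x y : 'cV[R]_n) : `|dot x y| <= enorm x * enorm y.
Proof.
rewrite ler_norml dot_le andbT lerNl -dotNl.
by rewrite (le_trans (dot_le _ _))// enormN.
Qed.

Lemma coord_le_enorm n (x : 'cV[R]_n) i : `|x i 0| <= enorm x.
Proof.
rewrite -(@ler_pXn2r _ 2) ?nnegrE ?enorm_ge0// enorm_sqr real_normK ?num_real//.
by rewrite /dot (bigD1 i)//= -expr2 lerDl sumr_ge0// => j _; rewrite -expr2 sqr_ge0.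
Qed.

Lemma enorm_le_sum n (x : 'cV[R]_n) : enorm x <= \sum_(i < n) `|x i 0|.
Proof.
have s0 : 0 <= \sum_(i < n) `|x i 0| by apply: sumr_ge0.
rewrite -(@ler_pXn2r _ 2) ?nnegrE ?enorm_ge0// enorm_sqr expr2 mulr_suml.
apply: ler_sum => i _; rewrite (le_trans (ler_norm _))// normrM ler_wpM2l//.
by rewrite (bigD1 i)//= lerDl sumr_ge0.
Qed.

Lemma enorm_eq0 n (x : 'cV[R]_n) : enorm x = 0 -> x = 0.
Proof.
move=> x0; apply/matrixP => i j; rewrite ord1 mxE; apply/eqP.
by rewrite -normr_le0 -x0 coord_le_enorm.
Qed.

Lemma enormZ n (c : R) (x : 'cV[R]_n) : enorm (c *: x) = `|c| * enorm x.
Proof.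
by rewrite /enorm dotZl dotZr mulrA -expr2 sqrtrM ?sqr_ge0// sqrtr_sqr.
Qed.

Lemma enormB n (x y : 'cV[R]_n) : enorm (x - y) = enorm (y - x).
Proof. by rewrite -enormN opprB. Qed.

Lemma enorm_dist n (x y : 'cV[R]_n) : `|enorm x - enorm y| <= enorm (x - y).
Proof.
rewrite ler_norml lerBlDr lerNl opprB lerBlDr; apply/andP; split.
  by rewrite addrC -lerBlDl lerBlDr enormB (le_trans _ (enormD _ _))// subrK.
by rewrite (le_trans _ (enormD _ _))// subrK.
Qed.

Lemma enorm_le_bound n (x : 'cV[R]_n) (c : R) : (forall i, `|x i 0| <= c) ->
  enorm x <= n%:R * c.
Proof.
move=> xc; apply: (le_trans (enorm_le_sum _)).
rewrite mulr_natl -[X in _ *+ X]card_ord -sumr_const.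
exact: ler_sum.
Qed.

Lemma mx_norm_le_enorm n (x : 'cV[R]_n) : `|x| <= enorm x.
Proof.
rewrite [leLHS]/Num.Def.normr/= mx_normrE (bigmax_le _ (enorm_ge0 _))//= => -[i j] _.
by rewrite ord1 coord_le_enorm.
Qed.

Lemma coord_le_mx_norm n (x : 'cV[R]_n) i : `|x i 0| <= `|x|.
Proof. by rewrite [leRHS]/Num.Def.normr /= mx_normrE; apply/bigmax_geP; right => /=; exists (i, 0). Qed.

Lemma enorm_le_mx_norm n (x : 'cV[R]_n) : enorm x <= n%:R * `|x|.
Proof. by apply: enorm_le_bound => i; exact: coord_le_mx_norm. Qed.

End euclidean_facts.

Section paths.
Context {R : realType}.
Notation mu := (@lebesgue_measure R).

Definition pot_vec n (a s t : R) (u : R -> 'cV[R]_n) : 'cV[R]_n :=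
  \col_i ((Gamma a)^-1 * fpot a s t (fun r => u r i 0)).

Definition prim n (u : R -> 'cV[R]_n) (t : R) : 'cV[R]_n :=
  \col_i \int[mu]_(r in `[0, t]) u r i 0.

Definition bounded_density n (M : R) (u : R -> 'cV[R]_n) : Prop :=
  (forall i, measurable_fun [set: R] (fun r => u r i 0)) /\ forall r, enorm (u r) <= M.

Lemma bounded_density_coord n M (u : R -> 'cV[R]_n) i : bounded_density M u ->
  bounded_by M (fun r => u r i 0).
Proof. by move=> [mu_ uM]; split => // r; rewrite (le_trans (coord_le_enorm _ _)). Qed.

Lemma fracI_pot_vec n a (u : R -> 'cV[R]_n) t : fracI a u t = pot_vec a t t u.
Proof. by []. Qed.

Lemma primB n M (u : R -> 'cV[R]_n) s t i : bounded_density M u -> 0 <= s -> s <= t ->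
  (prim u t - prim u s) i 0 = \int[mu]_(r in `[s, t]) u r i 0.
Proof.
move=> bu s0 st; rewrite !mxE (Rintegral_split s0 st).
  by rewrite addrC addKr.
exact: integrable_bounded_by (bounded_density_coord i bu).
Qed.

(** Pairing the increment w with itself brings the Euclidean norm under the integral: |w|^2 is the
    integral of <w, u>, at most |w| M (t - s). A coordinatewise estimate would cost a factor
    depending on n, whereas limits of paths have to stay in the same [AC_ball]. *)
Lemma prim_lip_le n M (u : R -> 'cV[R]_n) s t : bounded_density M u -> 0 <= s -> s <= t ->
  enorm (prim u t - prim u s) <= M * (t - s).
Proof.
move=> bu s0 st; set w := prim u t - prim u s.
have iu i : mu.-integrable `[s, t] (EFin \o (fun r => u r i 0)).
  exact: integrable_bounded_by (bounded_density_coord i bu).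
have dE : dot w w = \int[mu]_(r in `[s, t]) dot w (u r).
  rewrite /dot.
  have -> : \int[mu]_(r in `[s, t]) (\sum_(i < n) w i 0 * u r i 0) =
    \sum_(i < n) \int[mu]_(r in `[s, t]) (w i 0 * u r i 0).
    rewrite /Rintegral; under eq_integral do rewrite -sumEFin.
    rewrite integral_sum//; last first.
      by move=> i; have := @integrableZl _ _ _ mu `[s, t] _ (w i 0) _ (iu i); apply.
    rewrite -sum_fine// => i _.
    apply: integrable_fin_num => //.
    by have := @integrableZl _ _ _ mu `[s, t] _ (w i 0) _ (iu i); apply.
  apply: eq_bigr => i _; rewrite RintegralZl//; congr (_ * _).
  exact: primB bu s0 st.
have : dot w w <= enorm w * (M * (t - s)).
  rewrite dE mulrA -Rintegral_cst_itv//.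
  have iw : mu.-integrable `[s, t] (EFin \o (fun r => dot w (u r))).
    rewrite (_ : EFin \o _ = (fun r => \sum_(i < n) (w i 0 * u r i 0)%:E)%E); last first.
      by apply/funext => r /=; rewrite -sumEFin.
    apply: integrable_sum => // i _.
    by have := @integrableZl _ _ _ mu `[s, t] _ (w i 0) _ (iu i); apply.
  apply: le_Rintegral => //; first exact: integrable_cst_itv.
  move=> r _; rewrite (le_trans (dot_le _ _))// ler_wpM2l ?enorm_ge0//.
  by case: bu.
rewrite -enorm_sqr expr2.
have [->|] := eqVneq (enorm w) 0.
  move=> _; rewrite mulr_ge0 ?subr_ge0//; case: bu => _ /(_ 0); apply: le_trans.
  exact: enorm_ge0.
move=> w0; rewrite ler_pM2l// lt_neqAle eq_sym w0 enorm_ge0//.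
Qed.

Lemma prim_lip n M (u : R -> 'cV[R]_n) s t : bounded_density M u -> 0 <= s -> 0 <= t ->
  enorm (prim u t - prim u s) <= M * `|t - s|.
Proof.
move=> bu s0 t0; have [st|ts] := leP s t.
  by rewrite ger0_norm ?subr_ge0// prim_lip_le.
by rewrite ltr0_norm ?subr_lt0// opprB enormB prim_lip_le// ltW.
Qed.

Lemma pot_vec_holder n M (u : R -> 'cV[R]_n) a s t : 0 < a < 1 -> bounded_density M u ->
  0 <= s -> 0 <= t ->
  enorm (pot_vec a t t u - pot_vec a s s u) <=
    n%:R * ((Gamma a)^-1 * (2 * M / a)) * `|t - s| `^ a.
Proof.
move=> a01 bu; wlog st : s t / s <= t => [H s0 t0|s0 t0].
  have [st|/ltW ts] := leP s t; first exact: H.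
  by rewrite enormB distrC H.
rewrite ger0_norm ?subr_ge0// -mulrA; apply: enorm_le_bound => i.
rewrite !mxE -mulrBr normrM ger0_norm ?invr_ge0 ?(ltW (Gamma_gt0 a01))//.
rewrite -mulrA ler_wpM2l ?invr_ge0 ?(ltW (Gamma_gt0 a01))//.
exact: fpot_holder (bounded_density_coord i bu).
Qed.

(** A converse of [prim_lip_le] with the same constant: by Lebesgue differentiation the density is
    almost everywhere a limit, in all coordinates at once, of difference quotients of norm at most
    [K]. *)
Lemma prim_lipschitz_density n (T K : R) (u : R -> 'cV[R]_n) : 0 < T ->
  (forall i, mu.-integrable `[0, T] (EFin \o (fun r => u r i 0))) ->
  (forall s t : R, 0 <= s -> s <= t -> t <= T -> enorm (prim u t - prim u s) <= K * (t - s)) ->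
  {ae mu, forall t, 0 < t < T -> enorm (u t) <= K}.
Proof.
move=> T0 iu UK.
pose f i := (fun r => u r i 0) \_ `[0, T]%classic.
have fi i : mu.-integrable [set: R] (EFin \o f i).
  rewrite /f -restrict_EFin; exact/(integrable_mkcond _ _).1.
have lf i : locally_integrable [set: R] (f i) by apply: integrable_locally.
pose F i (y : R) : R := \int[mu]_(r in `[0, y]) f i r.
have H i : {ae mu, forall x : R, 0 < x -> derivable (F i) x 1 /\ derive1 (F i) x = f i x}.
  have fy (y : R) : mu.-integrable [set` Interval (BLeft 0) (BRight y)] (EFin \o f i).
    exact: integrableS (fi i).
  have X := FTC1 fy (lf i).
  move: X; apply: filterS; first exact: (ae_filter_ringOfSetsType mu).
  by move=> x Xx x0; have [] := Xx _.
have FF := ae_filter_ringOfSetsType mu.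
have := filter_forall FF H; apply: filterS => t Ht /andP[t0 tT].
have Fu i y : 0 <= y <= T -> F i y = prim u y i 0.
  move=> /andP[y0 yT]; rewrite mxE; apply: eq_Rintegral => r.
  rewrite inE/= in_itv/= => /andP[r0 ry]; rewrite /f patchE mem_set//=.
  by rewrite in_itv/= r0 (le_trans ry).
have cv i : h^-1 *: (F i (h *: 1 + t) - F i t) @[h --> 0^'] --> u t i 0.
  have [d dE] := Ht i t0.
  have utE : f i t = u t i 0 by rewrite /f patchE mem_set//= in_itv/= !ltW.
  by rewrite utE derive1E in dE; rewrite -dE.
apply/ler_addgt0Pr => e e0.
have e1 : 0 < e / (n%:R + 1) by rewrite divr_gt0// ltr_wpDl.
have cvn : \forall h \near (0 : R)^', forall i, `|u t i 0 - h^-1 *: (F i (h *: 1 + t) - F i t)| < e / (n%:R + 1).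
  by apply: filter_forall => i; move/cvgrPdist_lt : (cv i); exact.
have small : \forall h \near (0 : R)^', [/\ h != 0, - h < t & h < T - t].
  near=> h; split.
  - by near: h; exact: nbhs_dnbhs_neq.
  - rewrite ltrNl; near: h; apply: nbhs_dnbhs; apply: lt_nbhsr; by rewrite oppr_lt0.
  - near: h; apply: nbhs_dnbhs; apply: lt_nbhsl; by rewrite subr_gt0.
have [h [hq [h0 th hT]]] := filter_ex (filterI cvn small).
pose q := h^-1 *: (prim u (h + t) - prim u t).
have qK : enorm q <= K.
  rewrite enormZ normfV ler_pdivrMl ?normr_gt0// mulrC.
  have [hp|hn] := leP 0 h.
    rewrite ger0_norm// (le_trans (UK _ _ _ _ _)) ?(ltW t0) ?lerDr//; last by rewrite addrK.
    by rewrite -lerBrDr ltW.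
  rewrite ltr0_norm// enormB (le_trans (UK _ _ _ _ _))//; [lra|lra|exact: ltW|].
  by rewrite opprD addrCA subrr addr0.
rewrite -(subrK q (u t)) (le_trans (enormD _ _))// addrC lerD//.
apply: (@le_trans _ _ (n%:R * (e / (n%:R + 1)))).
  apply: enorm_le_bound => i; have := hq i.
  rewrite [h *: 1]mulr1 !Fu; [|lra|lra]; rewrite !mxE => /ltW.
  by apply: le_trans; rewrite le_eqVlt eqxx.
rewrite mulrA ler_pdivrMr ?ltr_wpDl// mulrC ler_wpM2l ?(ltW e0)//; lra.
Unshelve. all: by end_near. Qed.

Lemma ae_imp (P Q : R -> Prop) : (forall x, P x -> Q x) ->
  {ae mu, forall x, P x} -> {ae mu, forall x, Q x}.
Proof. by move=> PQ; apply: negligibleS => x /=; apply: contra_not; exact: PQ. Qed.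

Lemma ae_and (P Q : R -> Prop) :
  {ae mu, forall x, P x} -> {ae mu, forall x, Q x} -> {ae mu, forall x, P x /\ Q x}.
Proof.
move=> aP aQ; apply: negligibleS (negligibleU aP aQ) => x /= nPQ.
by have [Px|nP] := pselect (P x); [right => Qx; exact: nPQ|left].
Qed.

(** A representative of [fracD g] that is bounded everywhere. The last clause covers the path and
    its stopped extension together, as the upper limit [Num.min s t] is [t] before [s] and [s]
    afterwards. *)
Definition has_density (T a : R) n (M : R) (g : ACpath T a n) (u : R -> 'cV[R]_n) : Prop :=
  [/\ bounded_density M u,
      {ae mu, forall s, 0 <= s <= T -> u s = fracD g s} &
      forall s t : R, 0 <= s <= T -> 0 <= t ->
        stopped s g t = g 0 + pot_vec a (Num.min s t) t u].

Lemma Linf_norm_leP (T : R) n (M : R) (u : R -> 'cV[R]_n) : 0 <= M ->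
  (Linf_norm T u <= M%:E)%E <-> {ae mu, forall s, 0 <= s <= T -> enorm (u s) <= M}.
Proof.
move=> M0; rewrite /Linf_norm unlock/=.
have -> : (0 < mu [set: R])%E.
  apply: (@lt_le_trans _ _ (mu `[0%R, 1%R])%E).
    by rewrite lebesgue_measure_itv/= lte_fin ltr01 -EFinB subr0 lte_fin.
  by apply: le_measure => //; rewrite ?inE.
split.
  move=> /ess_supP; apply: ae_imp.
  move=> s /=; rewrite lee_fin indicE => us s0T; move: us.
  by rewrite mem_set//= mul1r ger0_norm ?enorm_ge0.
move=> H; apply/ess_supP; move: H; apply: ae_imp.
move=> s us /=; rewrite lee_fin indicE.
have [s0T|s0T] := boolP (0 <= s <= T).
  by rewrite mem_set/= ?mul1r ?ger0_norm ?enorm_ge0 ?us// in_itv.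
by rewrite memNset/= ?mul0r ?normr0// in_itv/=; exact/negP.
Qed.

Lemma fracDP (T a : R) n (g : ACpath T a n) : is_fracD T a g (fracD g).
Proof. exact: (svalP (cid (acfunP g))). Qed.

(** Cutting to 0 outside [0, T] and where the norm exceeds [M] alters the density on [0, T] only on
    a null set. The cut is phrased with [dot], whose measurability is that of a sum of products. *)
Lemma bounded_density_modification (T : R) n (M : R) (u : R -> 'cV[R]_n) : 0 <= M ->
  (forall i, measurable_fun `[0, T] (fun s => u s i 0)) ->
  {ae mu, forall s, 0 <= s <= T -> enorm (u s) <= M} ->
  exists2 w, bounded_density M w & {ae mu, forall s, 0 <= s <= T -> w s = u s}.
Proof.
move=> M0 mu_ uM.
pose v s : 'cV[R]_n := if s \in `[0, T] then u s else 0.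
have mv i : measurable_fun [set: R] (fun s => v s i 0).
  have := (measurable_restrictT (fun s => u s i 0) (measurable_itv `[0, T])).1 (mu_ i).
  congr measurable_fun; apply/funext => s; rewrite /v patchE mem_setE.
  by case: ifPn => //; rewrite mxE.
have md : measurable_fun [set: R] (fun s => dot (v s) (v s)).
  by apply: measurable_sum => i; exact: measurable_funM.
pose w s : 'cV[R]_n := if dot (v s) (v s) <= M ^+ 2 then v s else 0.
exists w.
  split.
    move=> i; rewrite (_ : (fun s => _) = (fun s => if dot (v s) (v s) <= M ^+ 2 then v s i 0 else 0)).
      by apply: measurable_fun_ifT => //; exact: measurable_fun_ler.
    by apply/funext => s; rewrite /w; case: ifPn => //; rewrite mxE.
  move=> s; rewrite /w; case: ifPn => [|_]; last by rewrite enorm0.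
  by rewrite -enorm_sqr ler_pXn2r// nnegrE enorm_ge0.
move: uM; apply: ae_imp.
move=> s us s0T; have := us s0T.
rewrite -(@ler_pXn2r _ 2) ?nnegrE ?enorm_ge0// enorm_sqr /w /v in_itv/= s0T.
by move=> ->.
Qed.

Lemma exists_density (T a : R) n (g : ACpath T a n) (M : R) : 0 <= M ->
  (Linf_norm T (fracD g) <= M%:E)%E -> exists u, has_density M g u.
Proof.
move=> M0 /(Linf_norm_leP _ _ M0) uM.
have [[mu_ _] gE] := fracDP g; set u := fracD g in mu_ gE uM.
have [w bw wu] := bounded_density_modification M0 mu_ uM.
have int_eq i s t : s <= T -> fpot a s t (fun r => u r i 0) = fpot a s t (fun r => w r i 0).
  move=> sT; rewrite /fpot /Rintegral; congr fine.
  apply: ae_eq_integral => //.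
  - apply/measurable_EFinP; apply: measurable_funM; last exact: measurable_fker.
    apply: measurable_funS (mu_ i) => //.
    by apply: subset_itvl; rewrite bnd_simp.
  - apply/measurable_EFinP; apply: measurable_funM; last exact: measurable_fker.
    by apply: measurable_funS (bw.1 i).
  - move: wu; apply: ae_imp.
    move=> r wr; rewrite /= in_itv/= => /andP[r0 rs].
    by rewrite wr// r0 (le_trans rs).
exists w; split => // s t /andP[s0 sT] t0; rewrite /stopped.
case: ifPn => [ts|].
  rewrite min_r// gE ?t0 ?(le_trans ts)//; congr (_ + _).
  apply/matrixP => i j; rewrite !mxE; congr (_ * _).
  by apply: int_eq; exact: le_trans sT.
rewrite -ltNge => st; rewrite min_l ?(ltW st)//; congr (_ + _).
by apply/matrixP => i j; rewrite !mxE; congr (_ * _); exact: int_eq.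
Qed.

Lemma exists_density_fin (T a : R) n (g : ACpath T a n) :
  exists M u, has_density M g u.
Proof.
have [[_ uoo] _] := fracDP g.
have [M M0 uM] : exists2 M, 0 <= M & (Linf_norm T (fracD g) <= M%:E)%E.
  exists (fine (Linf_norm T (fracD g))).
    by rewrite fine_ge0// Lnorm_ge0.
  by rewrite fineK// ge0_fin_numE// Lnorm_ge0.
by exists M; exact: exists_density.
Qed.

Lemma has_densityE (T a : R) n M (g : ACpath T a n) u (t : R) : has_density M g u ->
  0 <= t <= T -> g t = g 0 + pot_vec a t t u.
Proof.
move=> [_ _ /(_ t t) gE] t0T; have /andP[t0 _] := t0T.
by have := gE t0T t0; rewrite /stopped lexx minxx.
Qed.

End paths.

(* Locked, as otherwise unification unfolds it down to the Lebesgue integral. *)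
HB.lock Definition frac_int {R : realType} {a T : R} {n} (g : ACpath T a n) (t : R) : 'cV[R]_n :=
  fracI (1 - a) (fun s => g s - g 0) t.

Section fractional_integral_of_paths.
Context {R : realType}.
Notation mu := (@lebesgue_measure R).

Lemma frac_int_coord (a T : R) n (g : ACpath T a n) (t : R) i : frac_int g t i 0 =
  (Gamma (1 - a))^-1 * \int[mu]_(s in `[0, t]) ((g s - g 0) i 0 / (t - s) `^ (1 - (1 - a))).
Proof. by rewrite frac_int.unlock mxE. Qed.

(* The constant is 1 by the Beta-Gamma identity, but only its positivity matters. *)
Definition frac_const (a : R) : R := (Gamma (1 - a))^-1 * (Gamma a)^-1 * beta_const a.

Lemma frac_const_gt0 a : 0 < a < 1 -> 0 < frac_const a.
Proof.
move=> a01; rewrite !mulr_gt0 ?invr_gt0 ?Gamma_gt0 ?beta_const_gt0//; lra.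
Qed.

Lemma frac_intE (T a : R) n M (g : ACpath T a n) u (t : R) : 0 < a < 1 -> has_density M g u ->
  0 <= t <= T -> frac_int g t = frac_const a *: prim u t.
Proof.
move=> a01 gu /andP[t0 tT]; have /andP[a0 a1] := a01; have [bu _ _] := gu.
apply/matrixP => i j; rewrite ord1 frac_int_coord !mxE /frac_const.
pose v r : R := (Gamma a)^-1 * u r i 0.
have G0 := Gamma_gt0 a01; have bui := bounded_density_coord i bu.
have bv : bounded_by ((Gamma a)^-1 * M) v.
  case: bui => mu_ uM; split; first exact: measurable_funM.
  by move=> r; rewrite normrM ger0_norm ?invr_ge0 ?(ltW G0)// ler_wpM2l ?invr_ge0 ?(ltW G0).
have -> : \int[mu]_(s in `[0, t]) ((g s - g 0) i 0 / (t - s) `^ (1 - (1 - a))) =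
    \int[mu]_(s in `[0, t]) (fpot a s s v / (t - s) `^ (1 - (1 - a))).
  apply: eq_Rintegral => s; rewrite inE/= in_itv/= => /andP[s0 st]; congr (_ / _).
  rewrite (has_densityE gu) ?s0 ?(le_trans st)// addrC addKr mxE /fpot.
  rewrite -RintegralZl//; last exact: integrable_fpot bui.
  by apply: eq_Rintegral => r _; rewrite /v mulrA.
rewrite (abel_identity a01 t0 bv) /v RintegralZl//; last exact: integrable_bounded_by bui.
by rewrite -!mulrA; congr (_ * _); rewrite mulrCA.
Qed.

Lemma has_density_lip (T a : R) n M (g : ACpath T a n) u (s t : R) : 0 < a < 1 -> has_density M g u ->
  0 <= s <= T -> 0 <= t <= T ->
  enorm (frac_int g t - frac_int g s) <= frac_const a * M * `|t - s|.
Proof.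
move=> a01 gu sT tT; have c0 := frac_const_gt0 a01.
rewrite !(frac_intE a01 gu)// -scalerBr enormZ ger0_norm ?(ltW c0)// -mulrA.
rewrite ler_wpM2l ?(ltW c0)//; case: gu => bu _ _.
by case/andP: sT => ? _; case/andP: tT => ? _; exact: prim_lip.
Qed.

(** With [has_density_lip] this turns the bound on the density into a Lipschitz bound on [frac_int],
    which survives pointwise limits. It is what keeps a limit path in [AC_ball]. *)
Lemma Linf_norm_fracD_le (T a : R) n (g : ACpath T a n) (K : R) : 0 < T -> 0 < a < 1 -> 0 <= K ->
  (forall s t : R, 0 <= s -> s <= t -> t <= T ->
    enorm (frac_int g t - frac_int g s) <= frac_const a * K * (t - s)) ->
  (Linf_norm T (fracD g) <= K%:E)%E.
Proof.
move=> T0 a01 K0 gK; have [M [u gu]] := exists_density_fin g; have c0 := frac_const_gt0 a01.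
have [bu ug _] := gu.
have uK s t : 0 <= s -> s <= t -> t <= T -> enorm (prim u t - prim u s) <= K * (t - s).
  move=> s0 st tT; have := gK s t s0 st tT.
  rewrite !(frac_intE a01 gu) ?s0 ?tT ?(le_trans st)// ?(le_trans s0)//.
  by rewrite -scalerBr enormZ ger0_norm ?(ltW c0)// -mulrA ler_pM2l.
have iu i : mu.-integrable `[0, T] (EFin \o (fun r => u r i 0)).
  exact: integrable_bounded_by (bounded_density_coord i bu).
apply/Linf_norm_leP => //.
have nz (x : R) : {ae mu, forall r : R, r != x}.
  exists [set x]; split => //; first by rewrite lebesgue_measure_set1.
  by move=> r /= /negP; rewrite negbK => /eqP.
have := ae_and (ae_and (nz 0) (nz T)) (ae_and ug (prim_lipschitz_density T0 iu uK)).
apply: ae_imp => s [[s0 sT] [us1 us2]] s0T; rewrite -us1//; apply: us2.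
by move: s0T; rewrite !le_eqVlt (eq_sym 0) (negPf s0) (negPf sT).
Qed.

(** [frac_int] is computed directly from [u], again by Abel's identity: [fracD g] is a chosen
    density of the new path, and its equality with [u] is not established. *)
Lemma path_of_density (T a : R) n (x0 : 'cV[R]_n) M (u : R -> 'cV[R]_n) : 0 < T -> 0 < a < 1 ->
  bounded_density M u -> exists g : ACpath T a n,
  (g 0 = x0) /\ (forall t : R, 0 <= t <= T -> g t = x0 + pot_vec a t t u) /\
  (forall t : R, 0 <= t <= T -> frac_int g t = frac_const a *: prim u t).
Proof.
move=> T0 a01 bu.
pose G (t : R) : 'cV[R]_n := if 0 <= t <= T then x0 + pot_vec a t t u else 0.
have G0 : G 0 = x0.
  rewrite /G lexx ltW//=; apply/matrixP => i j.
  by rewrite !mxE /fpot set_itv1 Rintegral_set1 mulr0 addr0.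
have Gout t : ~~ (0 <= t <= T) -> G t = 0 by rewrite /G => /negPf ->.
have M0 : 0 <= M by case: bu => _ /(_ 0); apply: le_trans; exact: enorm_ge0.
have Gu : is_fracD T a G u.
  split; last by move=> t t0T; rewrite G0 /G t0T fracI_pot_vec.
  split; first by move=> i; apply: measurable_funTS; case: bu.
  apply: (@le_lt_trans _ _ M%:E); last exact: ltry.
  by apply/Linf_norm_leP => //; apply: aeW => s _; case: bu.
pose g := MkACpath Gout (ex_intro _ u Gu).
exists g; split => //; split; first by move=> t tT; rewrite /= /G tT.
move=> t /andP[t0 tT]; have /andP[a0 a1] := a01.
apply/matrixP => i j; rewrite ord1 frac_int_coord !mxE /frac_const.
pose v r : R := (Gamma a)^-1 * u r i 0.
have Ga0 := Gamma_gt0 a01; have bui := bounded_density_coord i bu.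
have bv : bounded_by ((Gamma a)^-1 * M) v.
  case: bui => mu_ uM; split; first exact: measurable_funM.
  by move=> r; rewrite normrM ger0_norm ?invr_ge0 ?(ltW Ga0)// ler_wpM2l ?invr_ge0 ?(ltW Ga0).
have -> : \int[mu]_(s in `[0, t]) ((g s - g 0) i 0 / (t - s) `^ (1 - (1 - a))) =
    \int[mu]_(s in `[0, t]) (fpot a s s v / (t - s) `^ (1 - (1 - a))).
  apply: eq_Rintegral => s; rewrite inE/= in_itv/= => /andP[s0 st]; congr (_ / _).
  rewrite /g/= G0 /G s0 (le_trans st)//= addrC addKr mxE /fpot.
  rewrite -RintegralZl//; last exact: integrable_fpot bui.
  by apply: eq_Rintegral => r _; rewrite /v mulrA.
rewrite (abel_identity a01 t0 bv) /v RintegralZl//; last exact: integrable_bounded_by bui.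
by rewrite -!mulrA; congr (_ * _); rewrite mulrCA.
Qed.

End fractional_integral_of_paths.

(** * Penalty on paths and test functions *)

(** Constant in [s] after the current time, so it sees the path only up to that time, as the penalty
    requires. It is locked for the same reason as [frac_int]. *)
HB.lock Definition stop_int {R : realType} {p : R} {hp : 2 <= p} {T a : R} {e l : nat}
    (P : state hp T a e l) (s : R) : 'cV[R]_l :=
  frac_int (spath P) (Num.min (stime P) s).

Section state_facts.
Context {R : realType}.
Notation mu := (@lebesgue_measure R).

Lemma rvar_increment n (r T c t : R) (f : R -> 'cV[R]_n) : 1 <= r -> 0 <= c ->
  0 <= t <= T -> (rvar r T f <= c%:E)%E -> enorm (f t - f 0) <= c.
Proof.
move=> r1 c0 /andP[t0 tT] /rvar_leP -/(_ r1 c0) fc.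
have r0 : 0 < r by rewrite (lt_le_trans _ r1).
move: t0; rewrite le_eqVlt => /predU1P[<-|t0]; first by rewrite subrr enorm0.
have inj x : 0 <= x -> x `^ r <= c `^ r -> x <= c.
  move=> x0; apply: contraTT; rewrite -!ltNge => cx.
  by apply: gt0_ltr_powR; rewrite ?in_itv/= ?andbT.
apply: inj; first exact: enorm_ge0.
move: tT; rewrite le_eqVlt => /predU1P[tT|tT].
  have := fc [:: T]; rewrite /variation_sum big_nat1/= tT; apply.
  by rewrite /itv_partition/= -tT t0 eqxx.
have := fc [:: t; T]; rewrite /variation_sum big_nat_recl// big_nat1/= => h.
apply: le_trans (h _); first by rewrite lerDl powR_ge0.
by rewrite /itv_partition/= t0 tT eqxx.
Qed.

Context {p : R} {hp : 2 <= p} {T a : R} {e l : nat}.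
Hypotheses (T0 : 0 < T) (a01 : 0 < a < 1).
Local Notation X := (state hp T a e l).

(** In the continuity proofs the path part of the metric enters only through this domination of the
    sup distance. *)
Lemma path_dist_sup (P Q : X) (r t : R) : (path_dist P Q < r%:E)%E -> 0 <= t <= T ->
  enorm (spath P t - spath Q t) <= r.
Proof.
move=> d t0T.
pose f s := spath P s - spath Q s.
have := rvar_ge0 (floor_ratio p) T f.
move: d; rewrite /path_dist -/f.
case E : (rvar (floor_ratio p) T f) => [c| |]//; rewrite -?EFinD ?lte_fin ?lee_fin => d c0.
have ft : enorm (f t - f 0) <= c.
  by apply: (rvar_increment (floor_ratio_ge1 hp) c0 t0T); rewrite E.
rewrite -/(f t) -(subrK (f 0) (f t)) (le_trans (enormD _ _))//.
by rewrite addrC (le_trans _ (ltW d))// lerD.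
Qed.

Lemma holder_within_continuous (f : R -> R) (C : R) : 0 <= C ->
  (forall s t, 0 <= s <= T -> 0 <= t <= T -> `|f t - f s| <= C * `|t - s| `^ a) ->
  {within `[0, T], continuous f}.
Proof.
move=> C0 fC; have /andP[a0 a1] := a01.
apply/subspace_continuousP => x; rewrite /= in_itv/= => xT.
apply/cvgrPdist_le => eps eps0.
pose d := (eps / (C + 1)) `^ a^-1.
have C1 : 0 < C + 1 by rewrite ltr_wpDl.
have d0 : 0 < d by apply: powR_gt0; exact: divr_gt0.
exists d => //= y; rewrite /= in_itv/= => yd yT.
apply: (le_trans (fC y x yT xT)).
have : `|x - y| `^ a <= d `^ a by apply: ler_powRl => //; exact: ltW.
rewrite /d -powRrM mulVf ?gt_eqF// powRr1 ?divr_ge0 ?(ltW eps0) ?(ltW C1)// => h.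
rewrite (le_trans (ler_wpM2l C0 h))// mulrA ler_pdivrMr// mulrC.
by rewrite ler_wpM2l ?(ltW eps0)// lerDl.
Qed.

Lemma path_holder (g : ACpath T a l) : exists2 C, 0 <= C & forall s t,
  0 <= s <= T -> 0 <= t <= T -> enorm (g t - g s) <= C * `|t - s| `^ a.
Proof.
have [N [u gu]] := exists_density_fin g; have [bu _ _] := gu.
have N0 : 0 <= N by case: bu => _ /(_ 0); apply: le_trans; exact: enorm_ge0.
have /andP[a0 a1] := a01; have G0 := Gamma_gt0 a01.
exists (l%:R * ((Gamma a)^-1 * (2 * N / a))).
  by rewrite !mulr_ge0 ?invr_ge0 ?(ltW G0) ?(ltW a0).
move=> s t sT tT; rewrite (has_densityE gu sT) (has_densityE gu tT).
rewrite opprD addrACA subrr add0r.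
by case/andP: sT => s0 _; case/andP: tT => t0 _; exact: pot_vec_holder.
Qed.

Lemma path_bounded (g : ACpath T a l) i :
  exists M, bounded_by M (fun s => (g s - g 0) i 0).
Proof.
have /andP[a0 a1] := a01; have [C C0 gC] := path_holder g.
have cg : {within `[0, T], continuous (fun s => g s i 0)}.
  apply: (holder_within_continuous C0) => s t sT tT.
  apply: le_trans (gC s t sT tT); have := coord_le_enorm (g t - g s) i.
  by rewrite !mxE.
have mg : measurable_fun [set: R] (fun s => g s i 0).
  have mg1 : measurable_fun `[0, T] (fun s => g s i 0).
    by apply: subspace_continuous_measurable_fun.
  have := (measurable_restrictT (fun s => g s i 0) (measurable_itv `[0, T])).1 mg1.
  congr measurable_fun; apply/funext => s; rewrite patchE mem_setE.
  by case: ifPn => //; rewrite in_itv/= => /acfun_out ->; rewrite mxE.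
exists (C * T `^ a + enorm (g 0)); split.
  rewrite (_ : (fun s => _) = (fun s => g s i 0 - g 0 i 0)); last by apply/funext => s; rewrite !mxE.
  exact: measurable_funB.
move=> s; rewrite (le_trans (coord_le_enorm _ _))//.
have [sT|sT] := boolP (0 <= s <= T); last first.
  rewrite acfun_out// sub0r enormN lerDr mulr_ge0// powR_ge0//.
have T0T : 0 <= (0 : R) <= T by rewrite lexx ltW.
rewrite (le_trans (gC 0 s T0T sT))// subr0 (le_trans (y := C * T `^ a))//.
  rewrite ler_wpM2l//; apply: ler_powRl => //.
  by case/andP: sT => s0 sT; rewrite ger0_norm.
by rewrite lerDl enorm_ge0.
Qed.

(** A bound for I^(1-a) on [0, T] in the sup norm, summed over the coordinates. The factor 2
    accounts for the initial values that [frac_int] subtracts. *)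
Definition frac_int_modulus : R :=
  l%:R * ((Gamma (1 - a))^-1 * (2 * (T `^ (1 - a) / (1 - a)))).

Lemma frac_int_modulus_ge0 : 0 <= frac_int_modulus.
Proof.
have /andP[a0 a1] := a01.
have G0 : 0 < Gamma (1 - a) by apply: Gamma_gt0; lra.
rewrite /frac_int_modulus !mulr_ge0 ?invr_ge0 ?(ltW G0) ?powR_ge0//; lra.
Qed.

Lemma frac_int_sup (g h : ACpath T a l) (d t : R) :
  (forall s, 0 <= s <= T -> enorm (g s - h s) <= d) -> 0 <= t <= T ->
  enorm (frac_int g t - frac_int h t) <= frac_int_modulus * d.
Proof.
move=> ghd /andP[t0 tT]; have /andP[a0 a1] := a01.
have a01' : 0 < 1 - a < 1 by lra.
have G0 := Gamma_gt0 a01'; have a'0 : 0 < 1 - a by lra.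
have d0 : 0 <= d by apply: le_trans (ghd 0 _); rewrite ?enorm_ge0 ?lexx ?ltW.
rewrite /frac_int_modulus -mulrA; apply: enorm_le_bound => i; rewrite coordB !frac_int_coord.
have [Mg bg] := path_bounded g i; have [Mh bh] := path_bounded h i.
rewrite -mulrBr normrM ger0_norm ?invr_ge0 ?(ltW G0)// -mulrA ler_wpM2l ?invr_ge0 ?(ltW G0)//.
have ig := integrable_fpot 0 a'0 (lexx t) bg.
have ih := integrable_fpot 0 a'0 (lexx t) bh.
rewrite -RintegralB//.
pose w s := if 0 <= s <= T then (g s - g 0) i 0 - (h s - h 0) i 0 else 0.
have bw : bounded_by (2 * d) w.
  split.
    apply: measurable_fun_ifT => //.
      rewrite (_ : (fun t => _) = (fun s : R => (0 <= s) && (s <= T)))//.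
      by apply: measurable_and; apply: measurable_fun_ler.
    by apply: measurable_funB; [case: bg|case: bh].
  move=> s; rewrite /w; case: ifPn => [sT|_]; last by rewrite normr0 mulr_ge0.
  have -> : (g s - g 0) i 0 - (h s - h 0) i 0 = (g s - h s) i 0 - (g 0 - h 0) i 0.
    by rewrite !mxE; ring.
  rewrite (le_trans (ler_normB _ _))// mulr2n mulrDl mul1r lerD//.
    by rewrite (le_trans (coord_le_enorm _ _))// ghd.
  by rewrite (le_trans (coord_le_enorm _ _))// ghd// lexx ltW.
have -> : \int[mu]_(s in `[0, t]) ((g s - g 0) i 0 / (t - s) `^ (1 - (1 - a)) -
     (h s - h 0) i 0 / (t - s) `^ (1 - (1 - a))) =
  \int[mu]_(s in `[0, t]) (w s / (t - s) `^ (1 - (1 - a))).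
  apply: eq_Rintegral => s; rewrite inE/= in_itv/= => /andP[s0 st].
  by rewrite /w s0 (le_trans st)//= mulrBl.
apply: (le_trans (fpot_bound a'0 t0 (lexx t) bw)).
rewrite subrr [0 `^ _]powR0 ?gt_eqF// !subr0 -mulrA -[leRHS]mulrA ler_wpM2l// mulrC ler_wpM2r//.
by rewrite ler_wpM2r ?invr_ge0 ?(ltW a'0)//; exact: ler_powRl.
Qed.

Local Opaque frac_int_modulus.

Lemma frac_int_le0 (g : ACpath T a l) s : s <= 0 -> frac_int g s = 0.
Proof.
move=> s0; apply/matrixP => i j; rewrite ord1 frac_int_coord mxE.
move: s0; rewrite le_eqVlt => /predU1P[->|s0]; first by rewrite set_itv1 Rintegral_set1 mulr0.
by rewrite set_itv_ge ?Rintegral_set0 ?mulr0// bnd_simp -ltNge.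
Qed.

Lemma clamp_lip (c s t : R) :
  `|Num.max 0 (Num.min c t) - Num.max 0 (Num.min c s)| <= `|t - s|.
Proof.
have h1 := ler_norm (t - s); have := ler_norm (s - t); rewrite distrC => h2.
rewrite ler_norml !maxElt !minElt.
by apply/andP; split; case: (ltP c t) => ?; case: (ltP c s) => ?; do !case: ltP => ?; lra.
Qed.

Lemma stop_int_lip_density (P : X) M u s t : has_density M (spath P) u ->
  enorm (stop_int P t - stop_int P s) <= frac_const a * M * `|t - s|.
Proof.
move=> gu; have c0 := frac_const_gt0 a01; have /andP[tp0 tpT] := stimeP P.
have M0 : 0 <= M by case: gu => -[_ /(_ 0)] + _ _; apply: le_trans; exact: enorm_ge0.
(* For a negative argument the integral is over an empty interval, so the argument may be clamped to
   [0, T], where the formula by densities holds. *)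
have toclamp r : stop_int P r = frac_int (spath P) (Num.max 0 (Num.min (stime P) r)).
  rewrite stop_int.unlock; have [h|h] := leP 0 (Num.min (stime P) r); first by [].
  by rewrite [RHS]frac_int_le0// frac_int_le0// ltW.
have inT r : 0 <= Num.max 0 (Num.min (stime P) r) <= T.
  by rewrite le_max lexx/= ge_max ltW//= ge_min tpT.
rewrite !toclamp (le_trans (has_density_lip a01 gu (inT s) (inT t)))//.
rewrite ler_wpM2l ?clamp_lip// mulr_ge0//; exact: ltW.
Qed.

Lemma stop_int_lip (P : X) : exists2 L, 0 <= L &
  forall s t, enorm (stop_int P t - stop_int P s) <= L * `|t - s|.
Proof.
have [M [u gu]] := exists_density_fin (spath P).
exists (frac_const a * M) => [|s t]; last exact: stop_int_lip_density gu.
rewrite mulr_ge0 ?(ltW (frac_const_gt0 a01))//.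
by case: gu => -[_ /(_ 0)] + _ _; apply: le_trans; exact: enorm_ge0.
Qed.

Lemma stop_int_le0 (P : X) s : s <= 0 -> stop_int P s = 0.
Proof. by move=> s0; rewrite stop_int.unlock; apply: frac_int_le0; rewrite ge_min s0 orbT. Qed.

Lemma stop_int_ge (P : X) s : stime P <= s -> stop_int P s = frac_int (spath P) (stime P).
Proof. by move=> ts; rewrite stop_int.unlock min_l. Qed.

Lemma stop_int_lt (P : X) s : s <= stime P -> stop_int P s = frac_int (spath P) s.
Proof. by move=> ts; rewrite stop_int.unlock min_r. Qed.

Lemma stop_int_bounded_density (P : X) : exists M, bounded_density M (stop_int P).
Proof.
have [L L0 PL] := stop_int_lip P; exists (L * T); split; last first.
  move=> s; have [s0|s0] := leP s 0.
    by rewrite stop_int_le0// enorm0 mulr_ge0// ltW.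
  have /andP[tp0 tpT] := stimeP P.
  have [ts|st] := leP (stime P) s.
    have := PL 0 (stime P); rewrite (stop_int_le0 P (lexx 0)) !subr0.
    rewrite stop_int_ge// (stop_int_ge ts) => h; apply: (le_trans h).
    by rewrite ler_wpM2l// ger0_norm.
  have := PL 0 s; rewrite (stop_int_le0 P (lexx 0)) !subr0 => h; apply: (le_trans h).
  by rewrite ler_wpM2l// gtr0_norm// (le_trans (ltW st)).
move=> i; apply: continuous_measurable_fun => x.
apply/cvgrPdist_le => eps eps0.
have L1 : 0 < L + 1 by rewrite ltr_wpDl.
exists (eps / (L + 1)); first by rewrite /= divr_gt0.
move=> y /= xy.
have := coord_le_enorm (stop_int P x - stop_int P y) i; rewrite coordB => h.
apply: (le_trans h); apply: (le_trans (PL _ _)).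
have := ltW xy; rewrite ler_pdivlMr// => h2; apply: le_trans h2.
by rewrite mulrC ler_wpM2l// lerDl.
Qed.

(** The stopping time is moved along the path of [P] first, and only then is the path exchanged.
    Thus only the density of [P] enters; states close in the metric have no common density bound. *)
Lemma stop_int_near (P : X) (eps : R) : 0 < eps ->
  \forall Q \near P, forall s, enorm (stop_int P s - stop_int Q s) <= eps.
Proof.
move=> eps0; have [M [u gu]] := exists_density_fin (spath P).
pose L := frac_const a * M.
have M0 : 0 <= M by case: gu => -[_ /(_ 0)] + _ _; apply: le_trans; exact: enorm_ge0.
have L0 : 0 <= L by rewrite mulr_ge0// ltW// frac_const_gt0.
have C0 := frac_int_modulus_ge0; pose D := L + frac_int_modulus + 1.
have D0 : 0 < D by rewrite /D; lra.
apply/nbhs_ballP; exists (eps / D); first exact: divr_gt0.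
move=> Q /rho_ballP[PQt _ PQg] s.
have /andP[tp0 tpT] := stimeP P; have /andP[tq0 tqT] := stimeP Q.
have d0 : 0 < eps / D by rewrite divr_gt0.
have [s0|s0] := leP s 0; first by rewrite !stop_int_le0// subrr enorm0 ltW.
have inT (c : R) : 0 <= c <= T -> 0 <= Num.min c s <= T.
  by move=> /andP[c0 cT]; rewrite le_min c0 ltW//= ge_min cT.
rewrite -(subrKA (frac_int (spath P) (Num.min (stime Q) s))).
rewrite (le_trans (enormD _ _))//.
have h1 : enorm (stop_int P s - frac_int (spath P) (Num.min (stime Q) s)) <= L * (eps / D).
  rewrite stop_int.unlock (le_trans (has_density_lip a01 gu (inT _ (stimeP Q)) (inT _ (stimeP P))))//.
  rewrite ler_wpM2l// (le_trans _ (ltW PQt))//.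
  have ab1 := ler_norm (stime P - stime Q); have := ler_norm (stime Q - stime P).
  rewrite distrC => ab2; rewrite ler_norml !minElt.
  by case: ltP => ?; case: ltP => ?; apply/andP; split; lra.
have h2 : enorm (frac_int (spath P) (Num.min (stime Q) s) - stop_int Q s) <= frac_int_modulus * (eps / D).
  rewrite stop_int.unlock; apply: frac_int_sup; last exact: inT (stimeP Q).
  by move=> r rT; exact: path_dist_sup PQg rT.
rewrite (le_trans (lerD h1 h2))// -mulrDl mulrA ler_pdivrMr// mulrC ler_wpM2l ?(ltW eps0)//.
by rewrite /D lerDl.
Qed.

Lemma enormB_le n (x y : 'cV[R]_n) : enorm (x - y) <= enorm x + enorm y.
Proof. by rewrite (le_trans (enormD _ _))// enormN. Qed.

(* The penalty compares the paths only through the primitives of their densities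
   up to the current time, the quantities in which ci-derivatives are taken. *)
Definition penalty_fun (P Q : X) (s : R) : R := dot (stop_int P s - stop_int Q s) (stop_int P s - stop_int Q s).

(** The first term is there because [frac_int] does not see the initial value. The integral runs up
    to [T] rather than to the current time, so that moving time acts only through the stopped
    integrals. *)
Definition penalty (P Q : X) : R :=
  enorm (spath P 0 - spath Q 0) ^+ 2 + \int[mu]_(s in `[0, T]) penalty_fun P Q s.

Lemma bounded_densityB n M N (u v : R -> 'cV[R]_n) : bounded_density M u -> bounded_density N v ->
  bounded_density (M + N) (fun s => u s - v s).
Proof.
move=> [mu_ uM] [mv vN]; split.
  move=> i; rewrite (_ : (fun r => _) = (fun r => u r i 0 - v r i 0)).
    exact: measurable_funB.
  by apply/funext => r; rewrite !mxE.
by move=> r; rewrite (le_trans (enormD _ _))// enormN lerD.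
Qed.

Lemma bounded_by_dot n M N (u v : R -> 'cV[R]_n) : bounded_density M u -> bounded_density N v ->
  bounded_by (M * N) (fun s => dot (u s) (v s)).
Proof.
move=> [mu_ uM] [mv vN]; split.
  by apply: measurable_sum => i; exact: measurable_funM.
by move=> r; rewrite (le_trans (dot_norm_le _ _))// ler_pM ?enorm_ge0.
Qed.

Lemma penalty_fun_bounded (P Q : X) : exists M, bounded_by M (penalty_fun P Q).
Proof.
have [M bM] := stop_int_bounded_density P; have [N bN] := stop_int_bounded_density Q.
have b := bounded_densityB bM bN.
by exists ((M + N) * (M + N)); exact: (bounded_by_dot b).
Qed.

Lemma penalty_fun_sym (P Q : X) : penalty_fun P Q = penalty_fun Q P.
Proof.
apply/funext => s; rewrite /penalty_fun -[LHS]enorm_sqr -[RHS]enorm_sqr.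
by move: (stop_int P s) (stop_int Q s) => x y; rewrite enormB.
Qed.

Lemma penalty_sym (P Q : X) : penalty P Q = penalty Q P.
Proof. by rewrite /penalty (enormB (spath P 0)) penalty_fun_sym. Qed.

Lemma penalty_ge0 (P Q : X) : 0 <= penalty P Q.
Proof.
by rewrite addr_ge0 ?exprn_ge0 ?enorm_ge0// Rintegral_ge0// => s _; exact: dot_ge0.
Qed.

Lemma dot_sqr_perturb n (A B : 'cV[R]_n) (M eps : R) : enorm A <= M -> enorm (A - B) <= eps ->
  `|dot A A - dot B B| <= eps * (2 * M + eps).
Proof.
move=> AM ABe; have e0 : 0 <= eps by apply: le_trans ABe; exact: enorm_ge0.
have -> : dot A A - dot B B = dot (A - B) (A + B).
  by rewrite dotBl !dotDr (dotC B A); ring.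
rewrite (le_trans (dot_norm_le _ _))// ler_pM ?enorm_ge0//.
have -> : A + B = (2 *: A) - (A - B) by rewrite scaler_nat mulr2n; rewrite opprB addrCA addrK addrC.
rewrite (le_trans (enormD _ _))// enormN lerD// enormZ ger0_norm//.
by rewrite ler_wpM2l.
Qed.

Lemma spath0_near (P : X) (eps : R) : 0 < eps ->
  \forall Q \near P, enorm (spath P 0 - spath Q 0) <= eps.
Proof.
move=> e0; apply/nbhs_ballP; exists eps => //.
move=> Q /rho_ballP[_ _ d]; apply: (path_dist_sup d).
by rewrite lexx ltW.
Qed.

Lemma penalty_near (P Q : X) (eps : R) : 0 < eps ->
  \forall P' \near P & Q' \near Q, `|penalty P Q - penalty P' Q'| <= eps.
Proof.
move=> eps0.
have [M bM] := stop_int_bounded_density P; have [N bN] := stop_int_bounded_density Q.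
have b := bounded_densityB bM bN.
pose K := M + N + enorm (spath P 0 - spath Q 0).
have MN0 : 0 <= M + N by case: b => _ /(_ 0); apply: le_trans; exact: enorm_ge0.
have K0 : 0 <= K by rewrite addr_ge0 ?enorm_ge0.
(* In the factor [T + 1], the 1 pays for the initial values and [T] for the integral; [d <= 1]
   bounds the quadratic term of [dot_sqr_perturb]. *)
pose d := Num.min 1 (eps / ((2 * K + 1) * (T + 1))).
have T1 : 0 < T + 1 by rewrite addr_gt0.
have K1 : 0 < 2 * K + 1 by lra.
have d0 : 0 < d by rewrite lt_min ltr01 divr_gt0 ?mulr_gt0.
have d1 : d <= 1 by rewrite ge_min lexx.
have dK : d * (2 * K + d) * (T + 1) <= eps.
  apply: (@le_trans _ _ (eps / ((2 * K + 1) * (T + 1)) * (2 * K + 1) * (T + 1))); last first.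
    by rewrite -mulrA divfK// gt_eqF ?mulr_gt0.
  rewrite ler_wpM2r ?(ltW T1)// ler_pM//; first exact: ltW.
  - by rewrite addr_ge0 ?(ltW d0)// mulr_ge0.
  - by rewrite ge_min lexx orbT.
  - by rewrite lerD2l.
have d20 : 0 < d / 2 by rewrite divr_gt0.
near=> P' Q'.
have hP s : enorm (stop_int P s - stop_int P' s) <= d / 2.
  by move: s; near: P'; exact: stop_int_near.
have hQ s : enorm (stop_int Q s - stop_int Q' s) <= d / 2.
  by move: s; near: Q'; exact: stop_int_near.
have hP0 : enorm (spath P 0 - spath P' 0) <= d / 2 by near: P'; exact: spath0_near.
have hQ0 : enorm (spath Q 0 - spath Q' 0) <= d / 2 by near: Q'; exact: spath0_near.
have cmp (x y x' y' : 'cV[R]_l) : enorm (x - x') <= d / 2 -> enorm (y - y') <= d / 2 ->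
    enorm ((x - y) - (x' - y')) <= d.
  move=> h1 h2; have -> : (x - y) - (x' - y') = (x - x') - (y - y').
    by apply/matrixP => i j; rewrite !mxE; ring.
  by rewrite (le_trans (enormD _ _))// enormN (splitr d) lerD.
have [M1 b1] := penalty_fun_bounded P Q; have [M2 b2] := penalty_fun_bounded P' Q'.
have i1 := integrable_bounded_by 0 T b1; have i2 := integrable_bounded_by 0 T b2.
have i12 : mu.-integrable `[0, T] (EFin \o (fun s => penalty_fun P Q s - penalty_fun P' Q' s)).
  by have := @integrableB _ _ _ mu `[0, T] _ _ _ i1 i2; apply.
have -> : penalty P Q - penalty P' Q' =
  (enorm (spath P 0 - spath Q 0) ^+ 2 - enorm (spath P' 0 - spath Q' 0) ^+ 2) +
  \int[mu]_(s in `[0, T]) (penalty_fun P Q s - penalty_fun P' Q' s).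
  rewrite RintegralB; [|by []|exact: i1|exact: i2].
  by rewrite /penalty opprD addrACA.
rewrite (le_trans (ler_normD _ _))//; apply: le_trans dK.
rewrite [leRHS]mulrDr mulr1 [leRHS]addrC lerD//.
  rewrite !enorm_sqr; apply: dot_sqr_perturb; last exact: cmp.
  by rewrite /K lerDr.
apply: (le_trans (le_normr_Rintegral _ i12)) => //.
have := @Rintegral_cst_itv R (d * (2 * K + d)) 0 T (ltW T0); rewrite subr0 => <-.
apply: le_Rintegral => //.
- by have := integrable_norm i12.
- exact: integrable_cst_itv.
- move=> s _; rewrite /penalty_fun; apply: dot_sqr_perturb; last exact: cmp.
  case: b => _ /(_ s) bs; apply: (le_trans bs).
  by rewrite /K lerDl enorm_ge0.
Unshelve. all: by end_near. Qed.

(* Half the gradient of penalty P Q in the path of P, which by the chain rule is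
   the integral of stop_int P T - stop_int Q s over s in [stime P, T]. *)
Definition penalty_grad (P Q : X) : 'cV[R]_l :=
  (T - stime P) *: stop_int P T - (prim (stop_int Q) T - prim (stop_int Q) (stime P)).

(** At equal times both stopped integrals are constant from that time on, so the gradient is the
    remaining time multiplied by the difference of their final values. *)
Lemma penalty_grad_antisym (P Q : X) : stime P = stime Q ->
  penalty_grad P Q = - penalty_grad Q P.
Proof.
move=> PQ; have /andP[tp0 tpT] := stimeP P.
have key (S S' : X) : stime S = stime S' ->
    penalty_grad S S' = (T - stime S) *: (stop_int S T - stop_int S' T).
  move=> SS; have /andP[t0 tT] := stimeP S.
  have [M bM] := stop_int_bounded_density S'.
  rewrite /penalty_grad scalerBr; congr (_ - _).
  apply/matrixP => i j; rewrite ord1 (primB _ bM)//.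
  have -> : \int[mu]_(r in `[stime S, T]) stop_int S' r i 0 =
      \int[mu]_(r in `[stime S, T]) (stop_int S' T i 0).
    apply: eq_Rintegral => r; rewrite inE/= in_itv/= => /andP[sr rT].
    rewrite stop_int_ge ?(stop_int_ge (P := S') (s := T)) -?SS//.
  by rewrite Rintegral_cst_itv// [RHS]mxE mulrC.
by rewrite (key P Q)// (key Q P)// PQ -scalerN opprB.
Qed.

Lemma penalty_grad_near (P Q : X) (eps : R) : 0 < eps ->
  \forall P' \near P & Q' \near Q, enorm (penalty_grad P Q - penalty_grad P' Q') <= eps.
Proof.
move=> eps0.
have [M bM] := stop_int_bounded_density P; have [N bN] := stop_int_bounded_density Q.
have M0 : 0 <= M by case: bM => _ /(_ 0); apply: le_trans; exact: enorm_ge0.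
have N0 : 0 <= N by case: bN => _ /(_ 0); apply: le_trans; exact: enorm_ge0.
pose D := M + N + 3 * T + 1.
have D0 : 0 < D by rewrite /D ltr_wpDl// !addr_ge0// mulr_ge0// ltW.
pose d := eps / D; have d0 : 0 < d by rewrite divr_gt0.
near=> P' Q'.
have hP s : enorm (stop_int P s - stop_int P' s) <= d.
  by move: s; near: P'; exact: stop_int_near.
have hQ s : enorm (stop_int Q s - stop_int Q' s) <= d.
  by move: s; near: Q'; exact: stop_int_near.
have ht : `|stime P - stime P'| <= d.
  near: P'; apply/nbhs_ballP; exists d => // P' /rho_ballP[h _ _]; exact: ltW.
have [N' bN'] := stop_int_bounded_density Q'.
have bd := bounded_densityB bN bN'.
have bd' : bounded_density d (fun s => stop_int Q s - stop_int Q' s).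
  by split; [case: bd|exact: hQ].
have /andP[t0 tT] := stimeP P; have /andP[t0' tT'] := stimeP P'.
have primD s : prim (stop_int Q) s - prim (stop_int Q') s = prim (fun s => stop_int Q s - stop_int Q' s) s.
  apply/matrixP => i j; rewrite ord1 coordB !mxE -RintegralB; first last.
  - exact: integrable_bounded_by (bounded_density_coord i bN').
  - exact: integrable_bounded_by (bounded_density_coord i bN).
  - by [].
  - by apply: eq_Rintegral => r _; rewrite coordB.
have -> : penalty_grad P Q - penalty_grad P' Q' =
   ((stime P' - stime P) *: stop_int P T + (T - stime P') *: (stop_int P T - stop_int P' T))
   - ((prim (fun s => stop_int Q s - stop_int Q' s) T - prim (fun s => stop_int Q s - stop_int Q' s) (stime P'))
      - (prim (stop_int Q) (stime P) - prim (stop_int Q) (stime P'))).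
  rewrite -!primD /penalty_grad.
  move: (stop_int P T) (stop_int P' T) (prim (stop_int Q) T) (prim (stop_int Q') T)
    (prim (stop_int Q) (stime P)) (prim (stop_int Q) (stime P')) (prim (stop_int Q') (stime P')).
  move=> A A' B B' C C' E; apply/matrixP => i j; rewrite !mxE; ring.
have n1 : enorm ((stime P' - stime P) *: stop_int P T) <= d * M.
  by rewrite enormZ ler_pM ?enorm_ge0//; [rewrite distrC|case: bM].
have n2 : enorm ((T - stime P') *: (stop_int P T - stop_int P' T)) <= T * d.
  rewrite enormZ ler_pM ?enorm_ge0// ger0_norm ?subr_ge0//; lra.
have n3 : enorm (prim (fun s => stop_int Q s - stop_int Q' s) T - prim (fun s => stop_int Q s - stop_int Q' s) (stime P')) <= d * T.
  apply: (le_trans (prim_lip bd' t0' (ltW T0))); rewrite ler_wpM2l ?(ltW d0)//.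
  rewrite ger0_norm ?subr_ge0//; lra.
have n4 : enorm (prim (stop_int Q) (stime P) - prim (stop_int Q) (stime P')) <= N * d.
  apply: (le_trans (prim_lip bN t0' t0)); exact: ler_wpM2l.
rewrite (le_trans (enormB_le _ _))//.
have n12 := le_trans (enormD _ _) (lerD n1 n2).
have n34 := le_trans (enormB_le _ _) (lerD n3 n4).
apply: (le_trans (lerD n12 n34)).
have -> : d * M + T * d + (d * T + N * d) = d * (M + N + 2 * T) by ring.
rewrite /d -mulrA (le_trans (y := eps * 1))//.
  by rewrite ler_wpM2l ?(ltW eps0)// mulrC ler_pdivrMr// mul1r /D; lra.
by rewrite mulr1.
Unshelve. all: by end_near. Qed.

Lemma frac_int_eq (g h : ACpath T a l) t : (forall s, 0 <= s <= t -> g s = h s) -> 0 <= t ->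
  frac_int g t = frac_int h t.
Proof.
move=> gh t0; apply/matrixP => i j; rewrite ord1 !frac_int_coord; congr (_ * _).
apply: eq_Rintegral => s; rewrite inE/= in_itv/= => sT.
by rewrite !mxE gh// gh// lexx.
Qed.

Lemma dot_expand n (x y j : 'cV[R]_n) :
  dot (x + y) (x + y) - dot x x - 2 * dot x j = 2 * dot x (y - j) + dot y y.
Proof. by rewrite dotBr dotDl !dotDr (dotC y x); ring. Qed.

Lemma dot0r n (x : 'cV[R]_n) : dot x 0 = 0.
Proof. by rewrite /dot big1// => i _; rewrite [X in _ * X]mxE mulr0. Qed.

(** Let A be the difference of the stopped integrals of [P] and [Q0], D the change of [stop_int]
    along [nu], and j its final value. D vanishes up to t, is O(z - t) afterwards, and equals j from
    z on. In |A + D|^2 - |A|^2 - 2 <A, j> = 2 <A, D - j> + |D|^2 the first term matters only on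
    [t, z] and the second is quadratic, so the integral is of order (z - t)^2. The constant involves
    the density bound of [nu], on which the remainder of a ci-derivative may depend. *)
Lemma penalty_ci (P Q0 : X) (nu : ACpath T a l) :
  (forall s, 0 <= s <= stime P -> nu s = spath P s) ->
  exists2 C, 0 <= C & forall Q : X, spath Q = nu -> stime P < stime Q < T ->
    `|penalty Q Q0 - penalty P Q0 -
      dot (2 *: penalty_grad P Q0) (frac_int nu (stime Q) - frac_int (spath P) (stime P))|
    <= C * (stime Q - stime P) ^+ 2.
Proof.
move=> nuP; have /andP[t0 tT] := stimeP P.
have [N [u nuu]] := exists_density_fin nu.
have N0 : 0 <= N by case: nuu => -[_ /(_ 0)] + _ _; apply: le_trans; exact: enorm_ge0.
pose L := frac_const a * N; have L0 : 0 <= L by rewrite mulr_ge0// ltW// frac_const_gt0.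
have [M bM] := stop_int_bounded_density P; have [M' bM'] := stop_int_bounded_density Q0.
have bA := bounded_densityB bM bM'; set K := M + M' in bA.
have K0 : 0 <= K by case: bA => _ /(_ 0); apply: le_trans; exact: enorm_ge0.
exists (4 * K * L + T * L ^+ 2); first by rewrite addr_ge0// mulr_ge0 ?sqr_ge0 ?(ltW T0)// mulr_ge0.
move=> Q Qnu /andP[tz zT]; set z := stime Q in tz zT *; set t := stime P in t0 tT tz *.
have z0 : 0 <= z by rewrite (le_trans t0)// ltW.
pose y := stop_int Q0.
pose A s := stop_int P s - y s.
pose D s := stop_int Q s - stop_int P s.
pose j := frac_int nu z - frac_int (spath P) t.
have JQ s : stop_int Q s = frac_int nu (Num.min z s) by rewrite stop_int.unlock -Qnu.
have D0 s : 0 <= s <= t -> D s = 0.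
  move=> /andP[s0 st]; rewrite /D JQ min_r; last by rewrite (le_trans st)// ltW.
  rewrite stop_int_lt// (@frac_int_eq nu (spath P)) ?subrr// => r /andP[r0 rs].
  by apply: nuP; rewrite r0 (le_trans rs).
have nut : frac_int nu t = frac_int (spath P) t by exact: frac_int_eq.
have DE s : t <= s -> D s = frac_int nu (Num.min z s) - frac_int nu t.
  by move=> ts; rewrite /D JQ stop_int_ge// nut.
have zt0 : 0 <= z - t by rewrite subr_ge0 ltW.
have DL s : t <= s -> enorm (D s) <= L * (z - t).
  move=> ts; rewrite DE// (le_trans (has_density_lip a01 nuu _ _))//.
  - by rewrite t0.
  - by rewrite le_min z0 (le_trans t0)//= ge_min (ltW zT).
  - rewrite ler_wpM2l// ger0_norm; first by rewrite lerD2r ge_min lexx.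
    by rewrite subr_ge0 le_min (ltW tz).
have Dj s : z <= s -> D s = j.
  by move=> zs; rewrite DE ?(le_trans (ltW tz))// min_l// nut.
have jL : enorm j <= L * (z - t) by rewrite -(Dj z (lexx z)) DL// ltW.
(* the integrand |A + D|^2 - |A|^2 - 2 <A, j> *)
pose E s := penalty_fun Q Q0 s - penalty_fun P Q0 s - 2 * dot (A s) j.
have EE s : E s = 2 * dot (A s) (D s - j) + dot (D s) (D s).
  rewrite /E /penalty_fun -/y (_ : stop_int Q s - y s = A s + D s); last first.
    by rewrite /A /D [RHS]addrC subrKA.
  exact: dot_expand.
have AK s : enorm (A s) <= K by case: bA => _; exact.
have E1 s : z <= s -> `|E s| <= L ^+ 2 * (z - t) ^+ 2.
  move=> zs; rewrite EE Dj// subrr.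
  rewrite dot0r mulr0 add0r ger0_norm ?dot_ge0// -enorm_sqr -exprMn ler_pXn2r ?nnegrE ?enorm_ge0//.
  by rewrite mulr_ge0.
have E2 s : t <= s -> `|E s| <= 4 * K * L * (z - t) + L ^+ 2 * (z - t) ^+ 2.
  move=> ts; rewrite EE (le_trans (ler_normD _ _))// lerD//.
    rewrite normrM ger0_norm// (le_trans (y := 2 * (K * (2 * (L * (z - t))))))//.
      rewrite ler_wpM2l// (le_trans (dot_norm_le _ _))// ler_pM ?enorm_ge0//.
      rewrite (le_trans (enormD _ _))// enormN mulr2n mulrDl mul1r lerD//; exact: DL.
    by rewrite le_eqVlt; apply/orP; left; apply/eqP; ring.
  rewrite ger0_norm ?dot_ge0// -enorm_sqr -exprMn ler_pXn2r ?nnegrE ?enorm_ge0//; first exact: DL.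
  by rewrite mulr_ge0.
have [M1 b1] := penalty_fun_bounded Q Q0; have [M2 b2] := penalty_fun_bounded P Q0.
have bj : bounded_density (enorm j) (cst j) by split.
have b3 := bounded_by_dot bA bj.
have i1 x x' := integrable_bounded_by x x' b1.
have i2 x x' := integrable_bounded_by x x' b2.
have i3 x x' := integrable_bounded_by x x' b3.
have i12 x x' : mu.-integrable `[x, x'] (EFin \o (fun s => penalty_fun Q Q0 s - penalty_fun P Q0 s)).
  by have := @integrableB _ _ _ mu `[x, x'] _ _ _ (i1 x x') (i2 x x'); apply.
have i3' x x' : mu.-integrable `[x, x'] (EFin \o (fun s => 2 * dot (A s) j)).
  by have := @integrableZl _ _ _ mu `[x, x'] _ 2 _ (i3 x x'); apply.
have iE x x' : mu.-integrable `[x, x'] (EFin \o E).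
  by have := @integrableB _ _ _ mu `[x, x'] _ _ _ (i12 x x') (i3' x x'); apply.
have tT' : t <= T by [].
(* Up to t nothing changes, and the integral of [A] over [t, T] is [penalty_grad P Q0] because
   [stop_int P] is constant there. *)
have main : penalty Q Q0 - penalty P Q0 - dot (2 *: penalty_grad P Q0) j =
    \int[mu]_(s in `[t, T]) E s.
  have -> : \int[mu]_(s in `[t, T]) E s =
     \int[mu]_(s in `[t, T]) (penalty_fun Q Q0 s - penalty_fun P Q0 s) -
     \int[mu]_(s in `[t, T]) (2 * dot (A s) j).
    by rewrite -RintegralB.
  congr (_ - _).
    have -> : penalty Q Q0 - penalty P Q0 = \int[mu]_(s in `[0, T]) (penalty_fun Q Q0 s - penalty_fun P Q0 s).
      rewrite RintegralB; [|by []|exact: i1|exact: i2].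
      by rewrite /penalty Qnu nuP ?lexx// opprD addrACA subrr add0r.
    rewrite (Rintegral_split t0 tT'); last exact: i12.
    rewrite (_ : \int[mu]_(s in `[0, t]) _ = 0) ?add0r//.
    rewrite (_ : \int[mu]_(s in `[0, t]) _ = \int[mu]_(s in `[0, t]) 0).
      by rewrite Rintegral_cst_itv// mul0r.
    apply: eq_Rintegral => s; rewrite inE/= in_itv/= => st.
    by rewrite /penalty_fun -(subrK (stop_int P s) (stop_int Q s)) -/(D s) D0// add0r subrr.
  rewrite RintegralZl; [|by []|exact: i3].
  rewrite dotZl; congr (_ * _).
  have -> : \int[mu]_(s in `[t, T]) dot (A s) j = \sum_(i < l) \int[mu]_(s in `[t, T]) (A s i 0) * j i 0.
    have iA i : mu.-integrable `[t, T] (EFin \o (fun s => A s i 0)).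
      exact: integrable_bounded_by (bounded_density_coord i bA).
    rewrite /dot /Rintegral; under eq_integral do rewrite -sumEFin.
    rewrite integral_sum//; last first.
      by move=> i; have := @integrableZr _ _ _ mu `[t, T] _ (j i 0) _ (iA i); apply.
    rewrite -sum_fine//; last first.
      move=> i _; apply: integrable_fin_num => //.
      by have := @integrableZr _ _ _ mu `[t, T] _ (j i 0) _ (iA i); apply.
    by apply: eq_bigr => i _; have := @RintegralZr _ _ _ mu `[t, T] _ (j i 0) (measurable_itv _) (iA i); apply.
  apply: eq_bigr => i _; congr (_ * _).
  have -> : \int[mu]_(s in `[t, T]) (A s i 0) = \int[mu]_(s in `[t, T]) (stop_int P T i 0 - y s i 0).
    apply: eq_Rintegral => s; rewrite inE/= in_itv/= => /andP[ts sT].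
    by rewrite /A coordB stop_int_ge// (stop_int_ge (P := P) (s := T)).
  rewrite RintegralB//; [|exact: integrable_cst_itv|exact: integrable_bounded_by (bounded_density_coord i bM')].
  rewrite Rintegral_cst_itv// /penalty_grad coordB (primB _ bM')// [X in X - _]mxE mulrC.
  by [].
rewrite -/j main (Rintegral_split (ltW tz) (ltW zT)); last exact: iE.
rewrite (le_trans (ler_normD _ _))//.
have B1 : `|\int[mu]_(s in `[t, z]) E s| <= (4 * K * L * (z - t) + L ^+ 2 * (z - t) ^+ 2) * (z - t).
  apply: (le_trans (le_normr_Rintegral _ (iE t z))) => //.
  rewrite -Rintegral_cst_itv ?(ltW tz)//; apply: le_Rintegral => //.
  - by have := integrable_norm (iE t z).
  - exact: integrable_cst_itv.
  - by move=> s; rewrite /= in_itv/= => /andP[ts _]; exact: E2.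
have B2 : `|\int[mu]_(s in `[z, T]) E s| <= L ^+ 2 * (z - t) ^+ 2 * (T - z).
  apply: (le_trans (le_normr_Rintegral _ (iE z T))) => //.
  rewrite -Rintegral_cst_itv ?(ltW zT)//; apply: le_Rintegral => //.
  - by have := integrable_norm (iE z T).
  - exact: integrable_cst_itv.
  - by move=> s; rewrite /= in_itv/= => /andP[zs _]; exact: E1.
rewrite (le_trans (lerD B1 B2))//.
have -> : (4 * K * L * (z - t) + L ^+ 2 * (z - t) ^+ 2) * (z - t) + L ^+ 2 * (z - t) ^+ 2 * (T - z)
  = (4 * K * L + (T - t) * L ^+ 2) * (z - t) ^+ 2 by ring.
rewrite ler_wpM2r ?sqr_ge0// lerD2l ler_wpM2r ?sqr_ge0//; lra.
Qed.

End state_facts.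

Section continuity.
Context {R : realType} {V : topologicalType}.

Lemma continuous_dist (W : normedModType R) (f : V -> W) :
  (forall v (eps : R), 0 < eps -> \forall w \near v, `|f v - f w| <= eps) -> continuous f.
Proof. by move=> fP v; apply/cvgrPdist_le => eps e0; exact: fP. Qed.

Lemma continuous_enorm n (f : V -> 'cV[R]_n) :
  (forall v (eps : R), 0 < eps -> \forall w \near v, enorm (f v - f w) <= eps) -> continuous f.
Proof.
move=> fP; apply: continuous_dist => v eps e0; have := fP v eps e0.
by apply: filterS => w; apply: le_trans; exact: mx_norm_le_enorm.
Qed.

Lemma enorm_continuous n (f : V -> 'cV[R]_n) :
  continuous f -> continuous (fun v => enorm (f v)).
Proof.
move=> fc; apply: continuous_dist => v eps e0.
have n1 : 0 < n%:R + 1 :> R by rewrite ltr_wpDl.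
have /cvgrPdist_le /(_ (eps / (n%:R + 1))) := fc v.
rewrite divr_gt0// => /(_ isT); apply: filterS => w vw.
rewrite (le_trans (enorm_dist _ _))// (le_trans (enorm_le_mx_norm _))//.
rewrite (le_trans (ler_wpM2l (ler0n _ _) vw))// mulrA ler_pdivrMr// mulrC ler_wpM2l ?(ltW e0)//.
by rewrite lerDl.
Qed.

Lemma affine_continuous (W : normedModType R) (k : R) (w : W) (f : V -> W) : continuous f ->
  continuous (fun v => k *: (f v - w)).
Proof.
move=> fc v; apply: cvgZr; apply: cvgB; [exact: fc|exact: cvg_cst].
Qed.

Lemma affineR_continuous (k s c : R) (f : V -> R) : continuous f ->
  continuous (fun v => k * (f v - s) + c).
Proof.
move=> fc v; apply: cvgD; last exact: cvg_cst.
by apply: cvgM; [exact: cvg_cst|apply: cvgB; [exact: fc|exact: cvg_cst]].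
Qed.

Lemma quadratic_continuous (k s : R) (f : V -> R) : continuous f ->
  continuous (fun v => k * (f v - s) ^+ 2).
Proof.
move=> fc v; apply: cvgM; first exact: cvg_cst.
by rewrite expr2; apply: cvgM; apply: cvgB; (try exact: cvg_cst); exact: fc.
Qed.

Lemma continuousD_fun (f g : V -> R) : continuous f -> continuous g ->
  continuous (fun v => f v + g v).
Proof. by move=> fc gc v; apply: cvgD; [exact: fc|exact: gc]. Qed.

Lemma continuousM_cst (k : R) (f : V -> R) : continuous f -> continuous (fun v => k * f v).
Proof. by move=> fc v; apply: cvgM; [exact: cvg_cst|exact: fc]. Qed.

End continuity.

(** * The test functions and their ci-derivatives *)

Section test_functions.
Context {R : realType} {p : R} {hp : 2 <= p} {T a : R} {e l : nat}.
Notation mu := (@lebesgue_measure R).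
Hypotheses (T0 : 0 < T) (a01 : 0 < a < 1).
Local Notation X := (state hp T a e l).

Lemma stime_near (P : X) (eps : R) : 0 < eps ->
  \forall Q \near P, `|stime P - stime Q| <= eps.
Proof.
by move=> e0; apply/nbhs_ballP; exists eps => // Q /rho_ballP[h _ _]; exact: ltW.
Qed.

Lemma spos_near (P : X) (eps : R) : 0 < eps ->
  \forall Q \near P, enorm (spos P - spos Q) <= eps.
Proof.
by move=> e0; apply/nbhs_ballP; exists eps => // Q /rho_ballP[_ h _]; exact: ltW.
Qed.

Lemma spath_sup_near (P : X) (eps : R) : 0 < eps ->
  \forall Q \near P, forall t, 0 <= t <= T -> enorm (spath P t - spath Q t) <= eps.
Proof.
move=> e0; apply/nbhs_ballP; exists eps => // Q /rho_ballP[_ _ h] t.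
exact: path_dist_sup h.
Qed.

Lemma path_near (g : ACpath T a l) (t eps : R) : 0 <= t <= T -> 0 < eps ->
  exists2 d, 0 < d & forall s, 0 <= s <= T -> `|t - s| <= d -> enorm (g t - g s) <= eps.
Proof.
move=> tT e0; have [C C0 gC] := path_holder a01 g; have /andP[a0 a1] := a01.
have C1 : 0 < C + 1 by rewrite ltr_wpDl.
exists ((eps / (C + 1)) `^ a^-1); first by apply: powR_gt0; exact: divr_gt0.
move=> s sT sd; apply: (le_trans (gC _ _ sT tT)).
have : `|t - s| `^ a <= ((eps / (C + 1)) `^ a^-1) `^ a by exact: ler_powRl.
rewrite -powRrM mulVf ?gt_eqF// powRr1 ?divr_ge0 ?(ltW e0) ?(ltW C1)// => h.
rewrite (le_trans (ler_wpM2l C0 h))// mulrA ler_pdivrMr// mulrC.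
by rewrite ler_wpM2l ?(ltW e0)// lerDl.
Qed.

Lemma spath_stime_near (P : X) (eps : R) : 0 < eps ->
  \forall Q \near P, enorm (spath P (stime P) - spath Q (stime Q)) <= eps.
Proof.
move=> e0; have e20 : 0 < eps / 2 by rewrite divr_gt0.
have [d d0 hd] := path_near (spath P) (stimeP P) e20.
near=> Q.
rewrite -(subrKA (spath P (stime Q))) (le_trans (enormD _ _))// (splitr eps) lerD//.
  by apply: hd (stimeP Q) _; near: Q; exact: stime_near.
have h : forall t, 0 <= t <= T -> enorm (spath P t - spath Q t) <= eps / 2.
  by near: Q; exact: spath_sup_near.
exact: h (stimeP Q).
Unshelve. all: by end_near. Qed.

Lemma stime_continuous : continuous (@stime R p hp T a e l).
Proof. by apply: continuous_dist => P eps; exact: stime_near. Qed.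

Lemma spos_continuous : continuous (@spos R p hp T a e l).
Proof. by apply: continuous_enorm => P eps; exact: spos_near. Qed.

Lemma spath_stime_continuous : continuous (fun P : X => spath P (stime P)).
Proof. by apply: continuous_enorm => P eps; exact: spath_stime_near. Qed.

Lemma penalty_continuous (Q : X) : continuous (fun P : X => penalty P Q).
Proof.
apply: continuous_dist => P eps e0.
have [[A B]/= [nA nB] AB] := penalty_near T0 a01 P Q e0.
apply: filterS nA => P' AP'; apply: (AB (P', Q)); split => //; exact: nbhs_singleton.
Qed.

Lemma penalty_grad_continuous (Q : X) : continuous (fun P : X => penalty_grad P Q).
Proof.
apply: continuous_enorm => P eps e0.
have [[A B]/= [nA nB] AB] := penalty_grad_near T0 a01 P Q e0.
apply: filterS nA => P' AP'; apply: (AB (P', Q)); split => //; exact: nbhs_singleton.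
Qed.

(** One family for both sides of the doubling: the coefficients A, B, m, -zeta with the second point
    frozen serve the subsolution, and -A, -B, -m, 0 with the first point frozen serve the
    supersolution. *)
Definition test_fun (k1 k2 k3 k4 : R) (y0 : 'cV[R]_e) (Q0 : X) (s0 : R) (P : X) : R :=
  k1 * enorm (spos P - y0) ^+ 2 + k2 * penalty P Q0 + k3 * (stime P - s0) ^+ 2 + k4 * stime P.

Lemma test_fun_continuous k1 k2 k3 k4 y0 Q0 s0 : continuous (test_fun k1 k2 k3 k4 y0 Q0 s0).
Proof.
have xc : continuous (fun P : X => spos P - y0).
  have := affine_continuous (k := 1) (w := y0) spos_continuous.
  by under eq_fun do rewrite scale1r.
rewrite /test_fun; apply: continuousD_fun; last exact: continuousM_cst stime_continuous.
apply: continuousD_fun; last exact: quadratic_continuous stime_continuous.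
apply: continuousD_fun; last exact: continuousM_cst (@penalty_continuous _).
have := quadratic_continuous (k := k1) (s := 0) (enorm_continuous xc).
by under eq_fun do rewrite subr0.
Qed.

(** Position and time leave exact squares as remainder, and the penalty a quadratic error by
    [penalty_ci]. The total is at most D h^2 for h = z - t + |y - x|, hence at most eps h as soon as
    h < eps / (D + 1). *)
Lemma test_fun_ci_smooth k1 k2 k3 k4 y0 Q0 s0 :
  ci_smooth (test_fun k1 k2 k3 k4 y0 Q0 s0)
    (fun P => 2 * k3 * (stime P - s0) + k4)
    (fun P => (2 * k1) *: (spos P - y0))
    (fun P => (2 * k2) *: penalty_grad P Q0).
Proof.
split.
- move=> P PT nu nuP eps e0.
  have [C C0 HC] := penalty_ci T0 a01 Q0 nuP.
  pose D := `|k1| + `|k2| * C + `|k3|.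
  have D0 : 0 <= D by rewrite !addr_ge0// mulr_ge0.
  have D1 : 0 < D + 1 by rewrite ltr_wpDl.
  exists (eps / (D + 1)); first exact: divr_gt0.
  move=> Q Qnu tzT; have := HC Q Qnu tzT.
  have -> : fracI (1 - a) (fun s => nu s - spath P 0) (stime Q) = frac_int nu (stime Q).
    by rewrite frac_int.unlock nuP// lexx; case/andP: (stimeP P).
  have -> : fracI (1 - a) (fun s => spath P s - spath P 0) (stime P) = frac_int (spath P) (stime P).
    by rewrite frac_int.unlock.
  case/andP: tzT => tz zT.
  have -> : dot ((2 * k2) *: penalty_grad P Q0) (frac_int nu (stime Q) - frac_int (spath P) (stime P))
     = k2 * dot (2 *: penalty_grad P Q0) (frac_int nu (stime Q) - frac_int (spath P) (stime P)).
    by rewrite !dotZl; ring.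
  set G := dot (2 *: _) _; set x := spos P; set y := spos Q; set t := stime P; set z := stime Q.
  set r := enorm (y - x); move=> hC hd.
  set h := z - t + r in hd *.
  have zt0 : 0 < z - t by rewrite subr_gt0.
  have r0 : 0 <= r by exact: enorm_ge0.
  have -> : test_fun k1 k2 k3 k4 y0 Q0 s0 Q - test_fun k1 k2 k3 k4 y0 Q0 s0 P -
    ((2 * k3 * (t - s0) + k4) * (z - t) + dot ((2 * k1) *: (x - y0)) (y - x) + k2 * G) =
    k1 * r ^+ 2 + k2 * (penalty Q Q0 - penalty P Q0 - G) + k3 * (z - t) ^+ 2.
    have -> : enorm (y - x) ^+ 2 = enorm (y - y0) ^+ 2 - enorm (x - y0) ^+ 2 - 2 * dot (x - y0) (y - x).
      rewrite !enorm_sqr (_ : y - y0 = (x - y0) + (y - x)); last by rewrite [RHS]addrC subrKA.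
      by move: (x - y0) (y - x) => u v; rewrite dotDl !dotDr (dotC v u); ring.
    by rewrite /test_fun -/x -/y -/t -/z !dotZl; ring.
  have h0 : 0 <= h by rewrite addr_ge0// ltW.
  have rh : r ^+ 2 <= h ^+ 2 by rewrite ler_pXn2r ?nnegrE// lerDr ltW.
  have th : (z - t) ^+ 2 <= h ^+ 2 by rewrite ler_pXn2r ?nnegrE ?(ltW zt0)// lerDl.
  have n1 : `|k1 * r ^+ 2| <= `|k1| * h ^+ 2 by rewrite normrM (ger0_norm (sqr_ge0 _)) ler_wpM2l.
  have n3 : `|k3 * (z - t) ^+ 2| <= `|k3| * h ^+ 2 by rewrite normrM (ger0_norm (sqr_ge0 _)) ler_wpM2l.
  have n2 : `|k2 * (penalty Q Q0 - penalty P Q0 - G)| <= `|k2| * C * h ^+ 2.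
    rewrite normrM -mulrA ler_wpM2l// (le_trans hC)// ler_wpM2l//.
  have := lerD (le_trans (ler_normD _ _) (lerD n1 n2)) n3; rewrite -!mulrDl -/D => nD.
  rewrite (le_trans (ler_normD _ _))// (le_trans nD)// expr2 mulrA ler_wpM2r//.
  move: hd; rewrite ltr_pdivlMr// => /ltW; apply: le_trans; rewrite mulrC ler_wpM2l//.
  by rewrite lerDl.
- exact: test_fun_continuous.
- apply: continuous_subspaceT; exact: affineR_continuous stime_continuous.
- apply: continuous_subspaceT; exact: affine_continuous spos_continuous.
- apply: continuous_subspaceT.
  have := affine_continuous (k := 2 * k2) (w := 0) (@penalty_grad_continuous Q0).
  by under eq_fun do rewrite subr0.
Qed.

End test_functions.

(** * The penalty controls the distance of property (L) *)

Section penalty_control.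
Context {R : realType}.
Notation mu := (@lebesgue_measure R).

(** The integral of a nonnegative function is a supremum over the simple functions below it, hence
    monotone even for nonmeasurable integrands. This avoids a measurability proof for the distance
    of stopped paths in [property_L]. *)
Lemma ge0_le_integral_nonmeasurable (D : set R) (f1 f2 : R -> \bar R) :
  (forall x, D x -> (0 <= f1 x)%E) -> (forall x, D x -> (f1 x <= f2 x)%E) ->
  (\int[mu]_(x in D) f1 x <= \int[mu]_(x in D) f2 x)%E.
Proof.
move=> f10 f12.
have f20 x : D x -> (0 <= f2 x)%E by move=> Dx; exact: le_trans (f10 x Dx) (f12 x Dx).
rewrite ge0_integralE// ge0_integralE//.
apply: ereal_sup_le => _ [h hf <-]; exists h => // x; apply: (le_trans (hf x)).
by rewrite !patchE; case: ifPn => // /set_mem; exact: f12.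
Qed.

Lemma weighted_Rintegral_le (a T E : R) (D : R -> R) : 0 < a -> 0 <= T ->
  (forall r, 0 <= r <= T -> 0 <= D r <= E) ->
  \int[mu]_(r in `[0, T]) (D r / (T - r) `^ (1 - a)) <= E * (T `^ a / a).
Proof.
move=> a0 T0 DE.
have iE : mu.-integrable `[0, T] (EFin \o (fun r => E * fker a T r)).
  by have := @integrableZl _ _ _ mu `[0, T] _ E _ (@integrable_fker R a 0 T T a0 (lexx T)); apply.
have -> : E * (T `^ a / a) = \int[mu]_(r in `[0, T]) (E * fker a T r).
  rewrite RintegralZl//; last exact: integrable_fker.
  by rewrite Rintegral_fker// subrr subr0 [0 `^ a]powR0 ?gt_eqF// subr0.
rewrite /Rintegral.
have le1 : (\int[mu]_(r in `[0%R, T]) (D r / (T - r) `^ (1 - a))%:E <=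
            \int[mu]_(r in `[0%R, T]) (E * fker a T r)%:E)%E.
  apply: ge0_le_integral_nonmeasurable => r; rewrite /= in_itv/= => /DE /andP[D0 DE'].
    by rewrite lee_fin mulr_ge0 ?fker_ge0.
  by rewrite lee_fin ler_wpM2r ?fker_ge0.
have ge0 : (0 <= \int[mu]_(r in `[0%R, T]) (D r / (T - r) `^ (1 - a))%:E)%E.
  apply: integral_ge0 => r; rewrite /= in_itv/= => /DE /andP[D0 DE'].
  by rewrite lee_fin mulr_ge0 ?fker_ge0.
have fin := @integrable_fin_num _ _ _ mu `[0, T] (measurable_itv _) _ iE.
apply: fine_le => //; rewrite ge0_fin_numE// (le_lt_trans le1)//.
by rewrite ltey_eq fin.
Qed.

Lemma sqr_young (x y z : R) : 0 <= z -> z <= x + y -> z ^+ 2 - 2 * y ^+ 2 <= 2 * x ^+ 2.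
Proof. by move=> z0 zxy; have := sqr_ge0 (x - y); rewrite !expr2 => h; nra. Qed.

Lemma sqr_young_le (x y z : R) : 0 <= x -> 0 <= y -> z ^+ 2 <= 2 * x ^+ 2 + 2 * y ^+ 2 ->
  z <= 2 * y + 2 * x.
Proof.
move=> x0 y0; apply: contraTT; rewrite -!ltNge => h.
have xy0 : 0 <= x * y by rewrite mulr_ge0.
have : (2 * y + 2 * x) ^+ 2 < z ^+ 2 by rewrite ltr_pXn2r// nnegrE; lra.
by rewrite !expr2; nra.
Qed.

(** On an interval of length h that contains x, W differs from W(x) by at most L h, and averaging
    the squares over that interval costs S divided by the root of h. The length h stays free, so
    that the first term can be made as small as desired. *)
Lemma lipschitz_interpolation (n : nat) (T L h S x : R) (W : R -> 'cV[R]_n) M :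
  0 < h -> h <= T -> 0 <= L -> 0 <= x <= T -> 0 <= S ->
  (forall s t, 0 <= s <= T -> 0 <= t <= T -> enorm (W t - W s) <= L * `|t - s|) ->
  bounded_density M W ->
  \int[mu]_(s in `[0, T]) dot (W s) (W s) <= S ^+ 2 ->
  enorm (W x) <= 2 * L * h + 2 * (Num.sqrt h)^-1 * S.
Proof.
move=> h0 hT L0 /andP[x0 xT] S0 WL bW WS.
have [y [y0 yx xyh yhT]] : exists y : R, [/\ 0 <= y, y <= x, x <= y + h & y + h <= T].
  have [xh|xh] := leP (x + h) T; first by exists x; split => //; lra.
  by exists (T - h); split; lra.
have sh0 : 0 < Num.sqrt h by rewrite sqrtr_gt0.
set m := enorm (W x); have m0 : 0 <= m by exact: enorm_ge0.
have pw s : y <= s <= y + h -> m ^+ 2 - 2 * (L * h) ^+ 2 <= 2 * dot (W s) (W s).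
  move=> /andP[ys syh].
  have mW : m <= enorm (W s) + L * h.
    rewrite /m -(subrK (W s) (W x)) (le_trans (enormD _ _))// addrC lerD2l.
    rewrite (le_trans (WL _ _ _ _))//; [apply/andP; split; lra|apply/andP; split; lra|].
    by rewrite ler_wpM2l// ler_norml; apply/andP; split; lra.
  by rewrite -enorm_sqr; exact: sqr_young.
have bWW := bounded_by_dot bW bW.
have iW x1 x2 := integrable_bounded_by x1 x2 bWW.
have i2W x1 x2 : mu.-integrable `[x1, x2] (EFin \o (fun s => 2 * dot (W s) (W s))).
  by have := @integrableZl _ _ _ mu `[x1, x2] _ 2 _ (iW x1 x2); apply.
have yyh : y <= y + h by lra.
have I1 : (m ^+ 2 - 2 * (L * h) ^+ 2) * h <= 2 * S ^+ 2.
  have -> : (m ^+ 2 - 2 * (L * h) ^+ 2) * h =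
    \int[mu]_(s in `[y, y + h]) (m ^+ 2 - 2 * (L * h) ^+ 2).
    by rewrite Rintegral_cst_itv// addrAC subrr add0r.
  apply: (@le_trans _ _ (\int[mu]_(s in `[y, y + h]) (2 * dot (W s) (W s)))).
    apply: le_Rintegral => //; first exact: integrable_cst_itv.
  rewrite RintegralZl; [|by []|exact: iW].
  rewrite ler_wpM2l// (le_trans _ WS)//.
  rewrite (Rintegral_split y0 _ (iW 0 T)); last by lra.
  rewrite (Rintegral_split yyh yhT (iW y T)).
  have ge x1 x2 : 0 <= \int[mu]_(s in `[x1, x2]) dot (W s) (W s).
    by apply: Rintegral_ge0 => s _; exact: dot_ge0.
  by rewrite ler_wpDl// ler_wpDr.
set q := (Num.sqrt h)^-1 * S.
have q0 : 0 <= q by rewrite mulr_ge0// invr_ge0 ltW.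
have qE : q ^+ 2 * h = S ^+ 2.
  by rewrite /q exprMn exprVn sqr_sqrtr ?(ltW h0)// mulrAC mulVf ?gt_eqF// mul1r.
have Lh0 : 0 <= L * h by rewrite mulr_ge0// ltW.
have : m ^+ 2 - 2 * (L * h) ^+ 2 <= 2 * q ^+ 2.
  by rewrite -(ler_pM2r h0) -[2 * q ^+ 2 * h]mulrA qE.
rewrite lerBlDr => m2.
by rewrite -!mulrA -/q; exact: sqr_young_le.
Qed.

Context {p : R} {hp : 2 <= p} {T a : R} {e l : nat}.
Hypotheses (T0 : 0 < T) (a01 : 0 < a < 1).
Local Notation X := (state hp T a e l).

(** The difference of the two densities is bounded by 2 N and has a primitive of size eta, up to the
    factor [frac_const], so [fpot_weak_bound] applies to each coordinate. The constant depends on N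
    and delta but not on the paths; it also serves to lift uniform convergence of fractional
    integrals to the paths. *)
Lemma stopped_frac_bound (N delta : R) : 0 <= N -> 0 < delta ->
  exists2 C, 0 <= C & forall (g h : ACpath T a l) u v (s eta : R), 0 <= s <= T -> 0 <= eta ->
    has_density N g u -> has_density N h v ->
    (forall x, 0 <= x <= s -> enorm (frac_int g x - frac_int h x) <= eta) ->
    forall r, 0 <= r <= T ->
      enorm (stopped s g r - stopped s h r) <= enorm (g 0 - h 0) + delta + C * eta.
Proof.
move=> N0 delta0; have G0 := Gamma_gt0 a01; have c0 := frac_const_gt0 a01; have c0' := ltW c0.
have ci0 : 0 <= (frac_const a)^-1 by rewrite invr_ge0.
pose G := l%:R * (Gamma a)^-1 : R.
have G_ge0 : 0 <= G by rewrite /G mulr_ge0 ?invr_ge0 ?(ltW G0).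
pose d1 := delta / (G + 1).
have G1 : 0 < G + 1 by rewrite ltr_wpDl.
have d10 : 0 < d1 by rewrite divr_gt0.
have [C1 C10 HC1] := fpot_weak_bound (2 * N) T a01 d10.
exists (G * C1 * (frac_const a)^-1); first by apply: mulr_ge0 => //; exact: mulr_ge0.
move=> g h u v t eta /andP[t0 tT] eta0 gu hv gheta r /andP[r0 rT].
have [bu _ hu] := gu; have [bv _ hv'] := hv.
pose w s := u s - v s.
have bw : bounded_density (2 * N) w.
  by have := bounded_densityB bu bv; rewrite mulr2n mulrDl mul1r.
have prim_le x : 0 <= x <= t -> enorm (prim w x) <= (frac_const a)^-1 * eta.
  move=> xt; have xT : 0 <= x <= T by case/andP: xt => x0 xt; rewrite x0 (le_trans xt).
  rewrite ler_pdivlMl//; have := gheta x xt.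
  rewrite (frac_intE a01 gu xT) (frac_intE a01 hv xT) -scalerBr.
  rewrite enormZ ger0_norm//; congr (_ * enorm _ <= _).
  apply/matrixP => i j; rewrite ord1 coordB !mxE -RintegralB; first last.
  - exact: integrable_bounded_by (bounded_density_coord i bv).
  - exact: integrable_bounded_by (bounded_density_coord i bu).
  - by [].
  - by apply: eq_Rintegral => s _; rewrite /w coordB.
have tT' : 0 <= t <= T by rewrite t0.
rewrite (hu _ _ tT' r0) (hv' _ _ tT' r0).
have -> : g 0 + pot_vec a (Num.min t r) r u - (h 0 + pot_vec a (Num.min t r) r v) =
   (g 0 - h 0) + (pot_vec a (Num.min t r) r u - pot_vec a (Num.min t r) r v).
  by rewrite opprD addrACA.
have mr : Num.min t r <= r by rewrite ge_min lexx orbT.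
have /andP[a0 _] := a01.
have bound : enorm (pot_vec a (Num.min t r) r u - pot_vec a (Num.min t r) r v) <=
    G * (d1 + C1 * ((frac_const a)^-1 * eta)).
  rewrite /G -mulrA; apply: enorm_le_bound => i; rewrite coordB !mxE -mulrBr normrM.
  rewrite ger0_norm ?invr_ge0 ?(ltW G0)// ler_wpM2l ?invr_ge0 ?(ltW G0)//.
  have iu := integrable_fpot 0 a0 mr (bounded_density_coord i bu).
  have iv := integrable_fpot 0 a0 mr (bounded_density_coord i bv).
  have -> : fpot a (Num.min t r) r (fun s => u s i 0) - fpot a (Num.min t r) r (fun s => v s i 0) =
     fpot a (Num.min t r) r (fun s => w s i 0).
    rewrite /fpot -RintegralB; [|by []|exact: iu|exact: iv].
    by apply: eq_Rintegral => s _; rewrite /w coordB mulrBl.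
  apply: HC1 => //; [exact: bounded_density_coord bw|exact: mulr_ge0|by rewrite le_min t0|].
  move=> x /andP[x0 xm]; have xt : 0 <= x <= t by rewrite x0 (le_trans xm)// ge_min lexx.
  have := le_trans (coord_le_enorm (prim w x) i) (prim_le x xt).
  by rewrite mxE.
rewrite (le_trans (enormD _ _))// -addrA lerD2l (le_trans bound)//.
have -> : G * (d1 + C1 * ((frac_const a)^-1 * eta)) = G * d1 + G * C1 / frac_const a * eta by ring.
by rewrite lerD2r /d1 mulrA ler_pdivrMr// mulrDr mulr1 mulrC lerDl ltW.
Qed.

Lemma stopped_penalty_bound (N delta : R) : 0 <= N -> 0 < delta ->
  exists2 C, 0 <= C & forall (P Q : X) u v, stime P = stime Q ->
    has_density N (spath P) u -> has_density N (spath Q) v ->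
    forall r, 0 <= r <= T ->
      enorm (stopped (stime P) (spath P) r - stopped (stime P) (spath Q) r)
      <= delta + C * Num.sqrt (penalty P Q).
Proof.
move=> N0 delta0; have c0' := ltW (frac_const_gt0 a01).
have d20 : 0 < delta / 2 by rewrite divr_gt0.
have [C1 C10 HC1] := stopped_frac_bound N0 d20.
pose L := frac_const a * (2 * N).
have L0 : 0 <= L by rewrite /L mulr_ge0// mulr_ge0.
pose K := C1 * (2 * L).
have K0 : 0 <= K by apply: mulr_ge0 => //; exact: mulr_ge0.
(* [h] makes the Lipschitz part of the interpolation, once multiplied by [C1], at most delta / 2.
   The price is the factor [B] in front of the root of the penalty. *)
pose h := Num.min T (delta / (2 * (K + 1))).
have K1 : 0 < K + 1 by rewrite ltr_wpDl.
have h0 : 0 < h by rewrite /h lt_min T0 divr_gt0 ?mulr_gt0.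
pose B := 2 * (Num.sqrt h)^-1; have B0 : 0 <= B by rewrite /B mulr_ge0 ?invr_ge0 ?sqrtr_ge0.
exists (1 + C1 * B); first by rewrite addr_ge0// mulr_ge0.
move=> P Q u v PQ Pu Qv r rT.
set S := Num.sqrt (penalty P Q); have S0 : 0 <= S by exact: sqrtr_ge0.
have pS : S ^+ 2 = penalty P Q by rewrite sqr_sqrtr// penalty_ge0.
have tT := stimeP P; set t := stime P in tT PQ *.
have Itot : 0 <= \int[mu]_(s in `[0, T]) penalty_fun P Q s by apply: Rintegral_ge0 => s _; exact: dot_ge0.
have n0 : enorm (spath P 0 - spath Q 0) <= S.
  rewrite -(@ler_pXn2r _ 2) ?nnegrE ?enorm_ge0// pS /penalty.
  by rewrite lerDl.
pose W s := stop_int P s - stop_int Q s.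
have WL s s' : enorm (W s' - W s) <= L * `|s' - s|.
  have := lerD (stop_int_lip_density T0 a01 s s' Pu) (stop_int_lip_density T0 a01 s s' Qv).
  have -> : frac_const a * N * `|s' - s| + frac_const a * N * `|s' - s| = L * `|s' - s|.
    by rewrite /L; ring.
  apply: le_trans; apply: le_trans (enormB_le _ _).
  rewrite /W; move: (stop_int P s') (stop_int P s) (stop_int Q s') (stop_int Q s) => x1 x2 y1 y2.
  by rewrite (_ : x1 - y1 - (x2 - y2) = x1 - x2 - (y1 - y2))//; apply/matrixP => i j; rewrite !mxE; ring.
have [MP bP] := stop_int_bounded_density T0 a01 P.
have [MQ bQ] := stop_int_bounded_density T0 a01 Q.
have bW := bounded_densityB bP bQ.
have Wx x : 0 <= x <= T -> enorm (W x) <= 2 * L * h + B * S.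
  move=> xT; apply: (@lipschitz_interpolation l T L h S x W _ h0 _ L0 xT S0 _ bW).
  - by rewrite /h ge_min lexx.
  - by move=> s s' _ _; exact: WL.
  - by rewrite pS /penalty lerDr exprn_ge0// enorm_ge0.
set eta := 2 * L * h + B * S.
have eta0 : 0 <= eta.
  by apply: addr_ge0; apply: mulr_ge0 => //; [exact: mulr_ge0|exact: ltW].
have Weta x : 0 <= x <= t -> enorm (frac_int (spath P) x - frac_int (spath Q) x) <= eta.
  move=> /andP[x0 xt]; have /andP[_ tT'] := tT.
  have xT : 0 <= x <= T by rewrite x0 (le_trans xt).
  have := Wx x xT; rewrite /W stop_int_lt// stop_int_lt//.
  by rewrite -PQ.
apply: (le_trans (HC1 _ _ _ _ _ _ tT eta0 Pu Qv Weta _ rT)).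
have b2 : K * h <= delta / 2.
  apply: (@le_trans _ _ (K * (delta / (2 * (K + 1))))).
    by rewrite ler_wpM2l// /h ge_min lexx orbT.
  rewrite mulrA ler_pdivrMr ?mulr_gt0//.
  have -> : delta / 2 * (2 * (K + 1)) = K * delta + delta by field.
  by rewrite lerDl ltW.
have -> : C1 * eta = K * h + C1 * B * S by rewrite /eta /K; ring.
rewrite mulrDl mul1r; lra.
Qed.

End penalty_control.

(** * Compactness of the truncated domains *)

Section lipschitz_primitive.
Context {R : realType}.
Notation mu := (@lebesgue_measure R).

Lemma clamp_bounds (T s : R) : 0 <= T -> 0 <= Num.max 0 (Num.min T s) <= T.
Proof. by move=> T0; rewrite le_max lexx/= ge_max T0 ge_min lexx. Qed.

Lemma clamp_id (T s : R) : 0 <= s <= T -> Num.max 0 (Num.min T s) = s.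
Proof. by move=> /andP[s0 sT]; rewrite min_r// max_r. Qed.

Lemma clamp_homo (T s t : R) : s <= t -> Num.max 0 (Num.min T s) <= Num.max 0 (Num.min T t).
Proof.
move=> st; rewrite ge_max le_max lexx/= le_max; apply/orP; right.
by rewrite le_min !ge_min lexx st orbT.
Qed.

(* Lipschitz functions on an interval are primitives: the Stieltjes measure of
   W + K id is dominated by Lebesgue measure and has a Radon-Nikodym density. *)
Lemma wlength_lipschitz (F : cumulative R R) (K : R) : 0 < K ->
  (forall s t, s <= t -> F t - F s <= K * (t - s)) ->
  forall A : set R, (lebesgue_stieltjes_measure F A <= K%:E * mu A)%E.
Proof.
move=> K0 FK A; rewrite /lebesgue_measure /lebesgue_stieltjes_measure /measure_extension /mu_ext.
have le_len E : ocitv E -> (wlength F E <= K%:E * wlength (idfun : R -> R) E)%E.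
  move=> /ocitvP[->|[[x y]/= xy ->]]; first by rewrite !wlength0 mule0.
  by rewrite !wlength_itv_bnd ?(ltW xy)// -EFinM lee_fin FK// ltW.
rewrite -lee_pdivrMl//.
apply: le_ereal_inf_tmp => _ [E [mE AE] <-].
rewrite lee_pdivrMl// -nneseriesZl//.
apply: (@le_trans _ _ (\sum_(0 <= k <oo) wlength F (E k))%E).
  by apply: ereal_inf_lbound; exists E.
apply: lee_nneseries => [k _ _|k _]; last by apply: le_len; exact: mE.
exact: wlength_ge0.
Qed.

Lemma lipschitz_has_density (T K : R) (W : R -> R) : 0 < T -> 0 < K ->
  (forall s t : R, 0 <= s -> s <= t -> t <= T -> `|W t - W s| <= K * (t - s)) ->
  exists2 u : R -> R, mu.-integrable `[0, T] (EFin \o u) &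
    forall s : R, 0 <= s <= T -> W s - W 0 = \int[mu]_(r in `[0, s]) u r.
Proof.
move=> T0 K0 WK.
(* Clamping extends the function to the whole line, where a Stieltjes measure needs it. The slope
   [K] added for monotonicity is subtracted from the density in the end. *)
pose c (s : R) := Num.max 0 (Num.min T s).
pose f s := W (c s) + K * c s.
have fK s t : s <= t -> 0 <= f t - f s <= 2 * K * (t - s).
  move=> st; have := clamp_homo T st; rewrite -/(c s) -/(c t) => cst.
  have /andP[cs0 csT] := clamp_bounds s (ltW T0); have /andP[ct0 ctT] := clamp_bounds t (ltW T0).
  have := WK (c s) (c t) cs0 cst ctT; rewrite ler_norml => /andP[W1 W2].
  have := clamp_lip T s t; rewrite -/(c s) -/(c t) !ger0_norm ?subr_ge0// => cl.
  have : K * (c t - c s) <= K * (t - s) by rewrite ler_wpM2l// ltW.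
  by rewrite /f => cl'; apply/andP; split; lra.
have nd : nondecreasing f by move=> s t st; have /andP[h _] := fK s t st; rewrite -subr_ge0.
have rc : right_continuous f.
  apply: right_continuousW => s; apply/cvgrPdist_le => eps eps0.
  exists (eps / (2 * K)) => /=; first by rewrite divr_gt0 ?mulr_gt0.
  move=> t /=; have K20 : 0 < 2 * K by rewrite mulr_gt0.
  rewrite ltr_pdivlMr// mulrC => h; apply: le_trans (ltW h).
  have [st|ts] := leP s t.
    have /andP[h1 h2] := fK s t st.
    by rewrite distrC (distrC s) !ger0_norm ?subr_ge0//; rewrite -subr_ge0.
  have /andP[h1 h2] := fK t s (ltW ts).
  by rewrite !ger0_norm ?subr_ge0 ?(ltW ts)//; rewrite -subr_ge0.
pose F : cumulative R R := HB.pack f (isCumulative.Build R _ R f nd rc).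
have FK s t : s <= t -> F t - F s <= 2 * K * (t - s) by move=> /fK /andP[].
have dom := wlength_lipschitz (mulr_gt0 (ltr0n _ 2) K0) FK.
pose nu := lebesgue_stieltjes_measure F.
have mT : measurable (`[0, T]%classic : set (measurableTypeR R)) by exact: measurable_itv.
have nuT : (nu `[0%R, T]%classic < +oo)%E.
  apply: le_lt_trans (dom _) _.
  by rewrite lebesgue_measure_itv/= lte_fin T0 -EFinB -EFinM ltry.
have ac : mfrestr mT nuT `<< mu.
  apply/null_content_dominatesP => A mA A0; rewrite /mfrestr/mrestr.
  apply/eqP; rewrite eq_le measure_ge0 andbT.
  apply: (@le_trans _ _ (nu A)).
    by apply: le_measure; rewrite ?inE//; exact: measurableI.
  by rewrite (le_trans (dom _))// (A0 : mu A = 0%E) mule0.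
have [h [h0 hfin hint hE]] := radon_nikodym_sigma_finite ac.
have mh : measurable_fun [set: R] (fun r => fine (h r)).
  by apply: measurableT_comp; [exact: fine_measurable|case/integrableP: hint].
have ih x y : mu.-integrable `[x, y] (EFin \o (fun r => fine (h r))).
  rewrite (_ : EFin \o _ = h); last by apply/funext => r /=; rewrite fineK.
  exact: integrableS hint.
have iu x y : mu.-integrable `[x, y] (EFin \o (fun r => fine (h r) - K)).
  by have := @integrableB _ _ _ mu `[x, y] _ _ _ (ih x y) (integrable_cst_itv K x y); apply.
exists (fun r => fine (h r) - K); first exact: iu.
move=> s sT; have /andP[s0 sT'] := sT.
rewrite RintegralB; [|by []|exact: ih|exact: integrable_cst_itv].
rewrite Rintegral_cst_itv// subr0.
suff -> : \int[mu]_(r in `[0, s]) fine (h r) = W s - W 0 + K * s by rewrite addrK.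
have e1 : mfrestr mT nuT `]0, s]%classic = (W s - W 0 + K * s)%:E.
  rewrite /mfrestr/mrestr setIidl; last by apply: subset_itv; rewrite bnd_simp.
  rewrite /nu /lebesgue_stieltjes_measure /measure_extension measurable_mu_extE/=; last exact: is_ocitv.
  rewrite (wlength_itv_bnd f false false s0) /f (_ : c s = s); last exact: clamp_id.
  rewrite (_ : c 0 = 0); last by apply: clamp_id; rewrite lexx ltW.
  by congr EFin; ring.
have : mfrestr mT nuT `]0, s]%classic = (\int[mu]_(x in `]0%R, s]) h x)%E by exact: hE.
rewrite e1 integral_itv_obnd_cbnd; last first.
  by apply: measurable_funTS; case/integrableP: hint.
rewrite /Rintegral => H; transitivity (fine (W s - W 0 + K * s)%:E) => //.
rewrite H; congr fine; apply: eq_integral => r _; rewrite fineK//.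
Qed.

End lipschitz_primitive.

(** * Limits along ultrafilters *)

Section ultrafilter_limits.
Context {R : realType} {X : Type} (U : set_system X) {UU : UltraFilter U}.

Lemma fmap_ultra (Y : Type) (f : X -> Y) : UltraFilter (f @ U).
Proof.
split=> [|G GF fG]; first exact: fmap_proper_filter.
apply/seteqP; split => [A GA|]; last exact: fG.
have [//|UnA] := in_ultra_setVsetC (f @^-1` A) UU.
have GnA : G (~` A) by apply: fG.
by have [y []] := filter_ex (filterI GA GnA).
Qed.

(** Along one ultrafilter every map with values eventually in a compact set converges. Limits of
    uncountably many quantities, one for each time, are thus taken simultaneously, without a
    diagonal sequence. *)
Lemma ultra_cvg_compact (Y : topologicalType) (C : set Y) (f : X -> Y) : compact C ->
  (\forall x \near U, C (f x)) -> exists2 y, C y & f @ U --> y.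
Proof.
rewrite compact_ultra => Cc UC.
by have [y [Cy fy]] := Cc _ (fmap_ultra f) UC; exists y.
Qed.

Lemma ultra_cvg_enorm n (f : X -> 'cV[R]_n) (M : R) :
  (\forall x \near U, enorm (f x) <= M) ->
  exists2 y, enorm y <= M & forall eps : R, 0 < eps -> \forall x \near U, enorm (f x - y) <= eps.
Proof.
move=> UM.
have /choice[y fy] : forall i, exists yi : R, (fun x => f x i 0) @ U --> yi.
  move=> i; have [|yi _ fyi] := @ultra_cvg_compact R `[- M, M]%classic (fun x => f x i 0) (@segment_compact R (- M) M).
    apply: filterS UM => x fM; rewrite /= in_itv/= -ler_norml.
    exact: le_trans (coord_le_enorm _ _) fM.
  by exists yi.
have close (eps : R) : 0 < eps -> \forall x \near U, enorm (f x - \col_i y i) <= eps.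
  move=> e0; have n1 : 0 < n%:R + 1 :> R by rewrite ltr_wpDl.
  have : \forall x \near U, forall i, `|y i - f x i 0| <= eps / (n%:R + 1).
    apply: filter_forall => i; move/cvgrPdist_le: (fy i); apply; exact: divr_gt0.
  apply: filterS => x fxy; apply: (@le_trans _ _ (n%:R * (eps / (n%:R + 1)))).
    by apply: enorm_le_bound => i; rewrite coordB mxE distrC.
  by rewrite mulrA ler_pdivrMr// mulrC ler_wpM2l ?(ltW e0)// lerDl.
exists (\col_i y i) => //.
apply/ler_addgt0Pr => eps e0; have [x [fM fy']] := filter_ex (filterI UM (close eps e0)).
have := le_trans (enormB_le (f x) (f x - \col_i y i)) (lerD fM fy').
by rewrite opprB addrC subrK.
Qed.

End ultrafilter_limits.

Section variation_of_holder_functions.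
Context {R : realType}.

(* Interpolation between the Hoelder exponent a and the sup norm: this is where
   a > floor(p)/p is used. *)
Lemma rvar_small (r T a C eps : R) : 1 <= r -> 0 < a -> a^-1 < r -> 0 < T -> 0 <= C -> 0 < eps ->
  exists2 eta : R, 0 < eta & forall n (f : R -> 'cV[R]_n),
    (forall s t, 0 <= s <= T -> 0 <= t <= T -> enorm (f t - f s) <= C * `|t - s| `^ a) ->
    (forall t, 0 <= t <= T -> enorm (f t) <= eta) ->
    (rvar r T f <= eps%:E)%E.
Proof.
move=> r1 a0 ar T0 C0 eps0.
(* The power r of an increment is split into b and 1 / a: the first factor is small by the sup
   bound, and the second is at most C^(1/a) times the step, by the Hoelder bound, and telescopes to
   [D]. [z] is such that z D <= eps^r, and eta is halved because an increment is a difference of two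
   values. *)
pose b := r - a^-1; have b0 : 0 < b by rewrite subr_gt0.
pose D := C `^ a^-1 * T; have D0 : 0 <= D by rewrite mulr_ge0 ?powR_ge0// ltW.
have D1 : 0 < D + 1 by rewrite ltr_wpDl.
pose z := eps `^ r / (D + 1); have z0 : 0 < z by rewrite divr_gt0 ?powR_gt0.
exists (z `^ b^-1 / 2) => [|n f fH feta]; first by rewrite divr_gt0 ?powR_gt0.
apply/rvar_leP => //; first exact: ltW.
move=> s sT; rewrite /variation_sum.
set t := nth T (0 :: s).
have tT i : (i < (size s).+1)%N -> 0 <= t i <= T.
  by move=> is1; rewrite (itv_partition_nth_ge is1 sT) (itv_partition_nth_le is1 sT).
have tm i : (i < size s)%N -> t i <= t i.+1.
  move=> is1; exact: (@nondecreasing_fun_itv_partition _ _ 0 T idfun s _ sT i is1).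
apply: (@le_trans _ _ (\sum_(0 <= i < size s) z * C `^ a^-1 * (t i.+1 - t i))).
  rewrite big_nat_cond [leRHS]big_nat_cond; apply: ler_sum => i /andP[/= is1 _].
  have i1 := tT i (ltnW is1); have i2 := tT i.+1 is1.
  set D1' := enorm _.
  have d0 : 0 <= D1' by exact: enorm_ge0.
  have dC : D1' <= C * (t i.+1 - t i) `^ a.
    by have := fH _ _ i1 i2; rewrite ger0_norm// subr_ge0 tm.
  have deta : D1' <= z `^ b^-1.
    rewrite (splitr (z `^ b^-1)); apply: (le_trans (enormB_le _ _)).
    by rewrite lerD// feta.
  have -> : D1' `^ r = D1' `^ b * D1' `^ a^-1.
    rewrite -powRD ?subrK//; apply/implyP => /eqP h; exfalso; move: r1.
    by rewrite h ler10.
  rewrite -mulrA ler_pM ?powR_ge0//.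
    have := ler_powRl b0 d0 deta; rewrite -powRrM mulVf ?gt_eqF// powRr1//; exact: ltW.
  have ai0 : 0 < a^-1 by rewrite invr_gt0.
  have := ler_powRl ai0 d0 dC; rewrite powRM ?powR_ge0// -powRrM divff ?gt_eqF// powRr1//.
  by rewrite subr_ge0 tm.
rewrite -mulr_sumr telescope_sumr// /t (itv_partition_nth_size _ sT)/= subr0.
rewrite -mulrA -/D /z mulrAC ler_pdivrMr// ler_wpM2l ?powR_ge0// lerDl//.
Qed.

End variation_of_holder_functions.

Section compactness.
Context {R : realType} {p : R} {hp : 2 <= p} {T a : R} {e l : nat}.
Notation mu := (@lebesgue_measure R).
Hypotheses (T0 : 0 < T) (a01 : 0 < a < 1) (pa : a^-1 < floor_ratio p).
Local Notation X := (state hp T a e l).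

Lemma AC_ball_density k (g : ACpath T a l) : AC_ball k g -> exists u, has_density k%:R g u.
Proof. by move=> [_ gk]; exact: exists_density. Qed.

Lemma prim_of_lipschitz n (K : R) (W : R -> 'cV[R]_n) : 0 <= K -> W 0 = 0 ->
  (forall s t : R, 0 <= s -> s <= t -> t <= T -> enorm (W t - W s) <= K * (t - s)) ->
  exists2 w, bounded_density K w & forall s, 0 <= s <= T -> prim w s = W s.
Proof.
move=> K0 W0 WK.
have K1 : 0 < K + 1 by rewrite ltr_wpDl.
have /choice[u uP] : forall i, exists ui : R -> R, mu.-integrable `[0, T] (EFin \o ui) /\
    forall s : R, 0 <= s <= T -> W s i 0 - W 0 i 0 = \int[mu]_(r in `[0, s]) ui r.
  move=> i; have [|ui iui uiW] := @lipschitz_has_density R T (K + 1) (fun s => W s i 0) T0 K1.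
    move=> s t s0 st tT; rewrite -coordB (le_trans (coord_le_enorm _ _))//.
    by rewrite (le_trans (WK _ _ s0 st tT))// ler_wpM2r ?subr_ge0// lerDl.
  by exists ui.
pose v (s : R) : 'cV[R]_n := \col_i u i s.
have vE i : (fun s => v s i 0) = u i by apply/funext => s; rewrite mxE.
have vW s : 0 <= s <= T -> prim v s = W s.
  move=> sT; apply/matrixP => i j; rewrite ord1 mxE vE.
  by have [_ /(_ s sT) <-] := uP i; rewrite W0 [X in _ - X]mxE subr0.
have iv i : mu.-integrable `[0, T] (EFin \o (fun r => v r i 0)).
  by rewrite vE; have [] := uP i.
have vK : {ae mu, forall t, 0 < t < T -> enorm (v t) <= K}.
  apply: (prim_lipschitz_density T0 iv) => s t s0 st tT.
  rewrite !vW ?s0 ?tT ?(le_trans s0 st) ?(le_trans st tT)//; exact: WK.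
have nz (x : R) : {ae mu, forall r : R, r != x}.
  exists [set x]; split => //; first by rewrite lebesgue_measure_set1.
  by move=> r /= /negP; rewrite negbK => /eqP.
have vK' : {ae mu, forall t, 0 <= t <= T -> enorm (v t) <= K}.
  apply: ae_imp (ae_and vK (ae_and (nz 0) (nz T))) => t [vt [t0 tT]] tT'.
  by apply: vt; move: tT'; rewrite !le_eqVlt (eq_sym 0) (negPf t0) (negPf tT).
have mv i : measurable_fun `[0, T] (fun s => v s i 0).
  by have /integrableP[/measurable_EFinP] := iv i.
have [w bw wv] := bounded_density_modification K0 mv vK'.
exists w => // s sT; rewrite -vW//; apply/matrixP => i j; rewrite !mxE.
rewrite /Rintegral; congr fine; have /andP[s0 sT'] := sT.
apply: ae_eq_integral => //.
- by apply/measurable_EFinP; apply: measurable_funTS; exact: bw.1.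
- apply/measurable_EFinP; apply: measurable_funS (mv i) => //.
  by apply: subset_itvl; rewrite bnd_simp.
- move: wv; apply: ae_imp => r wr; rewrite /= in_itv/= => /andP[r0 rs].
  by rewrite wr// r0 (le_trans rs).
Qed.

(** A common Lipschitz constant turns pointwise into uniform convergence. Compactness of [0, T] is
    used in its near-covering form, which works along an arbitrary filter. *)
Lemma near_sup_lipschitz (I : Type) (U : set_system I) {FU : Filter U} n (L eps : R)
    (W : I -> R -> 'cV[R]_n) : 0 <= L -> 0 < eps ->
  (\forall i \near U, forall s t, 0 <= s <= T -> 0 <= t <= T ->
     enorm (W i t - W i s) <= L * `|t - s|) ->
  (forall s eps' : R, 0 <= s <= T -> 0 < eps' -> \forall i \near U, enorm (W i s) <= eps') ->
  \forall i \near U, forall s : R, 0 <= s <= T -> enorm (W i s) <= eps.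
Proof.
move=> L0 eps0 WL W0; have eps20 : 0 < eps / 2 by rewrite divr_gt0.
have L1 : 0 < L + 1 by rewrite ltr_wpDl.
have [+ _] := @compact_near_coveringP R `[0, T]%classic.
move=> /(_ (@segment_compact R 0 T)) /(_ I U (fun i s => 0 <= s <= T -> enorm (W i s) <= eps) FU).
have -> : (\forall i \near U, forall s : R, 0 <= s <= T -> enorm (W i s) <= eps) =
  (\forall i \near U, `[0, T]%classic `<=` (fun s => 0 <= s <= T -> enorm (W i s) <= eps)).
  congr (nbhs U _); apply/funext => i; apply/propext; split => [h s _|h s sT]; first exact: h.
  by apply: h => //; rewrite /= in_itv.
apply => s; rewrite /= in_itv/= => sT.
near=> s' i => s'T.
have h1 : enorm (W i s) <= eps / 2 by near: i; exact: W0.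
have h2 : enorm (W i s' - W i s) <= L * `|s' - s|.
  have : forall s t, 0 <= s <= T -> 0 <= t <= T -> enorm (W i t - W i s) <= L * `|t - s|.
    by near: i; exact: WL.
  exact.
rewrite -(subrK (W i s) (W i s')) (le_trans (enormD _ _))// (splitr eps) lerD//.
rewrite (le_trans h2)// (@le_trans _ _ ((L + 1) * `|s' - s|))//.
  by rewrite ler_wpM2r// lerDl.
rewrite -ler_pdivlMl// mulrC distrC; near: s'.
have := @cvgr_dist_le _ _ _ _ _ id s (@cvg_id _ _) (eps / 2 / (L + 1)).
apply; exact: divr_gt0.
Unshelve. all: by end_near. Qed.

(** Convergence is strengthened in three stages. The fractional integrals converge uniformly by
    their common Lipschitz bound; then the paths converge in sup norm by [stopped_frac_bound]; then
    they converge in variation by [rvar_small] and their common Hoelder bound. *)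
Lemma compact_tube (k : nat) (r : R -> R) (M : R) :
  {within `[0, T], continuous r} -> (forall t, 0 <= t <= T -> r t <= M) ->
  compact [set P : X | enorm (spos P) <= r (stime P) /\ AC_ball k (spath P)].
Proof.
move=> rc rM; rewrite compact_ultra => U UU UK.
have c0 := frac_const_gt0 a01; have c0' := ltW c0; have k0 : 0 <= k%:R :> R by [].
have [t tT tU] : exists2 t, 0 <= t <= T & (@stime R p hp T a e l) @ U --> t.
  have [|t] := @ultra_cvg_compact X U UU R `[0, T]%classic (@stime R p hp T a e l) (@segment_compact R 0 T).
    by apply: filterS UK => P _; rewrite /= in_itv/=; exact: stimeP.
  by rewrite /= in_itv/=; exists t.
have [x _ xU] : exists2 x, enorm x <= M &
    forall eps : R, 0 < eps -> \forall P \near U, enorm (spos P - x) <= eps.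
  apply: ultra_cvg_enorm; apply: filterS UK => P [Pr _]; apply: (le_trans Pr).
  exact: rM (stimeP P).
have xr : enorm x <= r t.
  apply/ler_addgt0Pr => eps e0; have e20 : 0 < eps / 2 by rewrite divr_gt0.
  have rU : \forall P \near U, r (stime P) <= r t + eps / 2.
    have /subspace_continuousP /(_ t) := rc.
    rewrite /= in_itv/= => /(_ tT)/cvgrPdist_le /(_ _ e20); rewrite near_withinE => H.
    have tUH : \forall P \near U, 0 <= stime P <= T -> `|r t - r (stime P)| <= eps / 2.
      exact: (tU _ H).
    apply: filterS tUH => P /(_ (stimeP P)).
    by rewrite ler_norml; move=> /andP[]; lra.
  have [P [[Pr _] [Px Pt]]] := filter_ex (filterI UK (filterI (xU _ e20) rU)).
  have := le_trans (enormB_le (spos P) (spos P - x)) (lerD (le_trans Pr Pt) Px).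
  by rewrite opprB addrC subrK (_ : r t + eps / 2 + eps / 2 = r t + eps)//; field.
have [y yk yU] : exists2 y, enorm y <= k%:R &
    forall eps : R, 0 < eps -> \forall P \near U, enorm (spath P 0 - y) <= eps.
  by apply: ultra_cvg_enorm; apply: filterS UK => P [_ []].
have /choice[u uP] : forall P : X, exists u, AC_ball k (spath P) -> has_density k%:R (spath P) u.
  move=> P; have [h|h] := pselect (AC_ball k (spath P)); last by exists (fun=> 0).
  by have [u Pu] := AC_ball_density h; exists u.
have UL : \forall P \near U, forall s t, 0 <= s <= T -> 0 <= t <= T ->
    enorm (frac_int (spath P) t - frac_int (spath P) s) <= frac_const a * k%:R * `|t - s|.
  apply: filterS UK => P [_ Pk] s s' sT s'T; exact: (has_density_lip a01 (uP P Pk)).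
have frac0 (g : ACpath T a l) : frac_int g 0 = 0 by exact: frac_int_le0.
have T00 : 0 <= (0 : R) <= T by rewrite lexx ltW.
(* The limit path is recovered from the pointwise limit V of the fractional
   integrals, which inherits the Lipschitz bound. *)
have /choice[V VP] : forall s : R, exists V : 'cV[R]_l, 0 <= s <= T ->
    forall eps : R, 0 < eps -> \forall P \near U, enorm (frac_int (spath P) s - V) <= eps.
  move=> s; have [sT|sT] := boolP (0 <= s <= T); last by exists 0.
  have [|V _ VU] := @ultra_cvg_enorm R X U UU l (fun P => frac_int (spath P) s)
    (frac_const a * k%:R * `|s - 0|).
    by apply: filterS UL => P PL; have := PL 0 s T00 sT; rewrite frac0 subr0.
  by exists V.
have VL s s' : 0 <= s <= T -> 0 <= s' <= T -> enorm (V s' - V s) <= frac_const a * k%:R * `|s' - s|.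
  move=> sT s'T; apply/ler_addgt0Pr => eps e0; have e20 : 0 < eps / 2 by rewrite divr_gt0.
  have [P [PL [Ps Ps']]] := filter_ex (filterI UL (filterI (VP s sT _ e20) (VP s' s'T _ e20))).
  have -> : V s' - V s = (frac_int (spath P) s' - frac_int (spath P) s) +
     ((frac_int (spath P) s - V s) - (frac_int (spath P) s' - V s')).
    move: (frac_int _ _) (frac_int _ _) (V s) (V s') => z1 z2 z3 z4.
    by apply/matrixP => i j; rewrite !mxE; ring.
  rewrite (le_trans (enormD _ _))// lerD ?PL// (splitr eps).
  by rewrite (le_trans (enormB_le _ _))// lerD.
have V0 : V 0 = 0.
  apply: enorm_eq0; apply/eqP; rewrite eq_le enorm_ge0 andbT; apply/ler_addgt0Pr => eps e0.
  have [P] := filter_ex (VP 0 T00 _ e0); rewrite frac0 sub0r enormN add0r//.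
have [w bw wV] : exists2 w, bounded_density k%:R w &
    forall s, 0 <= s <= T -> prim w s = (frac_const a)^-1 *: V s.
  apply: prim_of_lipschitz => //; first by rewrite V0 scaler0.
  move=> s s' s0 ss' s'T; rewrite -scalerBr enormZ ger0_norm ?invr_ge0// ler_pdivrMl// mulrA.
  have := VL s s'; rewrite s0 (le_trans ss' s'T) s'T (le_trans s0 ss')/= => /(_ isT isT).
  by rewrite (@ger0_norm _ (s' - s)) ?subr_ge0.
have [g [g0 [gE gV]]] := path_of_density y T0 a01 bw.
have gV' s : 0 <= s <= T -> frac_int g s = V s.
  by move=> sT; rewrite gV// wV// scalerA divff ?gt_eqF// scale1r.
have gk : AC_ball k g.
  split; first by rewrite g0.
  apply: (Linf_norm_fracD_le T0 a01 k0) => s s' s0 ss' s'T.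
  have := VL s s'; rewrite s0 (le_trans ss' s'T) s'T (le_trans s0 ss')/= => /(_ isT isT).
  rewrite !gV' ?s0 ?s'T ?(le_trans ss' s'T) ?(le_trans s0 ss')//.
  by rewrite (@ger0_norm _ (s' - s)) ?subr_ge0.
pose Q : X := State hp x g tT.
exists Q; split; first by split.
move=> A /nbhs_ballP[eps /= e0 QA]; apply: filterS QA _.
have e20 : 0 < eps / 2 by rewrite divr_gt0.
have e40 : 0 < eps / 4 by rewrite divr_gt0.
have [ug gug] := AC_ball_density gk.
pose C := 2 * (l%:R * ((Gamma a)^-1 * (2 * k%:R / a))).
have /andP[a0 a1] := a01; have G0 := Gamma_gt0 a01.
have C0 : 0 <= C by rewrite /C !mulr_ge0 ?invr_ge0 ?(ltW G0) ?(ltW a0).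
have [eta eta0 small] := rvar_small (floor_ratio_ge1 hp) a0 pa T0 C0 e20.
have eta30 : 0 < eta / 3 by rewrite divr_gt0.
have [C1 C10 HC1] := @stopped_frac_bound R T a l a01 k%:R _ k0 eta30.
pose d := eta / (3 * (C1 + 1)); have C11 : 0 < C1 + 1 by rewrite ltr_wpDl.
have d0 : 0 < d by rewrite divr_gt0 ?mulr_gt0.
have unif : \forall P \near U, forall s, 0 <= s <= T -> enorm (frac_int g s - frac_int (spath P) s) <= d.
  apply: (@near_sup_lipschitz X U _ l (frac_const a * k%:R + frac_const a * k%:R) d
    (fun P s => frac_int g s - frac_int (spath P) s)) => //.
  - by rewrite addr_ge0// mulr_ge0.
  - apply: filterS UL => P PL s s' sT s'T; rewrite mulrDl !gV'//.
    apply: le_trans (lerD (VL s s' sT s'T) (PL s s' sT s'T)).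
    apply: le_trans (enormB_le _ _).
    move: (frac_int _ _) (frac_int _ _) (V s) (V s') => z1 z2 z3 z4.
    by rewrite (_ : z4 - z2 - (z3 - z1) = z4 - z3 - (z2 - z1))//; apply/matrixP => i j; rewrite !mxE; ring.
  - move=> s eps' sT eps'0; rewrite gV'//; apply: filterS (VP s sT _ eps'0) => P.
    by rewrite enormB.
have tn : \forall P \near U, `|t - stime P| <= eps / 2 by move/cvgrPdist_le : tU; exact.
near=> P.
have Pk : AC_ball k (spath P) by near: P; apply: filterS UK => P' [].
have Pu := uP P Pk.
apply/rho_ballP; split.
- rewrite (@le_lt_trans _ _ (eps / 2))//; last by rewrite ltr_pdivrMr// mulr_natr mulr2n ltrDl.
  by near: P; exact: tn.
- rewrite (@le_lt_trans _ _ (eps / 2))//; last by rewrite ltr_pdivrMr// mulr_natr mulr2n ltrDl.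
  by rewrite enormB; near: P; exact: xU.
have y4 : enorm (g 0 - spath P 0) <= eps / 4.
  by rewrite g0 enormB; near: P; exact: yU.
have y3 : enorm (g 0 - spath P 0) <= eta / 3.
  by rewrite g0 enormB; near: P; exact: yU.
have Pd : forall s, 0 <= s <= T -> enorm (frac_int g s - frac_int (spath P) s) <= d.
  by near: P; exact: unif.
(* Stopping at [T] leaves a path unchanged, so [stopped_frac_bound] at time [T] compares the paths
   themselves. *)
have gT s : s <= T -> forall h : ACpath T a l, stopped T h s = h s.
  by move=> sT h; rewrite /stopped sT.
have TT : 0 <= T <= T by rewrite lexx ltW.
have sup s : 0 <= s <= T -> enorm (g s - spath P s) <= eta.
  move=> sT; have /andP[_ sT'] := sT.
  have := HC1 g (spath P) ug (u P) T d TT (ltW d0) gug Pu Pd s sT.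
  rewrite !gT// => h; apply: (le_trans h).
  have : C1 * d <= eta / 3.
    rewrite /d mulrA ler_pdivrMr ?mulr_gt0//.
    have -> : eta / 3 * (3 * (C1 + 1)) = C1 * eta + eta by field.
    by rewrite lerDl ltW.
  move: y3; lra.
rewrite /path_dist /= (@le_lt_trans _ _ ((eps / 4)%:E + (eps / 2)%:E)%E)//; last first.
  by rewrite -EFinD lte_fin; lra.
apply: leeD; first by rewrite lee_fin.
apply: small; last exact: sup.
move=> s s' sT s'T.
have hold (h : ACpath T a l) v : has_density k%:R h v -> enorm (h s' - h s) <= C / 2 * `|s' - s| `^ a.
  move=> hv; rewrite (has_densityE hv sT) (has_densityE hv s'T) opprD addrACA subrr add0r.
  have [bv _ _] := hv; rewrite (_ : C / 2 = l%:R * ((Gamma a)^-1 * (2 * k%:R / a))); last by rewrite /C mulrC mulKf.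
  by case/andP: sT => s0 _; case/andP: s'T => s'0 _; exact: pot_vec_holder.
have := lerD (hold _ _ gug) (hold _ _ Pu); rewrite -mulrDl -splitr; apply: le_trans.
apply: le_trans (enormB_le _ _); rewrite (_ : g s' - _ - _ = (g s' - g s) - (spath P s' - spath P s))//.
move: (g s') (g s) (spath P s') (spath P s) => z1 z2 z3 z4.
by apply/matrixP => i j; rewrite !mxE; ring.
Unshelve. all: by end_near.
Qed.

End compactness.

(** * Drift, Hamiltonian and tube *)

Section continuity_lemmas.
Context {R : realType} {V : topologicalType}.

Lemma coord_fun_continuous n (f : V -> 'cV[R]_n) i : continuous f -> continuous (fun v => f v i 0).
Proof.
by move=> fc v; apply: (@continuous_comp _ _ _ f (fun M : 'cV[R]_n => M i 0)); [exact: fc|exact: coord_continuous].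
Qed.

Lemma continuous_coord n (f : V -> 'cV[R]_n) : (forall i, continuous (fun v => f v i 0)) -> continuous f.
Proof.
move=> fc; apply: continuous_enorm => v eps e0.
have n1 : 0 < n%:R + 1 :> R by rewrite ltr_wpDl.
have : \forall w \near v, forall i, `|f v i 0 - f w i 0| <= eps / (n%:R + 1).
  apply: filter_forall => i; move/cvgrPdist_le: (fc i v); apply; exact: divr_gt0.
apply: filterS => w fvw; apply: (@le_trans _ _ (n%:R * (eps / (n%:R + 1)))).
  by apply: enorm_le_bound => i; rewrite coordB.
by rewrite mulrA ler_pdivrMr// mulrC ler_wpM2l ?(ltW e0)// lerDl.
Qed.

Lemma continuousM_fun (f g : V -> R) : continuous f -> continuous g -> continuous (fun v => f v * g v).
Proof. by move=> fc gc v; apply: cvgM; [exact: fc|exact: gc]. Qed.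

Lemma continuous_sum n (f : 'I_n -> V -> R) : (forall i, continuous (f i)) ->
  continuous (fun v => \sum_(i < n) f i v).
Proof.
elim: n f => [|n IH] f fc.
  by under eq_fun do rewrite big_ord0; exact: cst_continuous.
under eq_fun do rewrite big_ord_recr; apply: continuousD_fun => //.
by apply: IH => i; exact: fc.
Qed.

Lemma dot_continuous n (f g : V -> 'cV[R]_n) : continuous f -> continuous g ->
  continuous (fun v => dot (f v) (g v)).
Proof.
move=> fc gc; apply: continuous_sum => i; apply: continuousM_fun; exact: coord_fun_continuous.
Qed.

Lemma mulmx_continuous m n (A : V -> 'M[R]_(m, n)) (f : V -> 'cV[R]_n) :
  continuous A -> continuous f -> continuous (fun v => A v *m f v).
Proof.
move=> Ac fc; apply: continuous_coord => i.
have -> : (fun v => (A v *m f v) i 0) = (fun v => \sum_(j < n) A v i j * f v j 0).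
  by apply/funext => v; rewrite mxE.
apply: continuous_sum => j; apply: continuousM_fun; last exact: coord_fun_continuous.
move=> v; apply: (@continuous_comp _ _ _ A (fun M : 'M[R]_(m, n) => M i j)); first exact: Ac.
exact: coord_continuous.
Qed.

Lemma pair_continuous (W W' : topologicalType) (f : V -> W) (g : V -> W') :
  continuous f -> continuous g -> continuous (fun v => (f v, g v)).
Proof. by move=> fc gc v; apply: cvg_pair; [exact: fc|exact: gc]. Qed.

Lemma continuousD_norm (W : normedModType R) (f g : V -> W) : continuous f -> continuous g ->
  continuous (fun v => f v + g v).
Proof. by move=> fc gc v; apply: cvgD; [exact: fc|exact: gc]. Qed.

Lemma continuousB_norm (W : normedModType R) (f g : V -> W) : continuous f -> continuous g ->
  continuous (fun v => f v - g v).
Proof. by move=> fc gc v; apply: cvgB; [exact: fc|exact: gc]. Qed.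

End continuity_lemmas.

Section lipschitz_functions.
Context {R : realType} {W W' : normedModType R}.

Lemma lipschitz_bound (h : W -> W') : lipschitz h ->
  exists2 L : R, 0 < L & forall x y, `|h x - h y| <= L * `|x - y|.
Proof.
move=> /pinfty_ex_gt0[L L0 hL]; exists L => // x y.
by have := hL (x, y); apply.
Qed.

Lemma lipschitz_continuous (h : W -> W') : lipschitz h -> continuous h.
Proof.
move=> /lipschitz_bound[L L0 hL]; apply: continuous_dist => x eps e0.
near=> y; rewrite (le_trans (hL _ _))// -ler_pdivlMl//.
near: y; apply: cvgr_dist_le; first exact: cvg_id.
by rewrite mulr_gt0// invr_gt0.
Unshelve. all: by end_near. Qed.

End lipschitz_functions.

Section derivative_on_interval.
Context {R : realType}.
Notation mu := (@lebesgue_measure R).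

Lemma within_dnbhs_proper (T t : R) : 0 < T -> 0 <= t <= T ->
  ProperFilter (within `[0, T]%classic t^').
Proof.
move=> T0 /andP[t0 tT]; apply: Build_ProperFilter_ex => B [d /= d0 dB].
have [tT'|tT'] := ltP t T.
  exists (Num.min T (t + d / 2)); have td : t < Num.min T (t + d / 2).
    by rewrite lt_min tT' ltrDl divr_gt0.
  have dt : Num.min T (t + d / 2) <= t + d / 2 by rewrite ge_min lexx orbT.
  have d2 : d / 2 < d by rewrite ltr_pdivrMr// mulr_natr mulr2n ltrDl.
  apply: dB => /=.
  - by rewrite ltr_distlC; apply/andP; split; lra.
  - by rewrite gt_eqF.
  - by rewrite in_itv/= ge_min lexx andbT (le_trans t0)// ltW.
exists (Num.max 0 (t - d / 2)).
have t0' : 0 < t by rewrite (lt_le_trans T0).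
have td : Num.max 0 (t - d / 2) < t by rewrite gt_max t0' gtrBl divr_gt0.
have dt : t - d / 2 <= Num.max 0 (t - d / 2) by rewrite le_max lexx orbT.
have d2 : d / 2 < d by rewrite ltr_pdivrMr// mulr_natr mulr2n ltrDl.
apply: dB => /=.
- by rewrite ltr_distlC; apply/andP; split; lra.
- by rewrite lt_eqF.
- by rewrite in_itv/= le_max lexx/= (le_trans (ltW td)).
Qed.

Lemma derive_on_smooth n (T : R) (f : R -> 'cV[R]_n) : 0 < T -> smooth_on T f ->
  exists2 F : R -> 'cV[R]_n, {within `[0, T], continuous F} &
    forall t, 0 <= t <= T -> derive_on T f t = F t.
Proof.
move=> T0 [F [F0 FD]]; exists (F 1%N); last first.
  move=> t tT; have PF := within_dnbhs_proper T0 tT.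
  apply: cvg_lim => //.
  apply: cvg_trans (FD 0%N t tT); apply: near_eq_cvg.
  rewrite near_withinE; near=> s => sT; rewrite !F0//.
apply/subspace_continuousP => t; rewrite /= in_itv/= => tT.
apply/cvgrPdist_le => eps e0.
have /cvgrPdist_le /(_ 1 ltr01) := FD 1%N t tT.
set D := F 2%N t.
rewrite !near_withinE => HD.
pose K := `|D| + 1; have K0 : 0 < K by rewrite ltr_wpDl.
have near_t : \forall s \near t, `|t - s| <= eps / K.
  by exists (eps / K) => /= [|s /= /ltW//]; exact: divr_gt0.
apply: filterS2 HD near_t => s hs ts sT /=.
have [->|st] := eqVneq s t; first by rewrite subrr normr0 ltW.
have := hs st sT => h.
have st0 : s - t != 0 by rewrite subr_eq0.
have -> : F 1%N t - F 1%N s = - ((s - t) *: ((s - t)^-1 *: (F 1%N s - F 1%N t))).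
  by rewrite scalerA divff// scale1r opprB.
rewrite normrN normrZ (distrC s).
have : `|(s - t)^-1 *: (F 1%N s - F 1%N t)| <= K.
  rewrite -[X in `|X|](subKr D) (le_trans (ler_normB _ _))// lerD2l//.
move=> hK; rewrite (le_trans (ler_pM _ _ ts hK))// divfK// gt_eqF.
Unshelve. all: by end_near. Qed.

End derivative_on_interval.

Section hamiltonian_facts.
Context {R : realType} {e l : nat}.

Lemma sup_ge0 (A : set R) : (forall x, A x -> 0 <= x) -> 0 <= sup A.
Proof.
move=> A0; have [hs|nhs] := pselect (has_sup A); last by rewrite sup_out.
have [x Ax] := hs.1; apply: le_trans (A0 x Ax) _; exact: sup_upper_bound.
Qed.

(** For controls of norm at most n, changing [phi] costs n |phi - phi'|; as [f] does not involve the
    control, its change leaves the supremum. The lower bound on [ft] makes the set bounded above, so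
    that [sup] is a genuine supremum. *)
Lemma hamiltonian_le (n : nat) (C0 : R) (f : 'cV[R]_e * 'cV[R]_l -> R) (ft : 'cV[R]_l -> R)
    (x x' : 'cV[R]_e) (y y' phi phi' : 'cV[R]_l) : (forall u, - C0 <= ft u) ->
  hamiltonian (fun x y u => f (x, y) + ft u) n x' y' phi' <=
  hamiltonian (fun x y u => f (x, y) + ft u) n x y phi
  + (f (x, y) - f (x', y')) + n%:R * enorm (phi - phi').
Proof.
move=> ftC; apply: ge_sup.
  by exists (- dot phi' 0 - (f (x', y') + ft 0)); exists 0 => //=; rewrite enorm0.
move=> _ [u /= un <-].
have ub : - dot phi u - (f (x, y) + ft u) <= hamiltonian (fun x y u => f (x, y) + ft u) n x y phi.
  apply: ub_le_sup; last by exists u.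
  exists (enorm phi * n%:R - f (x, y) + C0) => _ [v /= vn <-].
  have := ftC v; have := dot_norm_le phi v; rewrite ler_norml => /andP[h _].
  have : enorm phi * enorm v <= enorm phi * n%:R by rewrite ler_wpM2l ?enorm_ge0.
  lra.
have := dot_le (phi - phi') u; rewrite dotBl.
have : enorm (phi - phi') * enorm u <= n%:R * enorm (phi - phi').
  by rewrite mulrC ler_wpM2r ?enorm_ge0.
lra.
Qed.

End hamiltonian_facts.

Section tube.
Context {R : realType} {d e l : nat} (T : R) (T0 : 0 < T).
Notation mu := (@lebesgue_measure R).
Variables (b : 'cV[R]_e * 'cV[R]_l -> 'cV[R]_e)
          (lambda : 'cV[R]_e * 'cV[R]_l -> 'M[R]_(e, d))
          (eta : R -> 'cV[R]_d) (heta : smooth_on T eta).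

Lemma lipschitz_within_continuous (f : R -> R) (C : R) : 0 <= C ->
  (forall s t, 0 <= s -> s <= t -> t <= T -> `|f t - f s| <= C * (t - s)) ->
  {within `[0, T], continuous f}.
Proof.
move=> C0 fC; apply/subspace_continuousP => x; rewrite /= in_itv/= => /andP[x0 xT].
have C1 : 0 < C + 1 by rewrite ltr_wpDl.
apply/cvgrPdist_le => eps eps0; exists (eps / (C + 1)) => /=; first exact: divr_gt0.
move=> y /=; rewrite in_itv/= => xy /andP[y0 yT].
have : `|f x - f y| <= C * `|x - y|.
  have [xy'|/ltW yx] := leP x y; last by rewrite (ger0_norm (_ : 0 <= x - y)) ?subr_ge0// fC.
  by rewrite distrC (distrC x) (ger0_norm (_ : 0 <= y - x)) ?subr_ge0// fC.
move=> h; rewrite (le_trans h)// (le_trans (y := (C + 1) * `|x - y|))//.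
  by rewrite ler_wpM2r// lerDl.
by rewrite mulrC -ler_pdivlMr// ltW.
Qed.

(** Continuity makes the truncated domain closed, the lower bound lets it contain any given position
    once k is large, and the upper bound keeps the positions bounded. *)
Lemma tube_radius_facts (k : nat) :
  [/\ {within `[0, T], continuous (@tube_radius R T d e l b lambda eta k)},
      forall t, 0 <= t <= T -> k%:R <= @tube_radius R T d e l b lambda eta k t &
      exists M, forall t, 0 <= t <= T -> @tube_radius R T d e l b lambda eta k t <= M].
Proof.
have [F Fc FE] := derive_on_smooth T0 heta.
pose phi r := enorm (derive_on T eta r).
have phic : {within `[0, T], continuous phi}.
  apply/subspace_continuousP => t; rewrite /= => tT'; have tT : 0 <= t <= T by move: tT'; rewrite /= in_itv.
  apply/cvgrPdist_le => eps e0; have n1 : 0 < d%:R + 1 :> R by rewrite ltr_wpDl.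
  have /subspace_continuousP /(_ t tT') /cvgrPdist_le /(_ (eps / (d%:R + 1))) := Fc.
  rewrite divr_gt0// => /(_ isT); rewrite !near_withinE; apply: filterS => s h sT' /=.
  have sT : 0 <= s <= T by move: sT'; rewrite /= in_itv.
  change (`|phi t - phi s| <= eps).
  rewrite /phi !FE// (le_trans (enorm_dist _ _))// (le_trans (enorm_le_mx_norm _))//.
  rewrite (le_trans (ler_wpM2l (ler0n _ _) (h sT')))// mulrA ler_pdivrMr// mulrC ler_wpM2l ?(ltW e0)//.
  by rewrite lerDl.
have [M M0 phiM] : exists2 M, 0 <= M & forall r, 0 <= r <= T -> phi r <= M.
  have [c cT cmax] := EVT_max (ltW T0) phic.
  by exists (phi c) => [|r rT]; [exact: enorm_ge0|apply: cmax; rewrite in_itv].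
have iphi x y : 0 <= x -> y <= T -> mu.-integrable `[x, y] (EFin \o phi).
  move=> x0 yT; have := continuous_compact_integrable (@segment_compact R 0 T) phic.
  exact: integrable_subitv.
have int_le x y : 0 <= x -> x <= y -> y <= T -> 0 <= \int[mu]_(r in `[x, y]) phi r <= M * (y - x).
  move=> x0 xy yT; apply/andP; split; first by apply: Rintegral_ge0 => r _; exact: enorm_ge0.
  rewrite -Rintegral_cst_itv//; apply: le_Rintegral => //; [exact: iphi|exact: integrable_cst_itv|].
  by move=> r; rewrite /= in_itv/= => /andP[xr ry]; apply: phiM; rewrite (le_trans x0 xr) (le_trans ry).
set S1 := sup [set enorm (b z) | z in setT].
set S2 := sup [set opnorm (lambda z) | z in setT].
have S10 : 0 <= S1 by apply: sup_ge0 => _ [z _ <-]; exact: enorm_ge0.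
have S20 : 0 <= S2.
  apply: sup_ge0 => _ [z _ <-]; apply: sup_ge0 => _ [v _ <-]; exact: enorm_ge0.
have rE t : @tube_radius R T d e l b lambda eta k t = k%:R + S1 * t + S2 * \int[mu]_(r in `[0, t]) phi r by [].
have inc s t : 0 <= s -> s <= t -> t <= T ->
   0 <= @tube_radius R T d e l b lambda eta k t - @tube_radius R T d e l b lambda eta k s <= (S1 + S2 * M) * (t - s).
  move=> s0 st tT; rewrite !rE (Rintegral_split s0 st (iphi 0 t (lexx _) tT)).
  have /andP[h1 h2] := int_le s t s0 st tT.
  have -> : k%:R + S1 * t + S2 * (\int[mu]_(r in `[0, s]) phi r + \int[mu]_(r in `[s, t]) phi r) -
    (k%:R + S1 * s + S2 * \int[mu]_(r in `[0, s]) phi r) =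
    S1 * (t - s) + S2 * \int[mu]_(r in `[s, t]) phi r by ring.
  rewrite addr_ge0 ?mulr_ge0 ?subr_ge0//= mulrDl lerD2l -mulrA ler_wpM2l//.
have L0 : 0 <= S1 + S2 * M by rewrite addr_ge0// mulr_ge0.
have r0 : @tube_radius R T d e l b lambda eta k 0 = k%:R.
  by rewrite rE set_itv1 Rintegral_set1 !mulr0 !addr0.
split.
- apply: (lipschitz_within_continuous L0) => s t s0 st tT.
  by have /andP[h1 h2] := inc s t s0 st tT; rewrite ger0_norm.
- move=> t /andP[t0 tT]; have /andP[h1 _] := inc 0 t (lexx _) t0 tT.
  by rewrite -subr_ge0 -r0.
- exists (k%:R + (S1 + S2 * M) * T) => t /andP[t0 tT].
  have /andP[_ h2] := inc 0 t (lexx _) t0 tT.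
  rewrite -r0 -lerBlDl (le_trans h2)// ler_wpM2l// subr0//.
Qed.

End tube.

(** * Doubling of variables *)

Lemma comp_cvg (I : Type) (F : set_system I) {FF : Filter F} (V W : topologicalType)
    (x : I -> V) (v : V) (g : V -> W) :
  continuous g -> x @ F --> v -> (fun i => g (x i)) @ F --> g v.
Proof. by move=> gc xv; exact: (cvg_comp _ _ xv (gc v)). Qed.

Lemma continuous_comp_fun (V W Z : topologicalType) (h : V -> W) (g : W -> Z) :
  continuous h -> continuous g -> continuous (fun v => g (h v)).
Proof. by move=> hc gc v; exact: (cvg_comp _ _ (hc v) (gc (h v))). Qed.

Lemma cvg_le_eps {R : realType} (I : Type) (F : set_system I) {FF : ProperFilter F}
    (V : topologicalType) (x : I -> V) (v : V) (g : V -> R) (c : R) :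
  continuous g -> x @ F --> v ->
  (forall eps : R, 0 < eps -> \forall i \near F, g (x i) <= c + eps) -> g v <= c.
Proof.
move=> gc xv gxc; apply/ler_addgt0Pr => eps e0; have e20 : 0 < eps / 2 by rewrite divr_gt0.
have /cvgrPdist_le /(_ _ e20) gxv : (fun i => g (x i)) @ F --> g v by exact: comp_cvg.
have [i [h1 h2]] := filter_ex (filterI gxv (gxc _ e20)).
by move: h1; rewrite ler_norml => /andP[_ h1]; lra.
Qed.

Section doubling_of_variables.
Context {R : realType} {p : R} {hp : 2 <= p} {T a : R} {d e l : nat}.
Hypotheses (T0 : 0 < T) (a01 : 0 < a < 1) (pa : a^-1 < floor_ratio p).
Local Notation X := (state hp T a e l).
Variables (b : 'cV[R]_e * 'cV[R]_l -> 'cV[R]_e)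
          (lambda : 'cV[R]_e * 'cV[R]_l -> 'M[R]_(e, d))
          (eta : R -> 'cV[R]_d)
          (f : 'cV[R]_e * 'cV[R]_l -> R) (ftilde : 'cV[R]_l -> R) (C0 : R)
          (g : 'cV[R]_e -> R).
Hypotheses (bc : continuous b) (lc : continuous lambda) (heta : smooth_on T eta)
  (fc : continuous f) (ftC : forall u, - C0 <= ftilde u).

Definition endpoint (P : X) : 'cV[R]_e * 'cV[R]_l := (spos P, spath P (stime P)).

Definition drift (P : X) : 'cV[R]_e :=
  b (endpoint P) + lambda (endpoint P) *m derive_on T eta (stime P).

Lemma endpoint_continuous : continuous endpoint.
Proof.
exact: pair_continuous (@spos_continuous R p hp T a e l) (@spath_stime_continuous R p hp T a e l a01).
Qed.

(** [derive_on T eta] is known to be continuous only within [0, T]; as the times of states lie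
    there, its composition with [stime] is continuous without restriction. *)
Lemma drift_continuous : continuous drift.
Proof.
have zc := endpoint_continuous.
apply: continuousD_norm; first by move=> P; apply: (continuous_comp (zc P)); exact: bc.
apply: mulmx_continuous; first by move=> P; apply: (continuous_comp (zc P)); exact: lc.
have [F Fc FE] := derive_on_smooth T0 heta.
apply: continuous_dist => P eps e0.
have tP := stimeP P; have tPT : `[0, T]%classic (stime P) by rewrite /= in_itv.
have /subspace_continuousP /(_ _ tPT) /cvgrPdist_le /(_ _ e0) := Fc.
rewrite near_withinE => H.
have H' : \forall Q \near P, 0 <= stime Q <= T -> `|F (stime P) - F (stime Q)| <= eps.
  exact: (@stime_continuous R p hp T a e l P _ H).
apply: filterS H' => Q /= h.
rewrite (FE _ tP) (FE _ (stimeP Q)); exact: h (stimeP Q).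
Qed.

Lemma trunc_domain_compact n k : compact (@trunc_domain R p hp T a d e l b lambda eta n k).
Proof.
have [rc _ [M rM]] := tube_radius_facts T0 b lambda heta k.
exact: (compact_tube T0 a01 pa rc rM).
Qed.

Lemma penalty2_continuous : continuous (fun PQ : X * X => penalty PQ.1 PQ.2).
Proof.
apply: continuous_dist => -[P Q] eps e0 /=.
exact: (penalty_near T0 a01 P Q e0).
Qed.

Lemma penalty_grad2_continuous : continuous (fun PQ : X * X => penalty_grad PQ.1 PQ.2).
Proof.
apply: continuous_enorm => -[P Q] eps e0 /=.
exact: (penalty_grad_near T0 a01 P Q e0).
Qed.

Lemma fst_comp_continuous (V : topologicalType) (h : X -> V) : continuous h ->
  continuous (fun PQ : X * X => h PQ.1).
Proof. by move=> hc PQ; apply: (@continuous_comp _ _ _ fst h); [exact: cvg_fst|exact: hc]. Qed.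

Lemma snd_comp_continuous (V : topologicalType) (h : X -> V) : continuous h ->
  continuous (fun PQ : X * X => h PQ.2).
Proof. by move=> hc PQ; apply: (@continuous_comp _ _ _ snd h); [exact: cvg_snd|exact: hc]. Qed.

(** The term m (t - s)^2 is left out because it varies while the rest is fixed; it vanishes on the
    diagonal, so the limit of the maximizers can be compared with diagonal points. *)
Definition doubled (w1 w2 : X -> R) (A B zeta : R) (PQ : X * X) : R :=
  w1 PQ.1 - w2 PQ.2 - A * enorm (spos PQ.1 - spos PQ.2) ^+ 2
  - B * penalty PQ.1 PQ.2 - zeta * (T - stime PQ.1).

Lemma continuousB_fun (V : topologicalType) (u v : V -> R) : continuous u -> continuous v ->
  continuous (fun x => u x - v x).
Proof. by move=> uc vc x; apply: cvgB; [exact: uc|exact: vc]. Qed.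

Lemma continuousX2_fun (V : topologicalType) (u : V -> R) : continuous u ->
  continuous (fun x => u x ^+ 2).
Proof.
by move=> uc; under eq_fun do rewrite expr2; exact: continuousM_fun.
Qed.

Lemma doubled_continuous w1 w2 A B zeta : continuous w1 -> continuous w2 ->
  continuous (doubled w1 w2 A B zeta).
Proof.
move=> w1c w2c.
apply: continuousB_fun; last first.
  apply: continuousM_cst; apply: continuousB_fun; first exact: cst_continuous.
  exact: (fst_comp_continuous (@stime_continuous R p hp T a e l)).
apply: continuousB_fun; last exact: continuousM_cst penalty2_continuous.
apply: continuousB_fun; last first.
  apply: continuousM_cst; apply: continuousX2_fun; apply: enorm_continuous.
  apply: continuousB_norm; [apply: fst_comp_continuous|apply: snd_comp_continuous];
  exact: spos_continuous.
apply: continuousB_fun; [exact: fst_comp_continuous|exact: snd_comp_continuous].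
Qed.

Let HJ (x : 'cV[R]_e) (y u : 'cV[R]_l) := f (x, y) + ftilde u.

(** The squared time difference contributes the same 2 m (s - t) to both time derivatives, so it
    cancels and only zeta remains. *)
Lemma hjb_difference (z m A s t h1 h2 d1 d2 f1 f2 r : R) : h2 <= h1 + (f1 - f2) + r ->
  - (2 * m * (s - t) - z) - 2 * A * d1 + h1 <= 0 ->
  0 <= - (2 * - m * (t - s) + 0) - 2 * - A * - d2 + h2 ->
  z <= 2 * A * (d1 - d2) + (f1 - f2) + r.
Proof.
have -> : - (2 * m * (s - t) - z) - 2 * A * d1 + h1 = z + h1 - (2 * (m * (s - t)) + 2 * (A * d1)) by ring.
have -> : - (2 * - m * (t - s) + 0) - 2 * - A * - d2 + h2 = h2 - (2 * (m * (s - t)) + 2 * (A * d2)) by ring.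
have -> : 2 * A * (d1 - d2) = 2 * (A * d1) - 2 * (A * d2) by ring.
by move: (m * _) (A * d1) (A * d2) => y x1 x2; lra.
Qed.

(** The path gradients of the two test functions differ by the sum in the last term. It vanishes
    once the times agree, by [penalty_grad_antisym]; until then it is an error weighted by the
    Lipschitz constant n of the Hamiltonian. *)
Lemma doubled_viscosity n k (w1 w2 : X -> R) (A B zeta m : R) (P Q : X) : (0 < k)%N ->
  let K := trunc_domain b lambda eta n k in
  viscosity_subsolution b lambda eta HJ g n w1 ->
  viscosity_supersolution b lambda eta HJ g n w2 ->
  K P -> K Q -> stime P < T -> stime Q < T ->
  (forall P' Q', K P' -> K Q' ->
     doubled w1 w2 A B zeta (P', Q') - m * (stime P' - stime Q') ^+ 2 <=
     doubled w1 w2 A B zeta (P, Q) - m * (stime P - stime Q) ^+ 2) ->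
  zeta <= 2 * A * dot (spos P - spos Q) (drift P - drift Q) +
    (f (endpoint P) - f (endpoint Q)) +
    n%:R * enorm ((2 * B) *: (penalty_grad P Q + penalty_grad Q P)).
Proof.
move=> k0 K [_ _ sub] [_ _ sup] KP KQ PT QT opt.
have := sub k _ _ _ _ k0 (test_fun_ci_smooth T0 a01 A B m (- zeta) (spos Q) Q (stime Q)) P KP PT.
have opt1 : \forall Q' \near within K (nbhs P),
   w1 Q' - test_fun A B m (- zeta) (spos Q) Q (stime Q) Q' <=
   w1 P - test_fun A B m (- zeta) (spos Q) Q (stime Q) P.
  rewrite near_withinE; apply: nearW => P' KP'; have := opt P' Q KP' KQ.
  by rewrite /doubled /test_fun /=; lra.
move=> /(_ opt1) subP.
have := sup k _ _ _ _ k0 (test_fun_ci_smooth T0 a01 (- A) (- B) (- m) 0 (spos P) P (stime P)) Q KQ QT.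
have opt2 : \forall Q' \near within K (nbhs Q),
   w2 Q - test_fun (- A) (- B) (- m) 0 (spos P) P (stime P) Q <=
   w2 Q' - test_fun (- A) (- B) (- m) 0 (spos P) P (stime P) Q'.
  rewrite near_withinE; apply: nearW => Q' KQ'; have := opt P Q' KP KQ'.
  rewrite /doubled /test_fun /= !(penalty_sym _ P) !(enormB _ (spos P)).
  by rewrite -!(sqrrN (stime P - _)) !opprB; lra.
move=> /(_ opt2) supQ; move: subP supQ; rewrite /hjb.
set dg1 := (2 * B) *: penalty_grad P Q; set dg2 := (2 * - B) *: penalty_grad Q P.
have := @hamiltonian_le R e l n C0 f ftilde (spos P) (spos Q) (spath P (stime P)) (spath Q (stime Q)) dg1 dg2 ftC.
have -> : dg1 - dg2 = (2 * B) *: (penalty_grad P Q + penalty_grad Q P).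
  by apply/matrixP => i j; rewrite /dg1 /dg2 !mxE; ring.
rewrite -/HJ -/(endpoint P) -/(endpoint Q) -/(drift P) -/(drift Q).
rewrite !dotZl dotBr.
have -> : spos Q - spos P = - (spos P - spos Q) by rewrite opprB.
rewrite dotNl; exact: hjb_difference.
Qed.

(* The limit of maximizers as the weight m on (t - s)^2 tends to infinity; the
   path gradients cancel in the limit, since both points then carry the same time. *)
Lemma doubling n k (w1 w2 : X -> R) (A B zeta : R) : (0 < k)%N ->
  let K := trunc_domain b lambda eta n k in K !=set0 ->
  viscosity_subsolution b lambda eta HJ g n w1 ->
  viscosity_supersolution b lambda eta HJ g n w2 ->
  exists P Q, [/\ K P, K Q, stime P = stime Q,
    (forall P', K P' -> doubled w1 w2 A B zeta (P', P') <= doubled w1 w2 A B zeta (P, Q)) &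
    stime P < T -> zeta <= 2 * A * dot (spos P - spos Q) (drift P - drift Q) +
      (f (endpoint P) - f (endpoint Q))].
Proof.
move=> k0 K K0 sub sup; have [P0 KP0] := K0.
have [w1c _ _] := sub; have [w2c _ _] := sup.
have Dc := @doubled_continuous w1 w2 A B zeta w1c w2c.
have Kc : compact (K `*` K) by apply: compact_setX; exact: trunc_domain_compact.
have KK0 : K `*` K !=set0 by exists (P0, P0).
have sc : continuous (fun PQ : X * X => (stime PQ.1 - stime PQ.2) ^+ 2).
  apply: continuousX2_fun; apply: continuousB_fun.
    exact: (fst_comp_continuous (@stime_continuous R p hp T a e l)).
  exact: (snd_comp_continuous (@stime_continuous R p hp T a e l)).
pose D m PQ := doubled w1 w2 A B zeta PQ - m%:R * (stime PQ.1 - stime PQ.2) ^+ 2.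
have /choice[x xP] : forall m : nat, exists PQ : X * X, (K `*` K) PQ /\
    forall PQ', (K `*` K) PQ' -> D m PQ' <= D m PQ.
  move=> m; have Dmc : continuous (D m) by apply: continuousB_fun => //; exact: continuousM_cst.
  have [c /set_mem cK cmax] := compact_EVT_max KK0 Kc (continuous_subspaceT Dmc).
  by exists c; split => // PQ' /mem_set; exact: cmax.
have [c cK cmax] := compact_EVT_max KK0 Kc (continuous_subspaceT Dc).
have [U [UU oU]] := @ultraFilterLemma nat \oo _.
have [[P Q] [/= KP KQ] xU] : exists2 PQ : X * X, (K `*` K) PQ & x @ U --> PQ.
  by apply: (ultra_cvg_compact Kc); apply: nearW => m; exact: (xP m).1.
(* On the diagonal the time penalty vanishes, so the gap [C] between the maximum of [doubled] and
   one diagonal value bounds m (t - s)^2 at the maximizers for every m. *)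
pose C := doubled w1 w2 A B zeta c - doubled w1 w2 A B zeta (P0, P0).
have DxP m P' : K P' -> doubled w1 w2 A B zeta (P', P') <= D m (x m).
  move=> KP'; have := (xP m).2 (P', P') (conj KP' KP').
  by rewrite {1}/D /= subrr expr0n mulr0 subr0.
have Dle m : D m (x m) <= doubled w1 w2 A B zeta (x m).
  by rewrite /D gerBl mulr_ge0// sqr_ge0.
have sxC m : m%:R * (stime (x m).1 - stime (x m).2) ^+ 2 <= C.
  have := DxP m P0 KP0; have := cmax (x m) (mem_set (xP m).1); rewrite /D /C; lra.
have PQ : stime P = stime Q.
  apply/eqP; rewrite -subr_eq0 -sqrf_eq0 eq_le sqr_ge0 andbT.
  apply: (cvg_le_eps sc xU) => eps e0; rewrite add0r; apply: oU.
  exists (Num.truncn (C / eps)).+1 => // m /= mC.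
  have m0 : (0 < m)%N by rewrite (leq_trans _ mC).
  have mC' : C <= m%:R * eps.
    rewrite -ler_pdivrMr//; apply: (le_trans (ltW (truncnS_gt _))).
    by rewrite ler_nat.
  by rewrite -(@ler_pM2l _ m%:R) ?ltr0n// (le_trans (sxC m)).
exists P, Q; split => //.
  (* [cvg_le_eps] passes upper bounds to the limit; the lower bound by the diagonal value is
     obtained from it by a change of sign. *)
  move=> P' KP'; rewrite -lerN2.
  have Dnc : continuous (fun PQ => 0 - doubled w1 w2 A B zeta PQ).
    by apply: continuousB_fun => //; exact: cst_continuous.
  have := @cvg_le_eps R nat U _ _ x (P, Q) _ (- doubled w1 w2 A B zeta (P', P')) Dnc xU.
  rewrite sub0r; apply => eps e0; apply: nearW => m.
  by rewrite sub0r; have := DxP m P' KP'; have := Dle m; lra.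
move=> PT.
pose E (PQ : X * X) := 2 * A * dot (spos PQ.1 - spos PQ.2) (drift PQ.1 - drift PQ.2) +
    (f (endpoint PQ.1) - f (endpoint PQ.2)) +
    n%:R * enorm ((2 * B) *: (penalty_grad PQ.1 PQ.2 + penalty_grad PQ.2 PQ.1)).
have Ec : continuous (fun PQ => 0 - E PQ).
  apply: continuousB_fun; first exact: cst_continuous.
  have pc := @spos_continuous R p hp T a e l.
  have fec : continuous (fun P => f (endpoint P)).
    exact: continuous_comp_fun endpoint_continuous fc.
  apply: continuousD_fun; first apply: continuousD_fun.
  - apply: continuousM_cst; apply: dot_continuous; apply: continuousB_norm;
    (apply: fst_comp_continuous || apply: snd_comp_continuous) => //; exact: drift_continuous.
  - apply: continuousB_fun; [exact: (fst_comp_continuous fec)|exact: (snd_comp_continuous fec)].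
  - apply: continuousM_cst; apply: enorm_continuous.
    have swc : continuous (fun PQ : X * X => penalty_grad PQ.2 PQ.1).
      have swap : continuous (fun PQ : X * X => (PQ.2, PQ.1)).
        by apply: pair_continuous => S; [exact: cvg_snd|exact: cvg_fst].
      exact: (continuous_comp_fun swap penalty_grad2_continuous).
    have := continuousD_norm penalty_grad2_continuous swc.
    move=> /(@affine_continuous _ _ _ (2 * B) 0).
    by under eq_fun do rewrite subr0.
have EPQ : E (P, Q) = 2 * A * dot (spos P - spos Q) (drift P - drift Q) + (f (endpoint P) - f (endpoint Q)).
  by rewrite /E /= (penalty_grad_antisym T0 a01 PQ) addNr scaler0 enorm0 mulr0 addr0.
rewrite -EPQ -lerN2 -[leLHS]sub0r.
apply: (@cvg_le_eps R nat U _ _ x (P, Q) _ (- zeta) Ec xU) => eps e0.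
have tx : \forall m \near U, stime (x m).1 < T /\ stime (x m).2 < T.
  have s1c := fst_comp_continuous (@stime_continuous R p hp T a e l).
  have s2c := snd_comp_continuous (@stime_continuous R p hp T a e l).
  have Tt0 : 0 < T - stime P by rewrite subr_gt0.
  have /cvgrPdist_lt /(_ _ Tt0) h1 : (fun m => stime (x m).1) @ U --> stime P.
    exact: (comp_cvg s1c xU).
  have /cvgrPdist_lt /(_ _ Tt0) h2 : (fun m => stime (x m).2) @ U --> stime Q.
    exact: (comp_cvg s2c xU).
  apply: filterS2 h1 h2 => m; rewrite -PQ !ltr_distlC => /andP[_ h1] /andP[_ h2]; split; lra.
apply: filterS tx => m [t1 t2].
have [[K1 K2] mmax] := xP m.
have := @doubled_viscosity n k w1 w2 A B zeta m%:R (x m).1 (x m).2 k0 sub sup K1 K2 t1 t2.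
rewrite -/(E (x m)) => h; have : zeta <= E (x m).
  apply: h => P' Q' KP' KQ'; have := mmax (P', Q') (conj KP' KQ').
  by rewrite /D; case: (x m).
by rewrite sub0r -lerN2 => zE; rewrite (le_trans zE)// lerDl ltW.
Qed.

End doubling_of_variables.

(** * Comparison for the truncated problems *)

Section comparison.
Context {R : realType} {p : R} {hp : 2 <= p} {T a : R} {d e l : nat}.
Notation mu := (@lebesgue_measure R).
Hypotheses (T0 : 0 < T) (a01 : 0 < a < 1).
Local Notation X := (state hp T a e l).

Lemma AC_ball_le (k k' : nat) (g : ACpath T a l) : (k <= k')%N -> AC_ball k g -> AC_ball k' g.
Proof.
move=> kk' [g0 gk]; split; first by rewrite (le_trans g0)// ler_nat.
by rewrite (le_trans gk)// lee_fin ler_nat.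
Qed.

Lemma AC_ball_exists (g : ACpath T a l) : exists2 k, (0 < k)%N & AC_ball k g.
Proof.
have [[_ uoo] _] := fracDP g.
pose M := enorm (g 0) + fine (Linf_norm T (fracD g)).
have M0 : 0 <= fine (Linf_norm T (fracD g)) by rewrite fine_ge0// Lnorm_ge0.
have MN := ltW (truncnS_gt M); exists (Num.truncn M).+1 => //; split.
  by rewrite (le_trans _ MN)// lerDl.
rewrite -(@fineK _ (Linf_norm T (fracD g))); last by rewrite ge0_fin_numE// Lnorm_ge0.
by rewrite lee_fin (le_trans _ MN)// lerDr enorm_ge0.
Qed.

(** The order of quantifiers matters: [C] is chosen before [delta], so the estimate at the
    maximizers does not degrade when delta = 1/A tends to 0, and only [D], which is absorbed by the
    weight [B], may grow. The second conclusion controls the end points, at which the drift and [f]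
    are evaluated. *)
Lemma property_L_penalty (w : X -> R) (k k' : nat) (r : R) : (0 < k)%N -> property_L w ->
  (r <= k'%:R) ->
  exists2 C, 0 < C & forall delta : R, 0 < delta ->
  exists2 D, 1 <= D & forall P Q : X, stime P = stime Q ->
    enorm (spos P) <= r -> enorm (spos Q) <= r ->
    AC_ball k (spath P) -> AC_ball k (spath Q) ->
    `|w P - w Q| <= C * (enorm (spos P - spos Q) + (delta + D * Num.sqrt (penalty P Q))) /\
    enorm (spath P (stime P) - spath Q (stime Q)) <= delta + D * Num.sqrt (penalty P Q).
Proof.
move=> k0 wL rk'; pose K := maxn k k'.
have K0 : (0 < K)%N by rewrite leq_max k0.
have [C C0 HC] := wL K K0; have /andP[a0 a1] := a01.
(* [c] collects the two path terms of property (L): the value at [T], and the weighted integral,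
   whose kernel has mass T^a / a. *)
pose c := 1 + T `^ a / a; have c1 : 1 <= c by rewrite lerDl divr_ge0 ?powR_ge0// ltW.
exists (C * c); first by rewrite mulr_gt0// (lt_le_trans _ c1).
move=> delta delta0.
have [D D0 HD] := @stopped_penalty_bound R p hp T a e l T0 a01 k%:R delta (ler0n _ _) delta0.
exists (D + 1) => [|P Q PQ Px Qx Pk Qk]; first by rewrite lerDr.
have [u Pu] := AC_ball_density Pk; have [v Qv] := AC_ball_density Qk.
set S := Num.sqrt (penalty P Q); have S0 : 0 <= S by exact: sqrtr_ge0.
have HE := HD P Q u v PQ Pu Qv; rewrite -/S in HE.
set E := delta + (D + 1) * S.
have DE : delta + D * S <= E by rewrite lerD2l ler_wpM2r// lerDl.
have E0 : 0 <= E by apply: addr_ge0; [exact: ltW|apply: mulr_ge0 => //; exact: addr_ge0].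
split; last first.
  have := HE _ (stimeP P); rewrite /stopped lexx -PQ => h; exact: le_trans h DE.
have kK : (k <= K)%N by rewrite leq_maxl.
have rK : r <= K%:R by rewrite (le_trans rk')// ler_nat leq_maxr.
apply: (le_trans (HC P Q PQ (le_trans Px rK) (le_trans Qx rK) (AC_ball_le kK Pk) (AC_ball_le kK Qk))).
rewrite -mulrA ler_wpM2l ?(ltW C0)//.
set x := enorm (spos P - spos Q); have x0 : 0 <= x by exact: enorm_ge0.
have TT : 0 <= T <= T by rewrite lexx ltW.
have I1 := @weighted_Rintegral_le R a T E
  (fun r => enorm (stopped (stime P) (spath P) r - stopped (stime P) (spath Q) r)) a0 (ltW T0).
have I2 := le_trans (HE T TT) DE.
apply: (@le_trans _ _ (x + E + E * (T `^ a / a))).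
  rewrite lerD//; first by rewrite lerD2l.
  by apply: I1 => s sT; rewrite enorm_ge0 (le_trans (HE s sT)).
have -> : x + E + E * (T `^ a / a) = x + c * E by rewrite /c; ring.
by rewrite [leRHS]mulrDr lerD2r ler_peMl.
Qed.

End comparison.

Section quadratic_bounds.
Context {R : realType}.

Lemma sqr_le_affine (z k : R) : 0 <= k -> z ^+ 2 <= k * (z + 1) -> z <= k + 1.
Proof.
move=> k0; apply: contraTT; rewrite -!ltNge => h.
have : (k + 1) * z < z * z by rewrite ltr_pM2r//; lra.
by rewrite expr2; nra.
Qed.

(** For z = A (x + s) the hypothesis yields z^2 <= 2 C (z + 1), because the term 1/A is scaled to a
    constant. The resulting bound is independent of A. *)
Lemma scaled_sqr_bound (A x s C : R) : 0 < A -> 0 <= x -> 0 <= s -> 0 <= C ->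
  A * (x ^+ 2 + s ^+ 2) <= C * (x + (A^-1 + s)) -> A * (x + s) <= 2 * C + 1.
Proof.
move=> A0 x0 s0 C0 h; apply: sqr_le_affine; first by rewrite mulr_ge0.
have h1 : A * (A * (x ^+ 2 + s ^+ 2)) <= A * (C * (x + (A^-1 + s))) by apply: ler_wpM2l => //; exact: ltW.
have h2 : A * (C * (x + (A^-1 + s))) = C * (A * (x + s) + 1).
  by field; rewrite gt_eqF.
have h3 : (A * (x + s)) ^+ 2 <= 2 * (A * (A * (x ^+ 2 + s ^+ 2))).
  have -> : 2 * (A * (A * (x ^+ 2 + s ^+ 2))) = (A * (x + s)) ^+ 2 + (A * (x - s)) ^+ 2 by ring.
  by rewrite lerDl sqr_ge0.
rewrite (le_trans h3)// -mulrA ler_wpM2l// -h2//.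
Qed.

End quadratic_bounds.

Section truncated_comparison.
Context {R : realType} {p : R} {hp : 2 <= p} {T a : R} {d e l : nat}.
Notation mu := (@lebesgue_measure R).
Hypotheses (T0 : 0 < T) (a01 : 0 < a < 1) (pa : a^-1 < floor_ratio p).
Local Notation X := (state hp T a e l).
Variables (b : 'cV[R]_e * 'cV[R]_l -> 'cV[R]_e)
          (lambda : 'cV[R]_e * 'cV[R]_l -> 'M[R]_(e, d))
          (eta : R -> 'cV[R]_d)
          (f : 'cV[R]_e * 'cV[R]_l -> R) (ftilde : 'cV[R]_l -> R) (C0 : R)
          (g : 'cV[R]_e -> R).
Hypotheses (bc : continuous b) (lc : continuous lambda) (heta : smooth_on T eta)
  (fc : continuous f) (ftC : forall u, - C0 <= ftilde u) (hg : lipschitz g).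

Lemma penalty_refl (P : X) : penalty P P = 0.
Proof.
rewrite /penalty subrr enorm0 expr0n add0r.
have -> : penalty_fun P P = cst 0.
  by apply/funext => s; rewrite /penalty_fun subrr -enorm_sqr enorm0 expr0n.
by rewrite Rintegral_cst_itv ?(ltW T0)// mul0r.
Qed.

Lemma near_invS_le (c eps : R) : 0 < eps -> \forall N \near \oo, c / N.+1%:R <= eps.
Proof.
move=> e0; exists (Num.truncn (c / eps)) => // N /= hN.
rewrite ler_pdivrMr// -ler_pdivrMl// mulrC (le_trans (ltW (truncnS_gt _)))//.
by rewrite ler_nat ltnS.
Qed.

Lemma truncated_comparison n (w1 w2 : X -> R) : property_L w1 ->
  viscosity_subsolution b lambda eta (fun x y u => f (x, y) + ftilde u) g n w1 ->
  viscosity_supersolution b lambda eta (fun x y u => f (x, y) + ftilde u) g n w2 ->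
  forall P, w1 P <= w2 P.
Proof.
move=> w1L sub sup P0; rewrite leNgt; apply/negP => lt0.
pose sigma := w1 P0 - w2 P0; have sigma0 : 0 < sigma by rewrite subr_gt0.
have [k1 k10 P0k1] := AC_ball_exists (spath P0).
pose k := maxn k1 (Num.truncn (enorm (spos P0))).+1.
have k0 : (0 < k)%N by rewrite leq_max k10.
pose K : set X := trunc_domain b lambda eta n k.
have [_ rk [M rM]] := tube_radius_facts T0 b lambda heta k.
have KP0 : K P0.
  split; last by apply: AC_ball_le P0k1; rewrite leq_max /k leq_maxl orbT.
  apply: le_trans (rk _ (stimeP P0)); rewrite (le_trans (ltW (truncnS_gt _)))//.
  by rewrite ler_nat leq_maxr.
(* With this choice zeta (T - t) never exceeds sigma / 2, so half of the gap is left at the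
   maximizers. *)
pose zeta := sigma / (2 * T); have zeta0 : 0 < zeta by rewrite divr_gt0 ?mulr_gt0.
have nk0 : (0 < maxn n k)%N by rewrite leq_max k0 orbT.
have [C C_gt0 HC] := property_L_penalty T0 a01 nk0 w1L (ltW (truncnS_gt M)).
have C_ge0 := ltW C_gt0.
(* One more than the bound of [scaled_sqr_bound]: the end points of the paths differ by up to delta
   = 1/A in addition. *)
pose C2 := 2 * C + 2; have C20 : 0 <= C2 by rewrite addr_ge0// mulr_ge0.
have KM P : K P -> enorm (spos P) <= M by move=> [+ _] => /le_trans; apply; exact: rM (stimeP P).
have /choice[x xP] : forall N : nat, exists PQ : X * X,
    [/\ K PQ.1 /\ K PQ.2, stime PQ.1 = stime PQ.2,
       enorm (spos PQ.1 - spos PQ.2) <= C2 / N.+1%:R /\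
       enorm (spath PQ.1 (stime PQ.1) - spath PQ.2 (stime PQ.2)) <= C2 / N.+1%:R,
       sigma / 2 <= w1 PQ.1 - w2 PQ.2 &
       stime PQ.1 < T -> zeta <= 2 * C2 * enorm (drift b lambda eta PQ.1 - drift b lambda eta PQ.2) +
         (f (endpoint PQ.1) - f (endpoint PQ.2))].
  move=> N; pose A : R := N.+1%:R; have A0 : 0 < A by [].
  have Ai0 : 0 < A^-1 by rewrite invr_gt0.
  have [D D1 HD] := HC A^-1 Ai0.
  have D0 : 0 <= D by rewrite (le_trans ler01).
  (* With B = A D^2 the weighted penalty is A s^2, where s is [D] times the root of the penalty, so
     positions and paths enter [scaled_sqr_bound] symmetrically. *)
  have B0 : 0 <= A * D ^+ 2 by rewrite mulr_ge0 ?sqr_ge0 ?(ltW A0).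
  have [P [Q [KP KQ PQ opt drift_le]]] := @doubling R p hp T a d e l T0 a01 pa b lambda eta f ftilde C0 g
    bc lc heta fc ftC n k w1 w2 A (A * D ^+ 2) zeta k0 (ex_intro _ P0 KP0) sub sup.
  have diag S : doubled w1 w2 A (A * D ^+ 2) zeta (S, S) = w1 S - w2 S - zeta * (T - stime S).
    by rewrite /doubled /= subrr enorm0 penalty_refl expr0n !mulr0 !subr0.
  have [h1 h2] := HD P Q PQ (KM P KP) (KM Q KQ) KP.2 KQ.2.
  set xi := enorm (spos P - spos Q) in h1; have xi0 : 0 <= xi by exact: enorm_ge0.
  set s := D * Num.sqrt (penalty P Q) in h1 h2.
  have s0 : 0 <= s by rewrite mulr_ge0 ?sqrtr_ge0.
  have dE : doubled w1 w2 A (A * D ^+ 2) zeta (P, Q) =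
      w1 P - w2 Q - A * (xi ^+ 2 + s ^+ 2) - zeta * (T - stime P).
    have -> : s ^+ 2 = D ^+ 2 * penalty P Q by rewrite exprMn sqr_sqrtr// penalty_ge0.
    by rewrite /doubled /= -/xi; ring.
  (* Comparison with the diagonal point (Q, Q): [w2 Q] cancels, and so do the zeta terms since the
     times agree. What is left is an increment of [w1], to which property (L) applies. *)
  have quad : A * (xi ^+ 2 + s ^+ 2) <= C * (xi + (A^-1 + s)).
    have := opt Q KQ; rewrite diag dE PQ => h.
    apply: le_trans h1; apply: le_trans (ler_norm _).
    by move: h; move: (A * _) (zeta * _) (w1 P) (w1 Q) (w2 Q) => z1 z2 z3 z4 z5; lra.
  have Axs := scaled_sqr_bound A0 xi0 s0 C_ge0 quad.
  have xis : xi + s <= (2 * C + 1) / A by rewrite ler_pdivlMr// mulrC.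
  have CA : (2 * C + 1) / A <= C2 / A by rewrite ler_pM2r ?invr_gt0// lerD2l (ler_nat _ 1 2).
  have xiA : xi <= C2 / A by rewrite (le_trans _ CA)// (le_trans _ xis)// lerDl.
  have yA : enorm (spath P (stime P) - spath Q (stime Q)) <= C2 / A.
    rewrite (le_trans h2)// (_ : C2 / A = A^-1 + (2 * C + 1) / A).
      by rewrite lerD2l (le_trans _ xis)// lerDr.
    by rewrite /C2; field; rewrite gt_eqF.
  exists (P, Q); split => //=.
    have := opt P0 KP0; rewrite diag dE -/sigma.
    have zT : zeta * (T - stime P0) <= sigma / 2.
      have -> : sigma / 2 = zeta * T by rewrite /zeta; field; rewrite gt_eqF.
      by rewrite ler_wpM2l ?(ltW zeta0)// gerBl; case/andP: (stimeP P0).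
    have zP : 0 <= zeta * (T - stime P).
      by rewrite mulr_ge0 ?(ltW zeta0)// subr_ge0; case/andP: (stimeP P).
    have A1 : 0 <= A * (xi ^+ 2 + s ^+ 2) by rewrite mulr_ge0 ?(ltW A0)// addr_ge0 ?sqr_ge0.
    move: zT zP A1; move: (zeta * _) (zeta * _) (A * _) (w1 P) (w2 Q) => z1 z2 z3 z4 z5; lra.
  (* The large factor A is absorbed by the bound C2 / A on the distance of the positions, which
     leaves a coefficient independent of N. *)
  move=> /drift_le h; apply: (le_trans h); rewrite lerD2r -!mulrA ler_wpM2l//.
  set Dr := drift _ _ _ P - _.
  apply: (@le_trans _ _ (A * (xi * enorm Dr))).
    by rewrite ler_wpM2l ?(ltW A0)// dot_le.
  by rewrite mulrA ler_wpM2r ?enorm_ge0// mulrC -ler_pdivlMr.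
have Kc : compact (K `*` K).
  by apply: compact_setX; exact: (@trunc_domain_compact R p hp T a d e l T0 a01 pa).
have [U [UU oU]] := @ultraFilterLemma nat \oo _.
have [[P Q] [/= KP KQ] xU] : exists2 PQ : X * X, (K `*` K) PQ & x @ U --> PQ.
  by apply: (ultra_cvg_compact Kc); apply: nearW => N; have [] := xP N.
have smallU (u : X * X -> R) : continuous u -> (forall N, u (x N) <= C2 / N.+1%:R) -> u (P, Q) <= 0.
  move=> uc ux; apply: (cvg_le_eps uc xU) => eps eps0; apply: oU.
  have := @near_invS_le C2 eps eps0; apply: filterS => N h.
  by rewrite add0r (le_trans (ux N)).
(* [P] and [Q] may still carry different paths. The drift and [f] depend only on the end point and
   the time, so equality of these two is enough. *)
have ex : endpoint P = endpoint Q.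
  congr (_, _); apply/eqP; rewrite -subr_eq0; apply/eqP/enorm_eq0/eqP;
    rewrite eq_le enorm_ge0 andbT.
  - apply: (smallU (fun PQ => enorm (spos PQ.1 - spos PQ.2))).
      apply: enorm_continuous; apply: continuousB_norm;
      [apply: fst_comp_continuous|apply: snd_comp_continuous]; exact: spos_continuous.
    by move=> N; have [_ _ [h _]] := xP N.
  - apply: (smallU (fun PQ => enorm (spath PQ.1 (stime PQ.1) - spath PQ.2 (stime PQ.2)))).
      apply: enorm_continuous; apply: continuousB_norm.
        exact: (fst_comp_continuous (@spath_stime_continuous R p hp T a e l a01)).
      exact: (snd_comp_continuous (@spath_stime_continuous R p hp T a e l a01)).
    by move=> N; have [_ _ [_ h]] := xP N.
have tPQ : stime P = stime Q.
  apply/eqP; rewrite -subr_eq0 -normr_le0.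
  apply: (smallU (fun PQ => `|stime PQ.1 - stime PQ.2|)).
    have tc := @stime_continuous R p hp T a e l.
    have := continuousB_fun (fst_comp_continuous tc) (snd_comp_continuous tc).
    by move=> h S; apply: cvg_norm; exact: h.
  move=> N; have [_ tN _ _ _] := xP N; have -> : stime (x N).1 - stime (x N).2 = 0 by rewrite tN subrr.
  by rewrite normr0; exact: divr_ge0.
have drPQ : drift b lambda eta P = drift b lambda eta Q by rewrite /drift ex tPQ.
have [L L0 gL] := lipschitz_bound hg.
(* At time [T] both functions are compared with [g], whose increment is at most L C2 / (N + 1),
   eventually below sigma / 4. This contradicts the gap sigma / 2. *)
have tT : \forall N \near U, stime (x N).1 < T.
  apply: oU; have s40 : 0 < sigma / 4 by rewrite divr_gt0.
  have := @near_invS_le (L * C2) _ s40; apply: filterS => N h.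
  have [_ tt [hx _] hs _] := xP N.
  have /andP[_] := stimeP (x N).1; rewrite le_eqVlt => /predU1P[tT|//]; exfalso.
  have [_ subT _] := sub; have [_ supT _] := sup.
  have := subT _ tT; have := supT (x N).2; rewrite -tt => /(_ tT) h2 h1.
  have := gL (spos (x N).1) (spos (x N).2).
  have : L * `|spos (x N).1 - spos (x N).2| <= L * C2 / N.+1%:R.
    by rewrite -mulrA ler_wpM2l ?(ltW L0)// (le_trans (mx_norm_le_enorm _)).
  move=> h3 h4; have := le_trans (ler_norm _) (le_trans h4 (le_trans h3 h)).
  lra.
pose E (PQ : X * X) := 2 * C2 * enorm (drift b lambda eta PQ.1 - drift b lambda eta PQ.2) +
  (f (endpoint PQ.1) - f (endpoint PQ.2)).
have EPQ : E (P, Q) = 0 by rewrite /E /= drPQ ex !subrr enorm0 mulr0 addr0.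
have Ec : continuous (fun PQ => 0 - E PQ).
  apply: continuousB_fun; first exact: cst_continuous.
  have fec := continuous_comp_fun (@endpoint_continuous R p hp T a e l a01) fc.
  apply: continuousD_fun; last exact: continuousB_fun (fst_comp_continuous fec) (snd_comp_continuous fec).
  have dc := @drift_continuous R p hp T a d e l T0 a01 b lambda eta bc lc heta.
  apply: continuousM_cst; apply: enorm_continuous.
  exact: continuousB_norm (fst_comp_continuous dc) (snd_comp_continuous dc).
have : 0 - E (P, Q) <= - zeta.
  apply: (cvg_le_eps Ec xU) => eps eps0; apply: filterS tT => N tN.
  have [_ _ _ _ /(_ tN) h] := xP N.
  apply: (@le_trans _ _ (- zeta)); first by rewrite sub0r lerN2.
  by rewrite lerDl ltW.
by rewrite EPQ subrr lerNr oppr0 leNgt zeta0.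
Qed.

End truncated_comparison.

Theorem theorem6p7 (R : realType) (d e l : nat) (T : R) (hT : 0 < T)
  (p : R) (hp : 2 <= p) (hpN : p \isn't a Num.nat)
  (alpha : R) (halpha : (Num.truncn p)%:R / p < alpha < 1)
  (kappa : R) (hkappa : 1 < kappa <= (1 - alpha + (Num.truncn p)%:R / p)^-1)
  (q : R) (hq : Num.max ((Num.truncn p)%:R * p) (kappa / (kappa - 1)) < q)
  (b : 'cV[R]_e * 'cV[R]_l -> 'cV[R]_e) (hb : Lipb b)
  (lambda : 'cV[R]_e * 'cV[R]_l -> 'M[R]_(e, d))
  (hlambda : Cb (Num.truncn p + 1)%N lambda)
  (eta : R -> 'cV[R]_d) (heta : smooth_on T eta)
  (f : 'cV[R]_e * 'cV[R]_l -> R) (hf : Lipb f)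
  (ftilde : 'cV[R]_l -> R) (hftilde : continuous ftilde)
  (f0 C0 : R) (hf0 : 0 < f0) (hC0 : 0 < C0)
  (hcoercive : forall u, f0 * enorm u `^ q - C0 <= ftilde u)
  (g : 'cV[R]_e -> R) (hg : lipschitz g)
  (phi1 phi2 : state hp T alpha e l -> R)
  (hphi1 : continuous phi1) (hphi2 : continuous phi2)
  (phi1n phi2n : nat -> state hp T alpha e l -> R)
  (hcvg1 : {family compact, phi1n @ \oo --> phi1})
  (hcvg2 : {family compact, phi2n @ \oo --> phi2})
  (hsub : forall n, (0 < n)%N ->
    viscosity_subsolution b lambda eta (fun x y u => f (x, y) + ftilde u) g
      n (phi1n n))
  (hsup : forall n, (0 < n)%N ->
    viscosity_supersolution b lambda eta (fun x y u => f (x, y) + ftilde u) g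
      n (phi2n n))
  (hL1 : forall n, (0 < n)%N -> property_L (phi1n n))
  (hL2 : forall n, (0 < n)%N -> property_L (phi2n n))
  (hterminal : forall n, (0 < n)%N -> forall P, stime P = T ->
    phi1n n P = g (spos P) /\ phi2n n P = g (spos P)) :
  forall P, phi1 P <= phi2 P.
Proof.
have p0 : 0 < p by rewrite (lt_le_trans _ hp).
have tp0 : 0 < (Num.truncn p)%:R :> R by rewrite ltr0n truncn_gt0 (le_trans _ hp)// ler1n.
have /andP[pa1 a1] := halpha.
have a01 : 0 < alpha < 1 by rewrite a1 andbT (lt_trans _ pa1)// divr_gt0.
have a0 : 0 < alpha by case/andP: a01.
(* The lower bound on alpha in the form that [rvar_small] uses: the variation exponent exceeds the
   reciprocal of the Hoelder exponent. *)
have pa : alpha^-1 < floor_ratio p.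
  by rewrite /floor_ratio -[ltRHS]invf_div ltf_pV2 ?posrE ?divr_gt0.
have bc : continuous b := lipschitz_continuous hb.2.
have lc : continuous lambda by move: hlambda; rewrite addn1 => -[].
have fc : continuous f := lipschitz_continuous hf.2.
have ftC u : - C0 <= ftilde u.
  by apply: le_trans (hcoercive u); rewrite lerDr mulr_ge0 ?powR_ge0// ltW.
have le_n n P : (0 < n)%N -> phi1n n P <= phi2n n P.
  move=> n0; exact: (truncated_comparison hT a01 pa bc lc heta fc ftC hg (hL1 n n0) (hsub n n0) (hsup n n0)).
(* Singletons are compact, so locally uniform convergence contains pointwise convergence, which
   suffices to pass to the limit in the inequality. *)
have pointwise (phin : nat -> state hp T alpha e l -> R) phi P :
    {family compact, phin @ \oo --> phi} -> (fun n => phin n P) @ \oo --> phi P.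
  by move=> /fam_cvgP /(_ [set P] (@compact_set1 _ P)); rewrite uniform_set1.
move=> P; apply: (ler_cvg_to (pointwise _ _ P hcvg1) (pointwise _ _ P hcvg2)).
by exists 1%N => // n /= n1; exact: le_n.
Qed.
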